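(* All maximal independent sets of a $2$-threshold graph on $n$ vertices can be enumerated in time $O(n^3)$ and counted in time $O(n^2)$.
   Context: All graphs are finite, simple and undirected. A threshold graph is a graph $H=(V,F)$ for which there exist non-negative reals $w_v$ ($v\in V$) and $T$ such that $U\subseteq V$ is independent in $H$ if and only if $\sum_{v\in U}w_v\le T$. Equivalently, $H$ has no induced $C_4$, $P_4$ or $2K_2$. A graph $G=(V,E)$ is $2$-threshold if there are threshold graphs $G_1=(V,E_1)$ and $G_2=(V,E_2)$ with $E=E_1\cup E_2$. A maximal independent set is an independent set not properly contained in another independent set. *)

(* Defs.v *)
From mathcomp Require Import all_boot all_order all_algebra.
From mathcomp Require Import reals.
Set Implicit Arguments.
Unset Strict Implicit.
Unset Printing Implicit Defensive.

Definition simple_graph (V : finType) (e : rel V) : Prop :=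
  symmetric e /\ irreflexive e.

Definition independent (V : finType) (e : rel V) (U : {set V}) : bool :=
  [forall x in U, forall y in U, ~~ e x y].

Definition maximal_independent (V : finType) (e : rel V) (U : {set V}) : bool :=
  maxset (independent e) U.

Definition threshold_graph (R : realType) (V : finType) (e : rel V) : Prop :=
  simple_graph e /\
  exists (w : V -> R) (T : R),
    [/\ forall v, (0 <= w v)%R, (0 <= T)%R &
        forall U : {set V}, independent e U <-> (\sum_(v in U) w v <= T)%R].

Definition two_threshold_graph (R : realType) (V : finType) (e : rel V) : Prop :=
  exists e1 e2 : rel V,
    [/\ threshold_graph R e1, threshold_graph R e2 &
        forall x y, e x y = e1 x y || e2 x y].

(* Word RAM with structured control flow: every assignment, memory access,  *)
(* output and test costs 1.  Registers and memory cells are indexed by nat; *)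
(* memory is addressed indirectly, through registers.                       *)

Inductive cmd : Type :=
| Skip
| Const of nat & nat              (* r := k *)
| Add of nat & nat & nat          (* r := a + b *)
| Sub of nat & nat & nat          (* r := a - b, truncated at 0 *)
| Mul of nat & nat & nat          (* r := a * b *)
| Read of nat & nat               (* r := mem[a] *)
| Write of nat & nat              (* mem[a] := b *)
| Emit of nat                     (* append a to the output *)
| Seq of cmd & cmd
| IfLt of nat & nat & cmd & cmd   (* if a < b then _ else _ *)
| WhileLt of nat & nat & cmd.     (* while a < b do _ *)

Record state := State { reg : nat -> nat; mem : nat -> nat; out : seq nat }.

Definition upd (f : nat -> nat) (i v : nat) : nat -> nat :=
  fun j => if j == i then v else f j.

Definition set_reg (s : state) (r v : nat) : state :=
  State (upd (reg s) r v) (mem s) (out s).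

(* exec B p s t s' : started in s, the program p halts in s' after t steps, *)
(* and every number it computes is smaller than B.  A run that would create *)
(* a number >= B is stuck, i.e. has no derivation.                          *)
Inductive exec (B : nat) : cmd -> state -> nat -> state -> Prop :=
| exec_skip s : exec B Skip s 0 s
| exec_const r k s : k < B -> exec B (Const r k) s 1 (set_reg s r k)
| exec_add r a b s : reg s a + reg s b < B ->
    exec B (Add r a b) s 1 (set_reg s r (reg s a + reg s b))
| exec_sub r a b s :
    exec B (Sub r a b) s 1 (set_reg s r (reg s a - reg s b))
| exec_mul r a b s : reg s a * reg s b < B ->
    exec B (Mul r a b) s 1 (set_reg s r (reg s a * reg s b))
| exec_read r a s :
    exec B (Read r a) s 1 (set_reg s r (mem s (reg s a)))
| exec_write a b s :
    exec B (Write a b) s 1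
      (State (reg s) (upd (mem s) (reg s a) (reg s b)) (out s))
| exec_emit a s :
    exec B (Emit a) s 1 (State (reg s) (mem s) (rcons (out s) (reg s a)))
| exec_seq p q s1 s2 s3 t1 t2 :
    exec B p s1 t1 s2 -> exec B q s2 t2 s3 -> exec B (Seq p q) s1 (t1 + t2) s3
| exec_if_true a b p q s s' t :
    reg s a < reg s b -> exec B p s t s' -> exec B (IfLt a b p q) s t.+1 s'
| exec_if_false a b p q s s' t :
    reg s b <= reg s a -> exec B q s t s' -> exec B (IfLt a b p q) s t.+1 s'
| exec_while_end a b p s :
    reg s b <= reg s a -> exec B (WhileLt a b p) s 1 s
| exec_while_loop a b p s1 s2 s3 t1 t2 :
    reg s1 a < reg s1 b -> exec B p s1 t1 s2 ->
    exec B (WhileLt a b p) s2 t2 s3 ->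
    exec B (WhileLt a b p) s1 (t1 + t2).+1 s3.

(* The input is n in register 0 and the adjacency matrix, row by row, in    *)
(* memory cells 0, ..., n * n - 1; everything else is 0.                    *)
Definition input_state (n : nat) (e : rel 'I_n) : state :=
  State (upd (fun=> 0) 0 n)
        (fun a => [exists i : 'I_n, exists j : 'I_n, (a == i * n + j) && e i j]
                  : nat)
        [::].

Definition bigO (f g : nat -> nat) : Prop :=
  exists C n0 : nat, forall n, n0 <= n -> f n <= C * g n.

(* One fixed program works for all n; the bound n.+2 ^ c on the numbers it  *)
(* may use, with c constant, means words of O(log n) bits.                  *)
Definition computable_in_time
    (inputs : forall n, rel 'I_n -> Prop)
    (correct : forall n, rel 'I_n -> seq nat -> Prop)
    (g : nat -> nat) : Prop :=
  exists (p : cmd) (c : nat) (f : nat -> nat), bigO f g /\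
    forall n (e : rel 'I_n), inputs n e ->
      exists t s, [/\ exec (n.+2 ^ c) p (input_state e) t s, t <= f n &
                      correct n e (out s)].

(* A vertex set is output as its cardinality followed by its elements. *)
Definition encode_set (n : nat) (U : {set 'I_n}) : seq nat :=
  #|U| :: [seq val v | v <- enum U].

Definition enumerates_maximal_independent (n : nat) (e : rel 'I_n)
    (o : seq nat) : Prop :=
  exists L : seq {set 'I_n},
    [/\ uniq L, forall U, (U \in L) = maximal_independent e U &
        o = flatten [seq encode_set U | U <- L]].

Definition counts_maximal_independent (n : nat) (e : rel 'I_n)
    (o : seq nat) : Prop :=
  o = [:: #|[set U : {set 'I_n} | maximal_independent e U]|].

(* Main.v *)
Require Import Defs.
From mathcomp Require Import all_boot all_order all_algebra.
From mathcomp Require Import reals.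
From mathcomp Require Import zify lra.
Set Implicit Arguments.
Unset Strict Implicit.
Unset Printing Implicit Defensive.
Import Order.TTheory GRing.Theory Num.Theory.

(* Write [u ~ v] iff [A < a u + a v] or [B < b u + b v], and call [u] small if
   [2 a u <= A] and [2 b u <= B].  The small vertices form an independent set [I];
   among the others no three are pairwise non-adjacent, and the non-neighbours of
   such a vertex have nested neighbourhoods in [I].  Hence a maximal independent
   set is [I] minus the neighbours of the at most two non-small vertices it
   contains, and all of them can be listed or counted once [I] is known.

   The weights are not part of the input.  Any labelling "in I / not in I" for
   which [I] is independent and the rest contains no independent triple has at
   most four errors, and every violated condition is witnessed by at most five
   vertices, one of them labelled wrongly.  So two correctly labelled halves are
   merged by a search tree of depth 8 that flips certificate vertices; as each
   check is quadratic, divide and conquer takes quadratic time altogether.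
   Independent triples are detected in quadratic time because in the complement
   of a 2-threshold graph every odd closed walk backtracks or has three
   consecutive vertices forming a triangle: it is enough to test the edges of a
   spanning forest.

   The algorithm is written in a small language of bounded loops whose addition
   saturates at [cap n], so that all numbers are polynomially bounded, and
   compiled to the word RAM. *)

(** Smallness depends on the chosen weights, so the labelling finally used may still differ from it.
    The listing relies only on the three conditions that are tested: no edge inside [I], no
    independent triple outside, and for each outside vertex a correct flag telling whether it can be
    the only outside vertex of a maximal set. The bound four splits into two vertices wrongly put in
    [I] and two wrongly left out; merging two halves doubles it, hence depth 8, and a tree with five
    branches per node has constant size. The flags are what forces certificates of five vertices.
    Nestedness reduces the test for [u] to its outside non-neighbour [y] of least degree into [I]; a
    failure of nestedness shows up as [u], [y], a further non-neighbour [z] and two vertices of [I]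
    on which [y] and [z] cross. Repairing a block of length 2L costs O(L^2), so one level costs
    O(nL), and doubling L sums to O(n^2). The O(n^2) resulting sets cost constant time each to count
    and linear time each to print. *)

Lemma upd_eq f i v : upd f i v i = v.
Proof. by rewrite /upd eqxx. Qed.

Lemma upd_neq f i v j : j != i -> upd f i v j = f j.
Proof. by rewrite /upd => /negbTE ->. Qed.

(** * A language of bounded loops *)

Inductive exp : Type :=
| V of nat
| N of nat
| Plus of exp & exp
| Minus of exp & exp
| Arr of nat & exp
| Adj of exp & exp.

Inductive bexp : Type :=
| Lt of exp & exp
| Not of bexp
| And of bexp & bexp.

Inductive prog : Type :=
| Nop
| Asg of nat & exp
| Sto of nat & exp & exp
| Out of exp
| Sq of prog & prog
| If of bexp & prog & prog
| For of nat & nat & prog.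

(* [ck] is a clock: it bounds the running time of the compiled program. *)
Record st := St
  { vr : nat -> nat; ar : nat -> nat -> nat; ot : seq nat; ck : nat }.

Definition setv x v s := St (upd (vr s) x v) (ar s) (ot s) (ck s).
Definition seta k i v s :=
  St (vr s) (fun k' i' => if (k' == k) && (i' == i) then v else ar s k' i')
     (ot s) (ck s).
Definition tick c s := St (vr s) (ar s) (ot s) (c + ck s).
Definition emit v s := St (vr s) (ar s) (rcons (ot s) v) (ck s).

Fixpoint ecost e :=
  match e with
  | V _ | N _ => 1
  | Plus a b => ecost a + ecost b + 3
  | Minus a b => ecost a + ecost b + 1
  | Arr _ a => ecost a + 5
  | Adj a b => ecost a + ecost b + 5
  end.

Fixpoint bcost b :=
  match b with
  | Lt x y => ecost x + ecost y + 1
  | Not b => bcost b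
  | And b c => bcost b + bcost c
  end.

Fixpoint writes p (r : nat) :=
  match p with
  | Asg x _ => r == x
  | Sq p q | If _ p q => writes p r || writes q r
  | For x _ p => (r == x) || writes p r
  | _ => false
  end.

Fixpoint writes_array p (k : nat) :=
  match p with
  | Sto k' _ _ => k == k'
  | Sq p q | If _ p q => writes_array p k || writes_array q k
  | For _ _ p => writes_array p k
  | _ => false
  end.

Fixpoint emits p :=
  match p with
  | Out _ => true
  | Sq p q | If _ p q => emits p || emits q
  | For _ _ p => emits p
  | _ => false
  end.

Fixpoint wfe e :=
  match e with
  | V _ => true
  | N k => k < 8
  | Plus a b | Minus a b | Adj a b => wfe a && wfe b
  | Arr k a => (k < 8) && wfe a
  end.

Fixpoint wfb b :=
  match b with
  | Lt x y => wfe x && wfe y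
  | Not b => wfb b
  | And b c => wfb b && wfb c
  end.

(** Arrays are interleaved eight cells apart, so their indices stay below 8, as do constants. A loop
    may alter neither its counter nor its bound, so that a while loop can imitate it. *)
Fixpoint wf p :=
  match p with
  | Nop => true
  | Asg _ e | Out e => wfe e
  | Sto k a b => [&& k < 8, wfe a & wfe b]
  | Sq p q => wf p && wf q
  | If b p q => [&& wfb b, wf p & wf q]
  | For x y p => [&& x != y, ~~ writes p x, ~~ writes p y & wf p]
  end.

Fixpoint loop (f : nat -> st -> st) j k s :=
  if j is j'.+1 then loop f j' k.+1 (f k s) else s.

Section Semantics.

Variables (n : nat) (g : nat -> nat -> bool).

(** At least 8, so constants fit, and at least (n+1)^2, the number of pairs over 0..n, so the final
    count is never truncated. *)
Definition cap := (n + 2) ^ 3.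

(** [Adj] is 0 out of range, so the index [n] behaves like an isolated extra vertex; the listing
    uses it as a placeholder. *)
Fixpoint ev s e :=
  match e with
  | V x => vr s x
  | N k => k
  | Plus a b => minn (ev s a + ev s b) cap
  | Minus a b => ev s a - ev s b
  | Arr k a => ar s k (ev s a)
  | Adj a b => ((ev s a < n) && (ev s b < n) && g (ev s a) (ev s b)) : nat
  end.

Fixpoint evb s b :=
  match b with
  | Lt x y => ev s x < ev s y
  | Not b => ~~ evb s b
  | And b c => evb s b && evb s c
  end.

Fixpoint eval p s :=
  match p with
  | Nop => s
  | Asg x e => tick (ecost e).+1 (setv x (ev s e) s)
  | Sto k a b => tick (ecost a + ecost b + 5) (seta k (ev s a) (ev s b) s)
  | Out e => tick (ecost e).+1 (emit (ev s e) s)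
  | Sq p q => eval q (eval p s)
  | If b p q => if evb s b then eval p (tick (bcost b) s)
                else eval q (tick (bcost b) s)
  | For x y p =>
      tick 2 (loop (fun k s' => tick 2 (setv x k.+1 (eval p s')))
                (vr s y) 0 (setv x 0 s))
  end.

(** The three write predicates compute, so most framing conditions on concrete programs are closed
    by [isT]. *)
Definition frame p s s' :=
  [/\ forall r, ~~ writes p r -> vr s' r = vr s r,
      forall k, ~~ writes_array p k -> ar s' k = ar s k
    & ~~ emits p -> ot s' = ot s].

Lemma frame_eval p s : frame p s (eval p s).
Proof.
elim: p s => [|x e|k a b|e|p IHp q IHq|b p IHp q IHq|x y p IHp] s /=;
  split => //=.
- by move=> r; rewrite /upd => /negbTE ->.
- by move=> j /negbTE ->.
- move=> r /norP [hp hq].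
  by have [-> // _ _] := IHq (eval p s); have [-> // _ _] := IHp s.
- move=> r /norP [hp hq].
  by have [_ -> // _] := IHq (eval p s); have [_ -> // _] := IHp s.
- move=> /norP [hp hq].
  by have [_ _ -> //] := IHq (eval p s); have [_ _ -> //] := IHp s.
- move=> r /norP [hp hq]; case: ifP => _.
    by have [-> // _ _] := IHp (tick (bcost b) s).
  by have [-> // _ _] := IHq (tick (bcost b) s).
- move=> r /norP [hp hq]; case: ifP => _.
    by have [_ -> // _] := IHp (tick (bcost b) s).
  by have [_ -> // _] := IHq (tick (bcost b) s).
- move=> /norP [hp hq]; case: ifP => _.
    by have [_ _ ->] := IHp (tick (bcost b) s).
  by have [_ _ ->] := IHq (tick (bcost b) s).
- move=> r /norP [rx rp].
  suff H j k s' : vr s' r = vr s r -> vr (loop (fun k s' =>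
      tick 2 (setv x k.+1 (eval p s'))) j k s') r = vr s r.
    by apply: H; rewrite /= upd_neq.
  elim: j k s' => [|j IHj] k s' E //=; apply: IHj.
  by rewrite /= upd_neq //; have [-> // _ _] := IHp s'.
- move=> r rp.
  suff H j k s' : ar s' r = ar s r -> ar (loop (fun k s' =>
      tick 2 (setv x k.+1 (eval p s'))) j k s') r = ar s r by apply: H.
  elim: j k s' => [|j IHj] k s' E //=; apply: IHj.
  by have [_ /= -> // _] := IHp s'.
- move=> rp.
  suff H j k s' : ot s' = ot s -> ot (loop (fun k s' =>
      tick 2 (setv x k.+1 (eval p s'))) j k s') = ot s by apply: H.
  elim: j k s' => [|j IHj] k s' E //=; apply: IHj.
  by have [_ _ /= -> //] := IHp s'.
Qed.

(** The step case also receives the frame with respect to the state before the loop, so an invariant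
    need mention only what the body changes. *)
Lemma for_ind (Inv : nat -> st -> Prop) x y p s :
  Inv 0 (setv x 0 s) ->
  (forall k s', k < vr s y -> frame (For x y p) s s' -> vr s' x = k ->
     Inv k s' -> Inv k.+1 (tick 2 (setv x k.+1 (eval p s')))) ->
  exists s', [/\ Inv (vr s y) s', frame (For x y p) s s'
    & eval (For x y p) s = tick 2 s'].
Proof.
move=> I0 IS; rewrite /=; pose f k s' := tick 2 (setv x k.+1 (eval p s')).
suff H j k s' : k + j = vr s y -> frame (For x y p) s s' -> vr s' x = k ->
    Inv k s' -> Inv (vr s y) (loop f j k s') /\ frame (For x y p) s (loop f j k s').
  exists (loop f (vr s y) 0 (setv x 0 s)).
  have [||//|//|] := H (vr s y) 0 (setv x 0 s) => //; last by rewrite /= upd_eq.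
  by split=> //= r /norP [rx _]; rewrite upd_neq.
elim: j k s' => [|j IHj] k s' /=; first by rewrite addn0 => <-.
move=> hk hF hx hI; have [F1 F2 F3] := hF; have [G1 G2 G3] := frame_eval p s'.
apply: IHj; [by lia| |by rewrite /= upd_eq|by apply: IS => //; lia].
split=> /=.
- by move=> r hr; have /norP [rx rp] := hr; rewrite upd_neq // G1 // F1.
- by move=> r hr; rewrite G2 // F2.
- by move=> hr; rewrite G3 // F3.
Qed.

Fixpoint fcost p :=
  match p with
  | Nop => 0
  | Asg _ e | Out e => (ecost e).+1
  | Sto _ a b => ecost a + ecost b + 5
  | Sq p q => fcost p + fcost q
  | If b p q => bcost b + fcost p + fcost q
  | For _ _ p => fcost p + 4
  end.

Fixpoint depth p :=
  match p with
  | Sq p q | If _ p q => maxn (depth p) (depth q)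
  | For _ _ p => (depth p).+1
  | _ => 0
  end.

Fixpoint bounded_by (h : nat) p :=
  match p with
  | Sq p q | If _ p q => bounded_by h p && bounded_by h q
  | For _ y p => (y == h) && bounded_by h p
  | _ => true
  end.

(** All loops run [vr s h] times, so nesting depth becomes the exponent. The successor keeps the
    base positive, which makes powers monotone in the depth even when the bound is 0. *)
Lemma eval_cost (h : nat) p s : bounded_by h p -> ~~ writes p h ->
  ck (eval p s) <= ck s + fcost p * (vr s h).+1 ^ depth p.
Proof.
have pos d m : 0 < m.+1 ^ d by rewrite expn_gt0.
have mono c d d' m : d <= d' -> c * m.+1 ^ d <= c * m.+1 ^ d'.
  by move=> hd; rewrite leq_mul2l leq_pexp2l ?orbT.
elim: p s => [|x e|k a b|e|p IHp q IHq|b p IHp q IHq|x y p IHp] s //=.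
- by move=> _ _; lia.
- by rewrite expn0 => _ _; lia.
- by rewrite expn0 => _ _; lia.
- by rewrite expn0 => _ _; lia.
- case/andP=> hp hq /norP [wp wq].
  have := IHq (eval p s) hq wq; have := IHp s hp wp.
  have [-> // _ _] := frame_eval p s.
  have := mono (fcost p) _ _ (vr s h) (leq_maxl (depth p) (depth q)).
  have := mono (fcost q) _ _ (vr s h) (leq_maxr (depth p) (depth q)).
  by lia.
- case/andP=> hp hq /norP [wp wq].
  have := IHq (tick (bcost b) s) hq wq; have := IHp (tick (bcost b) s) hp wp.
  have := mono (fcost p) _ _ (vr s h) (leq_maxl (depth p) (depth q)).
  have := mono (fcost q) _ _ (vr s h) (leq_maxr (depth p) (depth q)).
  have := pos (maxn (depth p) (depth q)) (vr s h).
  by case: ifP => _ /=; nia.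
- case/andP=> /eqP -> hp /norP [hx wp].
  pose c := fcost p * (vr s h).+1 ^ depth p.
  have [|k s' _ [F1 _ _] _ IHk|s' [hI _ E]] := @for_ind
    (fun k s' => ck s' <= ck s + k * (c + 2)) x h p s.
  + by rewrite /=; lia.
  + have /= := IHp s' hp wp; rewrite F1 /= ?(negbTE hx) ?(negbTE wp) //.
    by rewrite -/c; lia.
  + move/(congr1 ck): E => /= ->; rewrite expnS.
    have := pos (depth p) (vr s h); rewrite /c in hI; by nia.
Qed.

End Semantics.

(** * Compilation to the word RAM *)

(* Registers 0 to 5 hold the constants [n], [1], [n * n], [cap n], [8] and [0];
   program variables live in the even registers from 6 on, temporaries in the
   odd ones.  Entry [i] of array [k < 8] is memory cell [n * n + 8 * i + k]. *)
Definition rN := 0.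
Definition r1 := 1.
Definition rNN := 2.
Definition rM := 3.
Definition r8 := 4.
Definition r0 := 5.
Definition va x := x.*2 + 6.
Definition tm d := d.*2 + 7.
Arguments va : simpl never.
Arguments tm : simpl never.

(** Only temporaries of index at least [d] are touched, so a left operand survives the evaluation of
    the right one at [d.+1]. The two subtractions in [Plus] form s - (s - cap n), the minimum of s
    and [cap n]. *)
Fixpoint cexp d e : cmd :=
  match e with
  | V x => Add (tm d) (va x) r0
  | N k => Const (tm d) k
  | Plus a b =>
      Seq (cexp d a) (Seq (cexp d.+1 b) (Seq (Add (tm d) (tm d) (tm d.+1))
        (Seq (Defs.Sub (tm d.+1) (tm d) rM) (Defs.Sub (tm d) (tm d) (tm d.+1)))))
  | Minus a b =>
      Seq (cexp d a) (Seq (cexp d.+1 b) (Defs.Sub (tm d) (tm d) (tm d.+1)))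
  | Arr k a =>
      Seq (cexp d a) (Seq (Mul (tm d) (tm d) r8) (Seq (Add (tm d) (tm d) rNN)
        (Seq (Const (tm d.+1) k) (Seq (Add (tm d) (tm d) (tm d.+1))
           (Read (tm d) (tm d))))))
  | Adj a b =>
      Seq (cexp d a) (Seq (cexp d.+1 b)
        (IfLt (tm d) rN
          (IfLt (tm d.+1) rN
             (Seq (Mul (tm d) (tm d) rN) (Seq (Add (tm d) (tm d) (tm d.+1))
                (Read (tm d) (tm d))))
             (Const (tm d) 0))
          (Const (tm d) 0)))
  end.

(** Negation swaps the branches and conjunction copies one of them, so no truth value is stored.
    Copying enlarges the program but not its running time. *)
Fixpoint cif b (p q : cmd) : cmd :=
  match b with
  | Lt x y => Seq (cexp 0 x) (Seq (cexp 1 y) (IfLt (tm 0) (tm 1) p q))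
  | Not b => cif b q p
  | And b c => cif b (cif c p q) q
  end.

Fixpoint comp p : cmd :=
  match p with
  | Nop => Skip
  | Asg x e => Seq (cexp 0 e) (Add (va x) (tm 0) r0)
  | Sto k a b =>
      Seq (cexp 0 a) (Seq (cexp 1 b) (Seq (Mul (tm 0) (tm 0) r8)
        (Seq (Add (tm 0) (tm 0) rNN) (Seq (Const (tm 2) k)
           (Seq (Add (tm 0) (tm 0) (tm 2)) (Write (tm 0) (tm 1)))))))
  | Out e => Seq (cexp 0 e) (Emit (tm 0))
  | Sq p q => Seq (comp p) (comp q)
  | If b p q => cif b (comp p) (comp q)
  | For x y p =>
      Seq (Const (va x) 0)
        (WhileLt (va x) (va y) (Seq (comp p) (Add (va x) (va x) r1)))
  end.

Section Compilation.

Variables (n : nat) (g : nat -> nat -> bool) (B : nat).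
(** Dominates what compiled code can form, in particular sums up to [2 * cap n] and addresses up to
    [8 * cap n + n * n + 7]. *)
Hypothesis hB : 10 * cap n + n * n + 8 < B.

Let n_cap : n <= cap n.
Proof. by rewrite /cap !expnS; nia. Qed.

Let cap8 : 8 <= cap n.
Proof. by rewrite /cap !expnS; nia. Qed.

Record sim (s : st) (m : state) : Prop := Sim {
  sim_var : forall x, reg m (va x) = vr s x;
  sim_N : reg m rN = n;
  sim_1 : reg m r1 = 1;
  sim_NN : reg m rNN = n * n;
  sim_M : reg m rM = cap n;
  sim_8 : reg m r8 = 8;
  sim_0 : reg m r0 = 0;
  sim_adj : forall i j, i < n -> j < n -> Defs.mem m (i * n + j) = g i j;
  sim_arr : forall k i, k < 8 -> Defs.mem m (n * n + 8 * i + k) = ar s k i;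
  sim_out : out m = ot s;
  sim_vcap : forall x, vr s x <= cap n;
  sim_acap : forall k i, ar s k i <= cap n }.

Lemma ev_cap s m e : sim s m -> wfe e -> ev n g s e <= cap n.
Proof.
move=> hs; elim: e => [x|k|a IHa b IHb|a IHa b IHb|k a IHa|a IHa b IHb] /=.
- by move=> _; apply: (sim_vcap hs).
- by lia.
- by move=> _; rewrite geq_minr.
- by case/andP=> /IHa ? _; lia.
- by move=> _; apply: (sim_acap hs).
- by case: (_ && _); lia.
Qed.

Definition same_but d (m m' : state) :=
  [/\ forall r, (forall j, d <= j -> r != tm j) -> reg m' r = reg m r,
      Defs.mem m' = Defs.mem m & out m' = out m].

Lemma same_but_trans d d' m1 m2 m3 : d <= d' ->
  same_but d m1 m2 -> same_but d' m2 m3 -> same_but d m1 m3.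
Proof.
move=> hd [A1 A2 A3] [C1 C2 C3]; split; [|by rewrite C2|by rewrite C3].
move=> r hr; rewrite C1 ?A1 // => j hj; apply: hr; exact: leq_trans hj.
Qed.

Lemma same_but_set d d' m v : d <= d' -> same_but d m (set_reg m (tm d') v).
Proof.
move=> hd; split=> //= r hr; rewrite upd_neq //; exact: hr.
Qed.

Lemma same_but_set_r d d' m m' v : d <= d' ->
  same_but d m m' -> same_but d m (set_reg m' (tm d') v).
Proof. by move=> hd h; apply: same_but_trans (leqnn d) h (same_but_set _ _ hd). Qed.

Lemma same_but_weak d m m' : same_but d.+1 m m' -> same_but d m m'.
Proof. by case=> A1 A2 A3; split=> // r hr; apply: A1 => j /ltnW; apply: hr. Qed.

Lemma same_but_tm d d' m m' : same_but d' m m' -> d < d' ->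
  reg m' (tm d) = reg m (tm d).
Proof. by case=> H _ _ hd; apply: H => j hj; rewrite /tm; lia. Qed.

Lemma same_but_sim s d m m' : sim s m -> same_but d m m' -> sim s m'.
Proof.
case=> h1 h2 h3 h4 h5 h6 h7 h8 h9 h10 h11 h12 [A1 A2 A3].
split; rewrite ?A2 ?A3 // => *; rewrite A1 // => j _;
  rewrite /va /tm /rN /r1 /rNN /rM /r8 /r0; lia.
Qed.

Lemma cexp_ok s m d e : sim s m -> wfe e ->
  exists t m', [/\ exec B (cexp d e) m t m', t <= ecost e,
    reg m' (tm d) = ev n g s e & same_but d m m'].
Proof.
have tmS d' : tm d'.+1 != tm d' by rewrite /tm; lia.
have tmS' d' : tm d' != tm d'.+1 by rewrite /tm; lia.
elim: e d m => [x|k|a IHa b IHb|a IHa b IHb|k a IHa|a IHa b IHb] d m hs /=.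
- move=> _; exists 1; eexists; split.
  + by apply: exec_add; rewrite (sim_var hs) (sim_0 hs);
       have := sim_vcap hs x; lia.
  + by [].
  + by rewrite /= upd_eq (sim_var hs) (sim_0 hs) addn0.
  + exact: same_but_set.
- move=> hk; exists 1; eexists; split.
  + by apply: exec_const; lia.
  + by [].
  + by rewrite /= upd_eq.
  + exact: same_but_set.
- case/andP=> wa wb.
  have [t1 [m1 [e1 c1 v1 s1]]] := IHa d m hs wa.
  have hs1 := same_but_sim hs s1.
  have [t2 [m2 [e2 c2 v2 s2]]] := IHb d.+1 m1 hs1 wb.
  have hs2 := same_but_sim hs1 s2.
  have v1' : reg m2 (tm d) = ev n g s a by rewrite (same_but_tm s2).
  have capa := ev_cap hs wa; have capb := ev_cap hs wb.
  exists (t1 + (t2 + (1 + (1 + 1)))); eexists; split.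
  + apply: exec_seq e1 _; apply: exec_seq e2 _.
    apply: exec_seq.
      by apply: exec_add; rewrite v1' v2; lia.
    by apply: exec_seq; apply: exec_sub.
  + by lia.
  + rewrite /= !(upd_eq, upd_neq) // ?(sim_M hs2) ?v1' ?v2; try lia.
    by rewrite /rM /tm; lia.
  + apply: (same_but_trans (leqnn d) s1).
    apply: same_but_set_r => //.
    apply: same_but_set_r => //.
    apply: same_but_set_r => //.
    exact: same_but_weak.
- case/andP=> wa wb.
  have [t1 [m1 [e1 c1 v1 s1]]] := IHa d m hs wa.
  have hs1 := same_but_sim hs s1.
  have [t2 [m2 [e2 c2 v2 s2]]] := IHb d.+1 m1 hs1 wb.
  have v1' : reg m2 (tm d) = ev n g s a by rewrite (same_but_tm s2).
  exists (t1 + (t2 + 1)); eexists; split.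
  + apply: exec_seq e1 _; apply: exec_seq e2 _; exact: exec_sub.
  + by lia.
  + by rewrite /= upd_eq v1' v2.
  + apply: (same_but_trans (leqnn d) s1).
    apply: same_but_set_r => //.
    exact: same_but_weak.
- case/andP=> hk wa.
  have [t1 [m1 [e1 c1 v1 s1]]] := IHa d m hs wa.
  have hs1 := same_but_sim hs s1.
  have capa := ev_cap hs wa.
  have n8 : (r8 == tm d) = false by rewrite /r8 /tm; lia.
  have nNN : (rNN == tm d) = false by rewrite /rNN /tm; lia.
  exists (t1 + (1 + (1 + (1 + (1 + 1))))); eexists; split.
  + apply: exec_seq e1 _; apply: exec_seq.
      by apply: exec_mul; rewrite v1 (sim_8 hs1); lia.
    apply: exec_seq.
      apply: exec_add; rewrite /= upd_eq upd_neq ?nNN // v1 (sim_8 hs1).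
      by rewrite (sim_NN hs1); lia.
    apply: exec_seq; first by apply: exec_const; lia.
    apply: exec_seq.
      apply: exec_add; rewrite /= !(upd_eq, upd_neq) ?nNN //.
      by rewrite v1 (sim_8 hs1) (sim_NN hs1); lia.
    exact: exec_read.
  + by lia.
  + rewrite /= !(upd_eq, upd_neq) ?nNN // v1 (sim_8 hs1) (sim_NN hs1).
    by rewrite -(sim_arr hs1) //; congr Defs.mem; lia.
  + apply: (same_but_trans (leqnn d) s1).
    apply: same_but_set_r => //.
    apply: same_but_set_r => //.
    apply: same_but_set_r => //.
    apply: same_but_set_r => //.
    exact: same_but_set.
- case/andP=> wa wb.
  have [t1 [m1 [e1 c1 v1 s1]]] := IHa d m hs wa.
  have hs1 := same_but_sim hs s1.
  have [t2 [m2 [e2 c2 v2 s2]]] := IHb d.+1 m1 hs1 wb.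
  have hs2 := same_but_sim hs1 s2.
  have v1' : reg m2 (tm d) = ev n g s a by rewrite (same_but_tm s2).
  have s12 : same_but d m m2.
    apply: (same_but_trans (leqnn d) s1).
    exact: same_but_weak.
  case: (ltnP (ev n g s a) n) => la; last first.
    exists (t1 + (t2 + 2)); eexists; split.
    + apply: exec_seq e1 _; apply: exec_seq e2 _.
      apply: exec_if_false; first by rewrite v1' (sim_N hs2).
      by apply: exec_const; lia.
    + by lia.
    + by rewrite /= upd_eq.
    + exact: same_but_set_r.
  case: (ltnP (ev n g s b) n) => lb; last first.
    exists (t1 + (t2 + 3)); eexists; split.
    + apply: exec_seq e1 _; apply: exec_seq e2 _.
      apply: exec_if_true; first by rewrite v1' (sim_N hs2).
      apply: exec_if_false; first by rewrite v2 (sim_N hs2).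
      by apply: exec_const; lia.
    + by lia.
    + by rewrite /= upd_eq.
    + exact: same_but_set_r.
  exists (t1 + (t2 + (1 + (1 + 1)).+2)); eexists; split.
  + apply: exec_seq e1 _; apply: exec_seq e2 _.
    apply: exec_if_true; first by rewrite v1' (sim_N hs2).
    apply: exec_if_true; first by rewrite v2 (sim_N hs2).
    apply: exec_seq.
      by apply: exec_mul; rewrite v1' (sim_N hs2); nia.
    apply: exec_seq; last exact: exec_read.
    by apply: exec_add; rewrite /= upd_eq upd_neq // v1' v2 (sim_N hs2); nia.
  + by lia.
  + by rewrite /= !(upd_eq, upd_neq) // v1' v2 (sim_N hs2) (sim_adj hs2).
  + apply: (same_but_trans (leqnn d) s12).
    apply: same_but_set_r => //.
    apply: same_but_set_r => //.
    exact: same_but_set.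
Qed.

(** Continuation style: a branch may occur several times in the compiled test, so it enters only
    through executions of the selected one. *)
Lemma cif_ok s m b p q : sim s m -> wfb b ->
  exists t m1, [/\ t <= bcost b, sim s m1 &
    forall t' m', exec B (if evb n g s b then p else q) m1 t' m' ->
      exec B (cif b p q) m (t + t') m'].
Proof.
elim: b m p q => [x y|b IHb|b IHb c IHc] m p q hs /=.
- case/andP=> wx wy.
  have [t1 [m1 [e1 c1 v1 s1]]] := cexp_ok 0 hs wx.
  have hs1 := same_but_sim hs s1.
  have [t2 [m2 [e2 c2 v2 s2]]] := cexp_ok 1 hs1 wy.
  have hs2 := same_but_sim hs1 s2.
  exists (t1 + t2 + 1), m2; split=> //; first by lia.
  move=> t' m'.
  have -> : t1 + t2 + 1 + t' = t1 + (t2 + t'.+1) by lia.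
  case: ltnP => hlt he; apply: exec_seq e1 _; apply: exec_seq e2 _.
    by apply: exec_if_true => //; rewrite (same_but_tm s2 (ltnSn 0)) v1 v2.
  by apply: exec_if_false => //; rewrite (same_but_tm s2 (ltnSn 0)) v1 v2.
- move=> wb; have [t [m1 [h1 h2 h3]]] := IHb m q p hs wb.
  by exists t, m1; split=> // t' m'; case: (evb n g s b) (h3 t' m').
- case/andP=> wb wc.
  have [t [m1 [h1 h2 h3]]] := IHb m (cif c p q) q hs wb.
  case E: (evb n g s b) h3 => h3 /=.
    have [t' [m2 [h1' h2' h3']]] := IHc m1 p q h2 wc.
    exists (t + t'), m2; split=> //; first by lia.
    by move=> t2 m' he; rewrite -addnA; apply: h3; apply: h3'.
  by exists t, m1; split=> //; lia.
Qed.

Lemma sim_setv s m x v : sim s m -> v <= cap n ->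
  sim (setv x v s) (set_reg m (va x) v).
Proof.
case=> h1 h2 h3 h4 h5 h6 h7 h8 h9 h10 h11 h12 hv.
have ne r : r < 6 -> r != va x by rewrite /va; lia.
split=> //=; try by rewrite upd_neq ?ne.
- move=> y; rewrite /upd h1; have -> : (va y == va x) = (y == x) => //.
  by rewrite /va; lia.
- by move=> y; rewrite /upd; case: eqP.
Qed.

Lemma sim_tick s m c : sim s m -> sim (tick c s) m.
Proof. by case=> *; split. Qed.

(** The clock is an upper bound and not an exact count, because out-of-range [Adj] and a failed
    first conjunct leave early. *)
Lemma comp_ok p s m : wf p -> sim s m ->
  exists t m', [/\ exec B (comp p) m t m', t + ck s <= ck (eval n g p s)
    & sim (eval n g p s) m'].
Proof.
elim: p s m => [|x e|k a b|e|p IHp q IHq|b p IHp q IHq|x y p IHp] s m /=.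
- by move=> _ hs; exists 0, m; split=> //; apply: exec_skip.
- move=> we hs; have [t1 [m1 [e1 c1 v1 s1]]] := cexp_ok 0 hs we.
  have hs1 := same_but_sim hs s1; have capa := ev_cap hs we.
  exists (t1 + 1); eexists; split.
  + apply: exec_seq e1 _; apply: exec_add; rewrite v1 (sim_0 hs1); lia.
  + by rewrite /=; lia.
  + rewrite v1 (sim_0 hs1) addn0; apply: sim_tick.
    exact: sim_setv.
- case/and3P=> hk wa wb hs.
  have [t1 [m1 [e1 c1 v1 s1]]] := cexp_ok 0 hs wa.
  have hs1 := same_but_sim hs s1.
  have [t2 [m2 [e2 c2 v2 s2]]] := cexp_ok 1 hs1 wb.
  have hs2 := same_but_sim hs1 s2.
  have v1' : reg m2 (tm 0) = ev n g s a by rewrite (same_but_tm s2).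
  have capa := ev_cap hs wa; have capb := ev_cap hs wb.
  exists (t1 + (t2 + (1 + (1 + (1 + (1 + 1)))))); eexists; split.
  + apply: exec_seq e1 _; apply: exec_seq e2 _; apply: exec_seq.
      by apply: exec_mul; rewrite v1' (sim_8 hs2); lia.
    apply: exec_seq.
      apply: exec_add; rewrite /= upd_eq upd_neq // v1' (sim_8 hs2).
      by rewrite (sim_NN hs2); lia.
    apply: exec_seq; first by apply: exec_const; lia.
    apply: exec_seq; last exact: exec_write.
    apply: exec_add; rewrite /= !(upd_eq, upd_neq) //.
    by rewrite v1' (sim_8 hs2) (sim_NN hs2); lia.
  + by rewrite /=; lia.
  + apply: sim_tick; rewrite /= !(upd_eq, upd_neq) //.
    rewrite v1' v2 (sim_8 hs2) (sim_NN hs2).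
    have E j : (j < 8) -> forall i, (n * n + 8 * i + j == ev n g s a * 8 + n * n + k)
       = (j == k) && (i == ev n g s a) by lia.
    case: hs2 => h1 h2 h3 h4 h5 h6 h7 h8 h9 h10 h11 h12.
    split=> //=.
    * move=> i; rewrite !upd_neq ?h1 //; rewrite /va /tm; lia.
    * move=> i j hi hj; rewrite upd_neq ?h8 //; nia.
    * by move=> k' i hk'; rewrite /upd E // h9.
    * by move=> k' i; case: ifP.
- move=> we hs; have [t1 [m1 [e1 c1 v1 s1]]] := cexp_ok 0 hs we.
  have hs1 := same_but_sim hs s1.
  exists (t1 + 1); eexists; split.
  + apply: exec_seq e1 _; exact: exec_emit.
  + by rewrite /=; lia.
  + apply: sim_tick; case: hs1 => h1 h2 h3 h4 h5 h6 h7 h8 h9 h10 h11 h12.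
    by split=> //=; rewrite h10 v1.
- case/andP=> wp wq hs.
  have [t1 [m1 [e1 c1 s1]]] := IHp s m wp hs.
  have [t2 [m2 [e2 c2 s2]]] := IHq _ m1 wq s1.
  exists (t1 + t2), m2; split=> //; first exact: exec_seq e1 e2.
  by lia.
- case/and3P=> wb wp wq hs.
  have [t [m1 [h1 h2 h3]]] := cif_ok (comp p) (comp q) hs wb.
  have h2' := sim_tick (bcost b) h2.
  case: (evb n g s b) h3 => h3.
    have [t' [m' [e' c' s']]] := IHp _ m1 wp h2'.
    by exists (t + t'), m'; split=> //; [apply: h3|move: c' => /=; lia].
  have [t' [m' [e' c' s']]] := IHq _ m1 wq h2'.
  by exists (t + t'), m'; split=> //; [apply: h3|move: c' => /=; lia].
- case/and4P=> xy wx wy wp hs.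
  pose f k s' := tick 2 (setv x k.+1 (eval n g p s')).
  have hy0 : vr s y <= cap n := sim_vcap hs y.
  (* The successor on the right pays for the last, failing test of the loop. *)
  suff H j k s1 m1 : k + j = vr s y -> sim s1 m1 -> vr s1 y = vr s y ->
      vr s1 x = k ->
      exists t m', [/\ exec B (WhileLt (va x) (va y)
           (Seq (comp p) (Add (va x) (va x) r1))) m1 t m',
         t + ck s1 <= (ck (loop f j k s1)).+1 & sim (loop f j k s1) m'].
    have hs0 := sim_setv x hs (leq0n (cap n)).
    have [||t [m' [e' c' s']]] := H (vr s y) 0 _ _ (add0n _) hs0.
    + by rewrite /= upd_neq // eq_sym.
    + by rewrite /= upd_eq.
    exists (1 + t), m'; split.
    + by apply: exec_seq e'; apply: exec_const; lia.
    + by move: c'; rewrite /f /=; lia.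
    + exact: sim_tick.
  elim: j k s1 m1 => [|j IHj] k s1 m1 hk hs1 y1 x1 /=.
    exists 1, m1; split=> //.
    by apply: exec_while_end; rewrite !(sim_var hs1); lia.
  have [t1 [m2 [e1 c1 s2]]] := IHp s1 m1 wp hs1.
  have [F _ _] := frame_eval n g p s1.
  have x2 : reg m2 (va x) = k by rewrite (sim_var s2) F.
  have hs2 : sim (f k s1) (set_reg m2 (va x) (reg m2 (va x) + reg m2 r1)).
    rewrite /f (sim_1 s2) x2 addn1; apply: sim_tick; apply: sim_setv => //.
    by lia.
  have [|||t2 [m' [e2 c2 s']]] := IHj k.+1 _ _ _ hs2.
  + by lia.
  + by rewrite /= upd_neq 1?eq_sym // F.
  + by rewrite /= upd_eq.
  exists (t1 + 1 + t2).+1, m'; split=> //.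
  + apply: exec_while_loop e2; first by rewrite !(sim_var hs1) y1 x1; lia.
    apply: exec_seq e1 _; apply: exec_add; rewrite x2 (sim_1 s2); lia.
  + by move: c2; rewrite /f /=; lia.
Qed.

End Compilation.

Arguments eval : simpl never.

(** * Scanning a segment of vertices *)

Fixpoint reads e r :=
  match e with
  | V x => r == x
  | N _ => false
  | Plus a b | Minus a b | Adj a b => reads a r || reads b r
  | Arr _ a => reads a r
  end.

Fixpoint breads b r :=
  match b with
  | Lt x y => reads x r || reads y r
  | Not b => breads b r
  | And b c => breads b r || breads c r
  end.

Definition Eqe x y := And (Not (Lt x y)) (Not (Lt y x)).
Definition Pos e := Lt (N 0) e.
Definition Is0 e := Not (Pos e).

Notation vN := 0 (only parsing).
Notation vS := 1 (only parsing).
Notation vLen := 2 (only parsing).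

(** A segment is the run of [vLen] vertices starting at [vS]. All checks are relative to it, so the
    same code serves every block of the divide and conquer. *)
Definition scan i w p := For i vLen (Sq (Asg w (Plus (V vS) (V i))) p).

(** The result is one plus a witness, with 0 for none; [dec] undoes the shift. *)
Definition locate x i w b :=
  Sq (Asg x (N 0)) (scan i w (If b (Asg x (Plus (V w) (N 1))) Nop)).

Section Scanning.

Variables (n : nat) (g : nat -> nat -> bool).
Hypothesis g_lt : forall u v, g u v -> (u < n) && (v < n).

Lemma eval_Nop s : eval n g Nop s = s.
Proof. by []. Qed.

Lemma eval_Asg x e s :
  eval n g (Asg x e) s = tick (ecost e).+1 (setv x (ev n g s e) s).
Proof. by []. Qed.

Lemma eval_Sto k x y s : eval n g (Sto k x y) s =
  tick (ecost x + ecost y + 5) (seta k (ev n g s x) (ev n g s y) s).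
Proof. by []. Qed.

Lemma eval_Sq p q s : eval n g (Sq p q) s = eval n g q (eval n g p s).
Proof. by []. Qed.

Lemma eval_If b p q s : eval n g (If b p q) s =
  if evb n g s b then eval n g p (tick (bcost b) s)
  else eval n g q (tick (bcost b) s).
Proof. by []. Qed.

Lemma evb_eq s x y : evb n g s (Eqe x y) = (ev n g s x == ev n g s y).
Proof. by rewrite /= -!leqNgt eqn_leq andbC. Qed.

Lemma ev_adj s x y : ev n g s (Adj x y) = g (ev n g s x) (ev n g s y) :> nat.
Proof. by rewrite /=; case E: (g _ _); rewrite ?andbF ?andbT ?(g_lt E). Qed.

Lemma evb_pos_adj s x y :
  evb n g s (Pos (Adj x y)) = g (ev n g s x) (ev n g s y).
Proof. by rewrite -[LHS]/(0 < ev n g s (Adj x y)) ev_adj lt0b. Qed.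

Lemma evb_not s b : evb n g s (Not b) = ~~ evb n g s b.
Proof. by []. Qed.

Lemma evb_and s b c : evb n g s (And b c) = evb n g s b && evb n g s c.
Proof. by []. Qed.

Lemma evb_pos s e : evb n g s (Pos e) = (0 < ev n g s e).
Proof. by []. Qed.

Lemma cap_gt m : m <= n.+1 -> minn m (cap n) = m.
Proof. by move=> h; apply/minn_idPl; rewrite /cap !expnS; nia. Qed.

Lemma ev_ext s s' e : (forall r, reads e r -> vr s r = vr s' r) ->
  (forall k, ar s k = ar s' k) -> ev n g s e = ev n g s' e.
Proof.
move=> hv ha; elim: e hv => [x|k|x IHx y IHy|x IHx y IHy|k x IHx|x IHx y IHy] hv //=;
  rewrite ?ha ?IHx ?IHy // => *; apply: hv; rewrite /= ?eqxx //;
  by apply/orP; auto.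
Qed.

Lemma evb_ext s s' b : (forall r, breads b r -> vr s r = vr s' r) ->
  (forall k, ar s k = ar s' k) -> evb n g s b = evb n g s' b.
Proof.
move=> hv ha; elim: b hv => [x y|b IHb|b IHb c IHc] hv /=.
- by rewrite !(ev_ext (s' := s')) // => r hr; apply: hv; rewrite /= hr ?orbT.
- by rewrite IHb.
- by rewrite IHb ?IHc // => r hr; apply: hv; rewrite /= hr ?orbT.
Qed.

(** The [tick 6] is the clock charge for assigning [vS + i] to [w]. *)
Lemma scan_ind (Inv : nat -> st -> Prop) i w p s :
  [&& i != vS, i != vLen, w != vS, w != vLen & i != w] ->
  [&& ~~ writes p i, ~~ writes p vS & ~~ writes p vLen] ->
  vr s vS + vr s vLen <= n ->
  Inv 0 (setv i 0 s) ->
  (forall k s', k < vr s vLen -> frame (scan i w p) s s' -> Inv k s' ->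
     Inv k.+1 (tick 2 (setv i k.+1
       (eval n g p (tick 6 (setv w (vr s vS + k) s')))))) ->
  exists s', [/\ Inv (vr s vLen) s', frame (scan i w p) s s'
    & eval n g (scan i w p) s = tick 2 s'].
Proof.
move=> /and5P [i1 i2 w1 w2 iw] /and3P [pi pS pL] hn I0 IS.
apply: for_ind => // k s' hk hF hx hI; have [F _ _] := hF.
have hS : ~~ writes (scan i w p) vS.
  by rewrite /= !negb_or ![vS == _]eq_sym i1 w1.
have := IS k s' hk hF hI; rewrite eval_Sq eval_Asg [ev _ _ s' _]/=.
by rewrite hx (F _ hS) cap_gt //; lia.
Qed.

(** Apart from [w], the loop changes only [x] and [i], which [b] does not read; hence each test can
    be evaluated in the initial state with [w] set to [u]. *)
Lemma locate_spec x i w b s :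
  [&& i != vS, i != vLen, w != vS, w != vLen & i != w] ->
  [&& x != vS, x != vLen, x != i & x != w] ->
  [&& ~~ breads b x & ~~ breads b i] ->
  vr s vS + vr s vLen <= n ->
  let s' := eval n g (locate x i w b) s in
  (vr s' x = 0 /\ forall u, vr s vS <= u < vr s vS + vr s vLen ->
      evb n g (setv w u s) b = false) \/
  exists u, [/\ vr s vS <= u < vr s vS + vr s vLen, vr s' x = u.+1
    & evb n g (setv w u s) b].
Proof.
move=> h1 /and4P [x1 x2 xi xw] /andP [bx bi] hn s'; rewrite {}/s' /locate eval_Sq eval_Asg.
set s0 := tick _ _.
have x1' : vS != x by rewrite eq_sym.
have x2' : vLen != x by rewrite eq_sym.
have E1 : vr s0 vS = vr s vS := upd_neq _ _ x1'.
have E2 : vr s0 vLen = vr s vLen := upd_neq _ _ x2'.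
have [|||k s1 hk [F1 F2 _] hI|s1 [hI _ ->]] := @scan_ind (fun k s1 =>
  (vr s1 x = 0 /\ forall u, vr s vS <= u < vr s vS + k ->
      evb n g (setv w u s) b = false) \/
  exists u, [/\ vr s vS <= u < vr s vS + vr s vLen, vr s1 x = u.+1
    & evb n g (setv w u s) b]) i w (If b (Asg x (Plus (V w) (N 1))) Nop) s0 h1.
- have /and5P [i1 i2 w1 w2 iw] := h1.
  by rewrite /= !orbF ![_ == x]eq_sym xi x1 x2.
- by rewrite E1 E2.
- by left; split=> [|u]; [rewrite /= !(upd_eq, upd_neq) // eq_sym|lia].
- rewrite E1; set s2 := tick 6 _.
  have Eb : evb n g s2 b = evb n g (setv w (vr s vS + k) s) b.
    apply: evb_ext => [r hr|]; last by move=> k'; rewrite /= F2.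
    rewrite /= /upd; case: eqP => // /eqP rw.
    have rx : r != x by apply: contraTneq hr => ->.
    have ri : r != i by apply: contraTneq hr => ->.
    by rewrite F1 /= ?orbF ?negb_or ?ri ?rw ?rx //= upd_neq.
  rewrite E2 in hk.
  have vw : vr (tick (bcost b) s2) w = vr s vS + k by rewrite /= upd_eq.
  rewrite eval_If Eb eval_Asg eval_Nop; case: ifP => hb.
    right; exists (vr s vS + k); split=> //; first by lia.
    by rewrite /= upd_neq // upd_eq -[upd _ _ _ _]/(vr (tick (bcost b) s2) w) vw
      cap_gt; lia.
  case: hI => [[hx0 hno]|[u [hu hxu hub]]].
    left; split; first by rewrite /= !upd_neq.
    move=> u hu; have [E|hne] := eqVneq u (vr s vS + k); first by rewrite E.
    by apply: hno; lia.
  by right; exists u; split=> //; rewrite /= !upd_neq.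
- by rewrite E2 in hI.
Qed.

End Scanning.

(** * The programs *)

(* Variables 4 to 8 hold a certificate: five vertices of the current segment, at
   least one of which is labelled wrongly. *)
Notation vOk := 3 (only parsing).
Notation vDone := 9 (only parsing).
Notation vI := 10 (only parsing).
Notation vJ := 11 (only parsing).
Notation vU := 12 (only parsing).
Notation vW := 13 (only parsing).
Notation vK := 14 (only parsing).
Notation vSel := 15 (only parsing).
Notation vP := 16 (only parsing).
Notation vY0 := 17 (only parsing).
Notation vV0 := 18 (only parsing).
Notation vY1 := 19 (only parsing).
Notation vV1 := 20 (only parsing).
Notation aLab := 0 (only parsing).
Notation aVis := 1 (only parsing).
Notation aNear := 2 (only parsing).
Notation aDeg := 3 (only parsing).
Notation aOne := 4 (only parsing).

Definition inI w := Pos (Arr aLab (V w)).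
Definition inO w := Is0 (Arr aLab (V w)).
Definition yadj x y := Pos (Adj x y).
Definition nadj x y := Is0 (Adj x y).
Definition coa x y := And (Not (Eqe x y)) (nadj x y).
Definition dec x := Minus (V x) (N 1).

(** Shorter certificates repeat a vertex, so that one search procedure serves all checks. *)
Definition setcert x1 x2 x3 x4 x5 :=
  Sq (Asg 4 x1) (Sq (Asg 5 x2) (Sq (Asg 6 x3) (Sq (Asg 7 x4) (Sq (Asg 8 x5)
    (Asg vOk (N 0)))))).

Definition check_edges :=
  scan vI vU (If (inI vU)
    (Sq (locate vV0 vJ vW (And (inI vW) (yadj (V vU) (V vW))))
       (If (Pos (V vV0)) (setcert (V vU) (dec vV0) (V vU) (V vU) (V vU)) Nop))
    Nop).

(* [prim_step] grows a spanning forest of the complement graph on the vertices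
   outside [I]; [aNear] stores one plus a visited co-neighbour, 0 if none. *)
Definition select :=
  Sq (locate vSel vJ vW (And (inO vW) (And (Is0 (Arr aVis (V vW)))
        (Pos (Arr aNear (V vW))))))
     (If (Pos (V vSel)) Nop
        (locate vSel vJ vW (And (inO vW) (Is0 (Arr aVis (V vW)))))).

(** Only the edge attaching the new vertex to its tree is tested: one linear scan per vertex keeps
    the triple check quadratic. *)
Definition test_edge :=
  If (Pos (Arr aNear (V vU)))
    (Sq (Asg vP (Minus (Arr aNear (V vU)) (N 1)))
    (Sq (locate vV0 vJ vW (And (inO vW)
           (And (coa (V vU) (V vW)) (coa (V vP) (V vW)))))
        (If (Pos (V vV0))
           (setcert (V vU) (V vP) (dec vV0) (V vU) (V vU)) Nop)))
    Nop.

Definition mark_near :=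
  scan vJ vW (If (And (inO vW) (coa (V vU) (V vW)))
    (Sto aNear (V vW) (Plus (V vU) (N 1))) Nop).

Definition prim_step :=
  Sq select
    (If (Pos (V vSel))
       (Sq (Asg vU (dec vSel))
         (Sq (Sto aVis (V vU) (N 1)) (Sq test_edge mark_near)))
       Nop).

Definition check_triples :=
  Sq (scan vJ vW (Sq (Sto aVis (V vW) (N 0)) (Sto aNear (V vW) (N 0))))
     (For vK vLen prim_step).

Definition degrees :=
  scan vI vU (Sq (Sto aDeg (V vU) (N 0))
    (scan vJ vW (If (And (inI vW) (yadj (V vU) (V vW)))
       (Sto aDeg (V vU) (Plus (Arr aDeg (V vU)) (N 1))) Nop))).

Definition least_degree :=
  Sq (Asg vY0 (N 0))
    (scan vJ vW (If (And (inO vW) (coa (V vU) (V vW)))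
       (If (Pos (V vY0))
          (If (Lt (Arr aDeg (V vW)) (Arr aDeg (dec vY0)))
             (Asg vY0 (Plus (V vW) (N 1))) Nop)
          (Asg vY0 (Plus (V vW) (N 1))))
       Nop)).

(** The flag starts at 1. If the least-degree non-neighbour [y] has no neighbour [v] in [I] outside
    those of [u], it becomes 0. Otherwise nestedness makes [v] adjacent to every other outside
    non-neighbour [z]; if some [z] misses [v], its degree provides a neighbour [w] in [I] that [y]
    misses, and the five vertices form a certificate. *)
Definition check_single :=
  Sq (Sto aOne (V vU) (N 1))
 (Sq least_degree
  (If (Pos (V vY0))
   (Sq (locate vV0 vJ vW (And (inI vW) (And (yadj (dec vY0) (V vW))
          (nadj (V vU) (V vW)))))
    (If (Pos (V vV0))
      (Sq (locate vY1 vJ vW (And (inO vW) (And (coa (V vU) (V vW))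
             (nadj (V vW) (dec vV0)))))
       (If (Pos (V vY1))
         (Sq (locate vV1 vJ vW (And (inI vW) (And (yadj (dec vY1) (V vW))
                (nadj (dec vY0) (V vW)))))
             (setcert (V vU) (dec vY0) (dec vY1) (dec vV0) (dec vV1)))
         Nop))
      (Sto aOne (V vU) (N 0))))
   Nop)).

Definition check_singles :=
  Sq degrees (scan vI vU (If (inO vU) check_single Nop)).

Definition check :=
  Sq (Asg vOk (N 1)) (Sq check_edges (Sq check_triples check_singles)).

Definition flip x :=
  If (Pos (Arr aLab (V x))) (Sto aLab (V x) (N 0)) (Sto aLab (V x) (N 1)).

(** The language has no stack, so each level of the search owns five variables, placed above all
    others. *)
Definition saved d j := 100 + 5 * d + j.

Definition save d :=
  Sq (Asg (saved d 0) (V 4)) (Sq (Asg (saved d 1) (V 5))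
    (Sq (Asg (saved d 2) (V 6)) (Sq (Asg (saved d 3) (V 7))
      (Asg (saved d 4) (V 8))))).

Definition attempt d p j :=
  If (Pos (V vDone)) Nop
    (Sq (flip (saved d j))
       (Sq p (If (Pos (V vDone)) Nop (flip (saved d j))))).

(** The recursion is unfolded when the program is built: [d] bounds the number of flips on a branch.
    A failed attempt undoes its flip, so the branches are independent. *)
Fixpoint repair d :=
  Sq check (if d is d'.+1 then
    If (Pos (V vOk)) (Asg vDone (N 1))
      (Sq (save d') (Sq (Asg vDone (N 0))
         (Sq (attempt d' (repair d') 0) (Sq (attempt d' (repair d') 1)
            (Sq (attempt d' (repair d') 2) (Sq (attempt d' (repair d') 3)
               (attempt d' (repair d') 4)))))))
    else Asg vDone (V vOk)).

(** As a finite list, the written variables can be checked all at once by computation. *)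
Fixpoint written p : seq nat :=
  match p with
  | Asg x _ => [:: x]
  | Sq p q | If _ p q => written p ++ written q
  | For x _ p => x :: written p
  | _ => [::]
  end.

Lemma writes_written p r : writes p r = (r \in written p).
Proof.
by elim: p => //= [x _|p IHp q IHq|_ p IHp q IHq|x _ p IHp];
  rewrite ?inE ?mem_cat ?IHp ?IHq.
Qed.

Lemma check_writes r : writes check r -> 2 < r < 21.
Proof.
rewrite writes_written => hr.
by have /allP : all (fun r => 2 < r < 21) (written check) by []; apply.
Qed.

Lemma repairS d : repair d.+1 = Sq check (If (Pos (V vOk)) (Asg vDone (N 1))
  (Sq (save d) (Sq (Asg vDone (N 0))
     (Sq (attempt d (repair d) 0) (Sq (attempt d (repair d) 1)
        (Sq (attempt d (repair d) 2) (Sq (attempt d (repair d) 3)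
           (attempt d (repair d) 4)))))))).
Proof. by []. Qed.

Lemma repair_writes d r : writes (repair d) r ->
  (2 < r < 21) || (100 <= r < 100 + 5 * d).
Proof.
elim: d => [|d IHd].
  by case/orP=> [/check_writes -> //|/eqP ->].
rewrite repairS; move: (repair d) IHd => p IHd /=.
case/orP=> [/check_writes -> //|]; rewrite /saved.
by case W: (writes p r); [have := IHd W|]; lia.
Qed.

(** Deeper search nests conditionals and not loops, so the loop depth stays 2 for all [d] and every
    repair is quadratic in the segment length. *)
Lemma repair_static d :
  [/\ wf (repair d), bounded_by vLen (repair d), depth (repair d) <= 2,
      forall k, writes_array (repair d) k -> k < 5 & ~~ emits (repair d)].
Proof.
have ck k : writes_array check k -> 0 < k < 5 by rewrite /=; lia.
elim: d => [|d]; first by split=> // k /orP [/ck|//]; lia.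
rewrite repairS; move: (repair d) => p [IH1 IH2 IH3 IH4 IH5]; split=> /=.
- by rewrite IH1.
- by rewrite IH2.
- by case: (depth p) IH3 => [|[|[|]]].
- move=> k; case W: (writes_array p k); first by have := IH4 k W; lia.
  by lia.
- by rewrite (negbTE IH5).
Qed.

(** * Programs for divide and conquer and for the listing *)

Notation vK1 := 30 (only parsing).
Notation vK2 := 31 (only parsing).
Notation vL := 32 (only parsing).
Notation vNext := 33 (only parsing).

Definition block d :=
  Sq (Asg vS (V vNext)) (Sq (Asg vLen (Plus (V vL) (V vL)))
    (Sq (If (Lt (V vN) (Plus (V vS) (V vLen))) (Asg vLen (Minus (V vN) (V vS))) Nop)
      (Sq (repair d) (Asg vNext (Plus (V vNext) (Plus (V vL) (V vL))))))).

(** Loop bounds are variables, so this loop and that of [doubling] run [vN] rounds and idle at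
    constant cost once their work is done. *)
Definition level d :=
  Sq (Asg vNext (N 0))
     (For vK2 vN (If (Lt (V vNext) (V vN)) (block d) Nop)).

Definition doubling d :=
  Sq (Asg vL (N 1))
     (For vK1 vN (If (Lt (V vL) (V vN))
        (Sq (level d) (Asg vL (Plus (V vL) (V vL)))) Nop)).

(** The doubling phase is remembered only through its error bound; a last repair of the whole range
    establishes the tested conditions and the flags globally. *)
Definition classify d :=
  Sq (doubling d) (Sq (Asg vS (N 0)) (Sq (Asg vLen (V vN)) (repair d))).

Notation vCnt := 34 (only parsing).
Notation vA := 35 (only parsing).
Notation vB := 36 (only parsing).
Notation vFl := 37 (only parsing).
Notation vE := 38 (only parsing).
Notation vX := 39 (only parsing).

Definition act_on act x y := Sq (Asg vA (V x)) (Sq (Asg vB (V y)) act).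

(** The larger vertex of a pair comes first, so no pair is met twice; [vN] stands for a missing
    second vertex. *)
Definition row act :=
  If (inO vU)
    (Sq (scan vJ vW (If (And (Lt (V vW) (V vU)) (And (inO vW) (nadj (V vU) (V vW))))
           (act_on act vU vW) Nop))
       (If (Pos (Arr aOne (V vU))) (act_on act vU vN) Nop))
    Nop.

(** The flag survives exactly when every outside vertex has a neighbour in [I], the case in which
    [I] itself is maximal. *)
Definition lonely :=
  Sq (Asg vFl (N 1))
    (scan vI vU (If (inO vU)
       (Sq (locate vV0 vJ vW (And (inI vW) (yadj (V vU) (V vW))))
          (If (Pos (V vV0)) Nop (Asg vFl (N 0))))
       Nop)).

(** With the action as a parameter, counting and printing share one correctness proof. *)
Definition listing act :=
  Sq (scan vI vU (row act))
    (Sq lonely (If (Pos (V vFl)) (act_on act vN vN) Nop)).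

Definition act_count := Asg vCnt (Plus (V vCnt) (N 1)).

Definition is_member :=
  Not (And (Not (Eqe (V vX) (V vA))) (And (Not (Eqe (V vX) (V vB)))
    (Not (And (inI vX) (And (nadj (V vX) (V vA)) (nadj (V vX) (V vB))))))).

(** Two passes, since the output format puts the cardinality before the elements. *)
Definition act_emit :=
  Sq (Asg vCnt (N 0))
 (Sq (scan vE vX (If is_member (Asg vCnt (Plus (V vCnt) (N 1))) Nop))
 (Sq (Out (V vCnt)) (scan vE vX (If is_member (Out (V vX)) Nop)))).

Definition count_prog d :=
  Sq (classify d) (Sq (listing act_count) (Out (V vCnt))).

Definition enum_prog d := Sq (classify d) (listing act_emit).

Lemma mem_iota0 m k : (k \in iota 0 m) = (k < m).
Proof. by rewrite mem_iota. Qed.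

(** * Counting in lists *)

Lemma three_of_count (T : eqType) (P : pred T) (s : seq T) : uniq s ->
  2 < count P s -> exists x y z,
  [/\ [/\ x \in s, y \in s & z \in s], [/\ P x, P y & P z]
    & [/\ x != y, x != z & y != z]].
Proof.
move=> us; rewrite -size_filter.
have := filter_uniq P us; have := mem_filter P ^~ s.
case: (filter P s) => [|x [|y [|z r]]] // h /=.
rewrite !inE !negb_or => /and4P [/and3P [xy xz _] /andP [yz _] _ _] _.
have /andP [Px xs] : P x && (x \in s) by rewrite -h !inE eqxx.
have /andP [Py ys] : P y && (y \in s) by rewrite -h !inE eqxx orbT.
have /andP [Pz zs] : P z && (z \in s) by rewrite -h !inE eqxx !orbT.
by exists x, y, z.
Qed.

(** If all of [Q] lay in [P], the extra [x] would make [P] the larger one. Applied to neighbourhoods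
    in [I], this turns a comparison of degrees into a crossing vertex. *)
Lemma count_exchange (T : eqType) (P Q : pred T) (s : seq T) x :
  count P s <= count Q s -> x \in s -> P x -> ~~ Q x ->
  exists z, [/\ z \in s, Q z & ~~ P z].
Proof.
move=> le xs Px nQx; have [/hasP [z zs /andP [Qz nPz]]|/hasPn no] :=
  boolP (has (fun z => Q z && ~~ P z) s); first by exists z.
have E : count Q s = count (predI Q P) s.
  apply: eq_in_count => z zs /=; have := no z zs.
  by case: (Q z) => //=; case: (P z).
have := count_predC Q (filter P s); rewrite !count_filter size_filter -E.
have : 0 < count (predI (predC Q) P) s.
  by rewrite -has_count; apply/hasP; exists x => //=; rewrite nQx.
by lia.
Qed.

Lemma count_add1 (T : eqType) (P Q : pred T) (s : seq T) x : uniq s ->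
  x \in s -> ~~ Q x -> (forall y, P y = (y == x) || Q y) ->
  count P s = (count Q s).+1.
Proof.
move=> us xs nQ E; rewrite (eq_count E).
have := count_predUI (pred1 x) Q s; rewrite count_uniq_mem // xs.
suff -> : count (predI (pred1 x) Q) s = 0 by rewrite addn0.
apply/eqP; rewrite -leqn0 leqNgt -has_count; apply/negP => /hasP [y _].
by case/andP=> /eqP ->; rewrite (negbTE nQ).
Qed.

Lemma enum_filter n (P : pred nat) (U : {set 'I_n}) :
  (forall v : 'I_n, (v \in U) = P v) ->
  [seq val v | v <- enum U] = [seq v <- iota 0 n | P v].
Proof.
move=> h; have -> : enum U = [seq v <- enum 'I_n | preim val P v].
  by rewrite [enum 'I_n]enumT; apply: eq_filter => v; rewrite /= -h.
by rewrite -val_enum_ord filter_map.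
Qed.

(** * Two-threshold graphs *)

Section TwoThreshold.

Variables (R : realType) (n : nat) (g : nat -> nat -> bool).
Variables (a b : nat -> R) (A B : R).
Hypothesis g_lt : forall u v, g u v -> (u < n) && (v < n).
Hypothesis g_def : forall u v, u < n -> v < n ->
  g u v = (u != v) && ((A < a u + a v)%R || (B < b u + b v)%R).

Lemma g_sym u v : g u v = g v u.
Proof.
apply/idP/idP => h; have /andP [hu hv] := g_lt h; move: h;
  by rewrite !g_def // eq_sym (addrC (a u)) (addrC (b u)).
Qed.

Lemma g_irr u : g u u = false.
Proof.
by apply/negP => h; have /andP [hu _] := g_lt h; rewrite g_def ?eqxx in h.
Qed.

Definition coadj u v := (u != v) && ~~ g u v.

Lemma coadj_sym u v : coadj u v = coadj v u.
Proof. by rewrite /coadj eq_sym g_sym. Qed.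

Lemma coadjP u v : u < n -> v < n -> coadj u v ->
  (a u + a v <= A)%R /\ (b u + b v <= B)%R.
Proof.
move=> hu hv /andP [uv]; rewrite g_def // uv /= negb_or -!leNgt.
by case/andP.
Qed.

Definition small u := (a u + a u <= A)%R && (b u + b u <= B)%R.

Lemma small_nadj u v : small u -> small v -> ~~ g u v.
Proof.
move=> /andP [a1 b1] /andP [a2 b2]; apply/negP => h.
have /andP [hu hv] := g_lt h; move: h; rewrite g_def // => /andP [_].
by case/orP; lra.
Qed.

(** A non-small vertex exceeds half of [A] or half of [B]. Of three, two exceed the same half, and
    these would be adjacent. *)
Lemma big_triple u v w : u < n -> v < n -> w < n ->
  coadj u v -> coadj u w -> coadj v w -> [|| small u, small v | small w].
Proof.
move=> hu hv hw /(coadjP hu hv) [a1 b1] /(coadjP hu hw) [a2 b2].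
move=> /(coadjP hv hw) [a3 b3].
case: (boolP (small u)) => // su; case: (boolP (small v)) => // sv.
case: (boolP (small w)) => // sw /=; move: su sv sw.
rewrite /small !negb_and -!ltNge => /orP su /orP sv /orP sw.
by case: su => ?; case: sv => ?; case: sw => ?; lra.
Qed.

(* Vertices outside [small] that are not adjacent to a common vertex outside
   [small] exceed the same threshold, so their neighbourhoods in [small] are
   nested. *)
Lemma crossing_cert x y z v w :
  x < n -> y < n -> z < n -> v < n -> w < n ->
  coadj x y -> coadj x z -> g y v -> ~~ g z v -> g z w -> ~~ g y w ->
  [|| small x, small y, small z, ~~ small v | ~~ small w].
Proof.
move=> hx hy hz hv hw /(coadjP hx hy) [a1 b1] /(coadjP hx hz) [a2 b2].
move=> yv zv zw yw.
case: (boolP (small x)) => // sx; case: (boolP (small y)) => // sy.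
case: (boolP (small z)) => // sz; case: (boolP (small v)) => // sv.
case: (boolP (small w)) => // sw /=.
have zv' : z != v by apply: contraNneq sz => ->.
have yw' : y != w by apply: contraNneq sy => ->.
move: yv zv zw yw; rewrite !g_def // zv' yw' /= !negb_or -!leNgt.
move=> /andP [_ yv] /andP [zv1 zv2] /andP [_ zw] /andP [yw1 yw2].
move: sx sy sz sv sw; rewrite /small !negb_and -!ltNge.
move=> /orP sx /orP sy /orP sz /andP [v1 v2] /andP [w1 w2].
move: yv zw => /orP yv /orP zw.
by case: sx => ?; case: sy => ?; case: sz => ?; case: yv => ?; case: zw => ?; lra.
Qed.

(* Otherwise the edges [c i, c i.+2] would lie alternately in the first and in
   the second threshold graph only, around a closed walk of odd length. *)
Lemma odd_closed_walk (c : nat -> nat) m : odd m ->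
  (forall i, c i < n) -> (forall i, c (i + m) = c i) ->
  (forall i, coadj (c i) (c i.+1)) ->
  exists2 i, i < m & (c i == c i.+2) || coadj (c i) (c i.+2).
Proof.
move=> om cn per cc.
case: (boolP (has (fun i => (c i == c i.+2) || coadj (c i) (c i.+2)) (iota 0 m))).
  by case/hasP=> i; rewrite mem_iota => hi; exists i.
move/hasPn=> no; exfalso.
have adj i : g (c i) (c i.+2).
  have m0 : 0 < m by rewrite lt0n; apply: contraTneq om => ->.
  have E k : c k = c (k %% m).
    rewrite {1}(divn_eq k m) addnC; elim: (k %/ m) => [|q IH]; first by rewrite addn0.
    by rewrite mulSn addnCA addnC per.
  have E2 k j : c (k + j) = c (k %% m + j).
    by rewrite E [RHS]E modnDml.
  have := no (i %% m); rewrite mem_iota /= ltn_mod m0 => /(_ isT).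
  rewrite -E -addn2 -E2 addn2 negb_or => /andP [ne].
  by rewrite /coadj ne /= negbK.
pose t i := (A < a (c i) + a (c i.+2))%R.
(* The non-edges [c i, c i.+1] and [c i.+2, c i.+3] cover the same four vertices as the edges
   [c i, c i.+2] and [c i.+1, c i.+3]. Adding the inequalities, these two edges cannot both exceed
   [A], nor both exceed [B]. *)
have alt i : t i.+1 = ~~ t i.
  have := adj i; have := adj i.+1; rewrite !g_def // => /andP [_ h1] /andP [_ h0].
  have [a1 b1] := coadjP (cn _) (cn _) (cc i).
  have [a2 b2] := coadjP (cn _) (cn _) (cc i.+2).
  move: h1 h0; rewrite /t; case: ltP => h1 /=; case: ltP => h2 //=; lra.
have alts k : t k = odd k (+) t 0.
  by elim: k => //= k IH; rewrite alt IH; case: (odd k); case: (t 0).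
(* Periodicity gives [t m = t 0], but alternation over an odd number of steps gives the opposite. *)
have := alts m; rewrite om /t -[m in c m]add0n per -[m.+2]/(2 + m) per.
by case: (_ < _)%R.
Qed.

(** * Independent triples and spanning forests of the complement *)

Section CoTriangles.

Variable O : pred nat.
Hypothesis O_lt : forall u, O u -> u < n.

(** A complement edge that extends to no independent triple inside [O]; this is what [test_edge]
    verifies for a tree edge. *)
Definition isolated_edge u v :=
  [&& O u, O v, coadj u v &
      all (fun w => ~~ [&& O w, coadj u w & coadj v w]) (iota 0 n)].

Lemma isolated_edge_sym u v : isolated_edge u v = isolated_edge v u.
Proof.
rewrite /isolated_edge coadj_sym andbCA; do 3 congr (_ && _).
by apply: eq_all => w; rewrite (andbC (coadj u w)).
Qed.

Lemma isolated_edgeP u v w : isolated_edge u v -> O w ->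
  coadj u w -> coadj v w -> False.
Proof.
case/and4P=> _ _ _ /allP h Ow uw vw.
by have := h w; rewrite mem_iota O_lt // Ow uw vw => /(_ isT).
Qed.

Definition linked u v := exists2 p, path isolated_edge u p & last u p = v.

(** The closing edge from [last x p] to [x] need not be isolated. A triangle on three consecutive
    vertices uses two consecutive edges of the closed walk, at least one of them isolated, which is
    absurd. A backtrack is cut out; this removes two edges, so parity is kept and induction on the
    length applies. *)
Lemma no_odd_walk p x : path isolated_edge x p -> O x ->
  coadj (last x p) x -> ~~ odd (size p) -> False.
Proof.
have [k] := ubnP (size p); elim: k p x => // k IH p x.
rewrite ltnS => pk xp Ox lx ev.
pose m := (size p).+1; pose c i := nth x (x :: p) (i %% m).
have cE i : i < m -> c i = nth x (x :: p) i by move=> hi; rewrite /c modn_small.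
have cm : c m = c 0 by rewrite /c modnn mod0n.
have Oc i : O (c i).
  have /allP : all O (x :: p).
    rewrite /= Ox; elim: p x xp {Ox lx pk ev m c cE cm} => //= y p IHp x.
    by case/andP=> /and4P [_ -> _ _] /IHp.
  by apply; apply: mem_nth; rewrite ltn_mod.
have Tc i : i < size p -> isolated_edge (c i) (c i.+1).
  by move=> hi; rewrite !cE ?ltnS ?(ltnW hi) //; move/(pathP x): xp; apply.
have lc : last x p = c (size p) by rewrite cE // (last_nth x).
have p0 : 0 < size p.
  by case: (p) lx => //=; rewrite /coadj eqxx.
have p2 : 1 < size p by move: p0 ev; case: (size p) => [|[]].
have cS i : c (i + m) = c i by rewrite /c modnDr.
have cm1 : c m.+1 = c 1 by rewrite -[m.+1]/(1 + m) cS.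
have cc i : coadj (c i) (c i.+1).
  have -> : c i = c (i %% m) by rewrite /c modn_mod.
  have -> : c i.+1 = c (i %% m).+1 by rewrite /c -[i.+1]addn1 -[(i %% m).+1]addn1 modnDml.
  have : i %% m < m by rewrite ltn_mod.
  rewrite ltnS leq_eqVlt => /orP [/eqP ->|hi].
    by rewrite -lc -/m cm cE.
  by have /and4P [] := Tc _ hi.
have om : odd m by rewrite /= ev.
have takeT j : path isolated_edge x (take j p).
  by move: xp; rewrite -{1}(cat_take_drop j p) cat_path => /andP [].
have last_take j : j <= size p -> last x (take j p) = c j.
  case: j => [|j] hj; first by rewrite take0 cE.
  by rewrite (last_nth x) size_takel // cE //= nth_take.
have [i im] := odd_closed_walk om (fun i => O_lt (Oc i)) cS cc.
case/orP; last first.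
  move=> tri; case: (ltnP i (size p)) => hi.
    exact: (isolated_edgeP (Tc i hi) (Oc i.+2) tri (cc _)).
  have {im hi} ip : i = size p by move: im hi; rewrite /m; lia.
  move: tri; rewrite ip -/m cm1 => tri.
  apply: (isolated_edgeP (Tc 0 p0) (Oc (size p))).
    by rewrite coadj_sym -cm; apply: cc.
  by rewrite coadj_sym.
move/eqP=> bt; have [hi|] := ltnP i.+2 m.
  have hi' : i.+2 <= size p by [].
  apply: (IH (take i p ++ drop i.+2 p) x) => //.
  - by rewrite size_cat size_takel ?size_drop; lia.
  - rewrite cat_path takeT last_take; last by lia.
    move: xp; rewrite bt -{1}(cat_take_drop i.+2 p) cat_path last_take //.
    by case/andP.
  - rewrite last_cat last_take; last by lia.
    by rewrite bt -(last_take i.+2) // -last_cat cat_take_drop.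
  - by rewrite size_cat size_takel ?size_drop; lia.
(* Here the backtrack involves the closing edge. It cancels against the last or the first edge of
   the path, and a path edge takes over as closing edge. *)
move=> hi; have [ip|ip] : i = (size p).-1 \/ i = size p by rewrite /m in im hi; lia.
  apply: (IH (take (size p).-2 p) x) => //.
  - by rewrite size_takel; lia.
  - rewrite last_take; last by lia.
    have E : i.+2 = m by rewrite ip /m; lia.
    have E' : x = c i by rewrite bt E cm cE.
    rewrite E' ip; have -> : (size p).-1 = (size p).-2.+1 by lia.
    exact: cc.
  - by rewrite size_takel; lia.
case Ep : p p0 => [//|y q] _.
have c1 : c 1 = y by rewrite cE ?Ep // /m Ep.
have cy j : j < size p -> nth y (y :: q) j = c j.+1.
  by move=> hj; rewrite cE // Ep /= (set_nth_default x) //; rewrite Ep in hj.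
apply: (IH (take (size q).-1 q) y) => //.
- by rewrite size_takel; move: pk; rewrite Ep /=; lia.
- by move: xp; rewrite Ep /= -{1}(cat_take_drop (size q).-1 q) cat_path
    => /and3P [].
- by rewrite -c1.
- rewrite (last_nth y) size_takel; last by lia.
  have -> : nth y (y :: take (size q).-1 q) (size q).-1 = c (size q).
    have -> : size q = (size q).-1.+1 by move: p2; rewrite Ep /=; lia.
    rewrite -cy /=; last by rewrite Ep /=; lia.
    by case: (size q).-1 => //= j; rewrite nth_take.
  have -> : y = c (size q).+1.
    have -> : (size q).+1 = i by rewrite ip Ep.
    by rewrite bt ip -/m cm1.
  exact: cc.
- by rewrite size_takel; move: ev p2; rewrite Ep /=; case: (size q) => //= r; rewrite negbK; lia.
Qed.

(** Join the ends of each side by a path of isolated edges. A path of even length together with its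
    side is an odd closed walk; three paths of odd length concatenate to one, whose last edge then
    serves as the closing edge. *)
Lemma no_cotriangle :
  (forall u v, O u -> O v -> coadj u v -> linked u v) ->
  forall u v w, O u -> O v -> O w -> coadj u v -> coadj v w -> coadj u w ->
  False.
Proof.
move=> con u v w Ou Ov Ow uv vw uw.
have [p1 P1 L1] := con _ _ Ou Ov uv.
have [p2 P2 L2] := con _ _ Ov Ow vw.
have [p3 P3 L3] := con _ _ Ow Ou (etrans (coadj_sym w u) uw).
case: (boolP (odd (size p1))) => o1; last first.
  by apply: (no_odd_walk P1 Ou) => //; rewrite L1 coadj_sym.
case: (boolP (odd (size p2))) => o2; last first.
  by apply: (no_odd_walk P2 Ov) => //; rewrite L2 coadj_sym.
case: (boolP (odd (size p3))) => o3; last first.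
  by apply: (no_odd_walk P3 Ow) => //; rewrite L3.
case/lastP: p3 P3 L3 o3 => // q z; rewrite rcons_path last_rcons size_rcons.
move=> /andP [P3 T3] zu o3; subst z.
apply: (@no_odd_walk (p1 ++ p2 ++ q) u) => //.
- by rewrite !cat_path P1 L1 P2 L2 P3.
- by rewrite !last_cat L1 L2; case/and4P: T3.
- by move: o3; rewrite !size_cat !oddD o1 o2 /=; case: (odd _).
Qed.

Lemma linked_refl u : linked u u.
Proof. by exists [::]. Qed.

Lemma linked_trans v u w : linked u v -> linked v w -> linked u w.
Proof.
move=> [p P1 L1] [q P2 L2]; exists (p ++ q); last by rewrite last_cat L1.
by rewrite cat_path P1 L1.
Qed.

Lemma linked_edge u v : isolated_edge u v -> linked u v.
Proof. by move=> uv; exists [:: v]; rewrite //= uv. Qed.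

Lemma linked_sym u v : linked u v -> linked v u.
Proof.
case=> p; elim: p u => [|w p IH] u /=; first by move=> _ ->; apply: linked_refl.
case/andP=> uw pp pv; apply: linked_trans (IH w pp pv) _.
by apply: linked_edge; rewrite isolated_edge_sym.
Qed.

Definition near_ok (vis : pred nat) (near : nat -> nat) := forall w, O w ->
  if near w is p.+1 then [/\ O p, vis p & coadj p w]
  else forall u, O u -> vis u -> ~~ coadj u w.

(* [cur] is the vertex set of the tree of the spanning forest that is still
   growing. *)
Definition forest_ok (vis : pred nat) :=
  (exists cur : nat -> Prop,
    [/\ forall u, cur u -> O u /\ vis u,
        forall u v, cur u -> cur v -> linked u v
      & forall u w, O u -> O w -> vis u -> ~~ vis w -> coadj u w -> cur u]) /\
  forall u w, O u -> O w -> vis u -> vis w -> coadj u w -> linked u w.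

Lemma near_step vis near u : O u -> near_ok vis near ->
  near_ok (fun v => (v == u) || vis v)
    (fun w => if O w && coadj u w then u.+1 else near w).
Proof.
move=> Ou h w Ow; rewrite Ow /=; case: ifP => uw; first by rewrite eqxx.
have := h w Ow; case: (near w) => [|p].
  move=> h' v Ov /orP [/eqP ->|vv]; first by rewrite uw.
  exact: h'.
by case=> Op vp pw; split=> //; rewrite vp orbT.
Qed.

(** If [u] has no visited co-neighbour, then no unvisited vertex has one, the old tree is complete,
    and [u] alone starts a new one. Otherwise [p] belongs to the growing tree, because all
    complement edges from visited to unvisited vertices start there, and [u] joins through the
    isolated edge to [p]. *)
Lemma forest_step vis near u : O u -> ~~ vis u -> near_ok vis near ->
  (if near u is p.+1 then isolated_edge u p
   else forall w, O w -> ~~ vis w -> near w = 0) ->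
  forest_ok vis -> forest_ok (fun v => (v == u) || vis v).
Proof.
move=> Ou nu hn hu [[cur [c1 c2 c3]] ha].
have irr : coadj u u = false by rewrite /coadj eqxx.
have hnu := hn u Ou; case: (near u) hu hnu => [|p] hu hnu.
  split.
    exists (eq u); split=> [v <-|v w <- <-|v w Ov Ow].
    - by rewrite eqxx.
    - exact: linked_refl.
    - case/orP=> [/eqP -> //|vv]; rewrite negb_or => /andP [_ nw].
      by have := hn w Ow; rewrite hu // => /(_ v Ov vv) /negbTE ->.
  move=> v w Ov Ow /orP [/eqP ->|vv] /orP [/eqP ->|vw].
  - by rewrite irr.
  - by rewrite coadj_sym (negbTE (hnu w Ow vw)).
  - by rewrite (negbTE (hnu v Ov vv)).
  - exact: ha.
have [Op vp pu] := hnu.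
have cp : cur p by apply: c3 pu.
have lu v : cur v -> linked u v.
  by move=> cv; apply: linked_trans (linked_edge hu) (c2 _ _ cp cv).
split.
  exists (fun v => v = u \/ cur v); split.
  - move=> v [->|/c1 [Ov ->]]; first by rewrite eqxx.
    by rewrite orbT.
  - move=> v w [->|cv] [->|cw]; [exact: linked_refl|exact: lu| |exact: c2].
    by apply: linked_sym; apply: lu.
  - move=> v w Ov Ow /orP [/eqP ->|vv]; first by left.
    by rewrite negb_or => /andP [_ nw] vw; right; apply: c3 vw.
move=> v w Ov Ow /orP [/eqP ->|vv] /orP [/eqP ->|vw].
- by rewrite irr.
- by rewrite coadj_sym => wu; apply: lu; apply: c3 wu.
- by move=> vu; apply: linked_sym; apply: lu; apply: c3 vu.
- exact: ha.
Qed.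

End CoTriangles.

(** * Correctness of the labelling *)

Definition lab s u := 0 < ar s aLab u.
Definition seg s u := vr s vS <= u < vr s vS + vr s vLen.

Lemma lab_ext s s' : ar s' aLab = ar s aLab -> lab s' = lab s.
Proof. by rewrite /lab => ->. Qed.

Lemma seg_ext s s' : vr s' vS = vr s vS -> vr s' vLen = vr s vLen ->
  seg s' = seg s.
Proof. by rewrite /seg => -> ->. Qed.

Definition cert s :=
  let c := [seq vr s j | j <- iota 4 5] in
  all (seg s) c && has (fun u => lab s u != small u) c.

(** Within a check, once [vOk] has been set to 1 only [setcert] clears it. So the implication
    survives later tests, which keep the certificate or replace it by another. *)
Definition sound s := vr s vOk = 0 -> cert s.

Lemma cert_ext s s' : (forall r, r \in [:: 1; 2; 4; 5; 6; 7; 8] -> vr s' r = vr s r) ->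
  ar s' aLab = ar s aLab -> cert s -> cert s'.
Proof.
by move=> hv ha; rewrite /cert /= /seg /lab !ha !hv.
Qed.

Lemma sound_ext s s' :
  (forall r, r \in [:: 1; 2; 3; 4; 5; 6; 7; 8] -> vr s' r = vr s r) ->
  ar s' aLab = ar s aLab -> sound s -> sound s'.
Proof.
move=> hv ha hs h; apply: cert_ext (hs _) => // [r hr|].
  by apply: hv; move: hr; rewrite !inE; lia.
by rewrite -hv.
Qed.

Lemma frame_sound p s s' : frame p s s' ->
  all (fun r => ~~ writes p r) (iota 1 8) -> ~~ writes_array p aLab ->
  sound s -> sound s'.
Proof.
case=> F1 F2 _ /allP h1 h2; apply: sound_ext => [r hr|]; last exact: F2.
exact: F1 (h1 r hr).
Qed.

Lemma frame_seg p s s' : frame p s s' -> ~~ writes p vS -> ~~ writes p vLen ->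
  seg s' = seg s.
Proof. by case=> F1 _ _ h1 h2; apply: seg_ext; apply: F1. Qed.

Lemma frame_lab p s s' : frame p s s' -> ~~ writes_array p aLab ->
  lab s' = lab s.
Proof. by case=> _ F2 _ h; apply: lab_ext; apply: F2. Qed.

Let evE := (evb_and, evb_not, evb_eq, evb_pos_adj g_lt, evb_pos).

(** The assignments are sequential; [free] forbids reading variables 3 to 8, so that all five
    expressions keep their initial values. *)
Lemma setcert_spec s x1 x2 x3 x4 x5 :
  let s' := eval n g (setcert x1 x2 x3 x4 x5) s in
  let free x := all (fun r => ~~ reads x r) (iota 3 6) in
  let e x := ev n g s x in
  let wrong x := lab s (e x) != small (e x) in
  [&& free x1, free x2, free x3, free x4 & free x5] ->
  [&& seg s (e x1), seg s (e x2), seg s (e x3), seg s (e x4) & seg s (e x5)] ->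
  [|| wrong x1, wrong x2, wrong x3, wrong x4 | wrong x5] ->
  vr s' vOk = 0 /\ cert s'.
Proof.
move=> s' free e wrong /and5P [f1 f2 f3 f4 f5] /and5P [g1 g2 g3 g4 g5] hw.
split; first by [].
have E x t : free x -> (forall r, r \notin iota 3 6 -> vr t r = vr s r) ->
    ar t = ar s -> ev n g t x = e x.
  move=> /allP fx ht ha; apply: ev_ext => [r rx|k]; last by rewrite ha.
  by apply: ht; apply: contraL rx; apply: fx.
have up f i v : i \in iota 3 6 ->
    (forall r, r \notin iota 3 6 -> f r = vr s r) ->
    forall r, r \notin iota 3 6 -> upd f i v r = vr s r.
  by move=> hi ht r hr; rewrite upd_neq ?ht //; apply: contraNneq hr => ->.
have E1 : vr s' 4 = e x1 by [].
have E2 : vr s' 5 = e x2 by apply: E => // r hr; apply: up.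
have E3 : vr s' 6 = e x3 by apply: E => // r hr; do 2 (apply: (up) => // {hr}r hr).
have E4 : vr s' 7 = e x4 by apply: E => // r hr; do 3 (apply: (up) => // {hr}r hr).
have E5 : vr s' 8 = e x5 by apply: E => // r hr; do 4 (apply: (up) => // {hr}r hr).
have E6 : [seq vr s' j | j <- iota 4 5] = [:: e x1; e x2; e x3; e x4; e x5].
  by rewrite -E1 -E2 -E3 -E4 -E5.
rewrite /cert E6; apply/andP; split.
  by apply/and5P; split=> //; apply/andP.
rewrite -[has _ _]/[|| wrong x1, wrong x2, wrong x3, wrong x4, wrong x5 | false].
by rewrite orbF.
Qed.

Lemma locateP x i w be (c : nat -> bool) s :
  [&& i != vS, i != vLen, w != vS, w != vLen & i != w] ->
  [&& x != vS, x != vLen, x != i & x != w] ->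
  [&& ~~ breads be x & ~~ breads be i] ->
  vr s vS + vr s vLen <= n ->
  (forall u, evb n g (setv w u s) be = c u) ->
  let s' := eval n g (locate x i w be) s in
  frame (locate x i w be) s s' /\
  ((vr s' x = 0 /\ forall u, seg s u -> ~~ c u) \/
   exists u, [/\ seg s u, vr s' x = u.+1 & c u]).
Proof.
move=> h1 h2 h3 hn hc s'; split; first exact: frame_eval.
have [[-> no]|[u [su -> cu]]] := @locate_spec n g x i w be s h1 h2 h3 hn.
  by left; split=> // u su; rewrite -hc no.
by right; exists u; rewrite -hc.
Qed.

Lemma segn s u : vr s vS + vr s vLen <= n -> seg s u -> u < n.
Proof. by rewrite /seg; lia. Qed.

Lemma check_edges_spec s : vr s vS + vr s vLen <= n -> sound s ->
  let s' := eval n g check_edges s in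
  sound s' /\ (vr s' vOk <> 0 -> vr s vOk <> 0 /\
    forall u v, seg s u -> seg s v -> lab s u -> lab s v -> ~~ g u v).
Proof.
move=> hn hs; rewrite /check_edges.
set body := If _ _ _.
have [|k s1 hk [F1 F2 _] [hI1 hI2]|s1 [[h1 h2] _ ->]] := @scan_ind n g
  (fun k s1 => sound s1 /\ (vr s1 vOk <> 0 -> vr s vOk <> 0 /\
    forall u v, vr s vS <= u < vr s vS + k -> seg s v -> lab s u -> lab s v ->
      ~~ g u v)) vI vU body s isT isT hn.
- by split=> // h; split=> // u v; lia.
- set u := vr s vS + k; set s2 := tick 6 _.
  have lab2 : lab s2 = lab s := lab_ext (F2 aLab isT).
  have seg2 : seg s2 = seg s := seg_ext (F1 vS isT) (F1 vLen isT).
  have hn2 : vr s2 vS + vr s2 vLen <= n by rewrite -[vr s2 vS]/(vr s1 vS) -[vr s2 vLen]/(vr s1 vLen) !F1.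
  have su : seg s u by rewrite /seg; lia.
  rewrite /body eval_If evE -[_ < _]/(lab s2 u) lab2; case: ifP => lu; last first.
    rewrite eval_Nop; split; first exact: hI1.
    move=> /hI2 [h3 h4]; split=> // v w hv; have [->|vu] := eqVneq v u.
      by rewrite lu.
    by apply: h4; lia.
  rewrite eval_Sq; set s3 := tick _ s2.
  have [|F4] := @locateP vV0 vJ vW (And (inI vW) (yadj (V vU) (V vW)))
    (fun v => lab s v && g u v) s3 isT isT isT hn2.
    by move=> v; rewrite !evE -lab2.
  set s4 := eval _ _ _ _ in F4 *; have [G1 G2 _] := F4.
  have snd4 : sound s4 := frame_sound F4 isT isT hI1.
  have seg4 : seg s4 = seg s := etrans (frame_seg F4 isT isT) seg2.
  have lab4 : lab s4 = lab s := etrans (frame_lab F4 isT) lab2.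
  rewrite eval_If evE [ev _ _ _ _]/=.
  case=> [[-> no]|[v [vs Ev /andP [lv uv]]]].
    rewrite eval_Nop; split; first exact: snd4.
    move=> ok; have [|h3 h4] := hI2; first by rewrite -[vr s1 _](G1 vOk isT : _ = vr s1 vOk).
    split=> // v w hv sw lv lw; have [->|vu] := eqVneq v u; last by apply: h4; lia.
    by have := no w; rewrite -[seg s3 _]/(seg s2 w) seg2 sw lw => /(_ isT).
  have E4 : vr s4 vU = u := G1 vU isT.
  rewrite Ev /=; set s5 := tick _ s4.
  have [|||] := @setcert_spec s5 (V vU) (dec vV0) (V vU) (V vU) (V vU).
  + by [].
  + rewrite /= -![seg s5 _]/(seg s4 _) seg4 E4 Ev subn1 su /=.
    by rewrite -[seg s3 _]/(seg s2 _) seg2 in vs; rewrite vs.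
  (* Small vertices are pairwise non-adjacent, so one of [u] and [v], both labelled as members of
     [I], is not small. *)
  + rewrite /= -![lab s5 _]/(lab s4 _) lab4 E4 Ev subn1 lu lv /=.
    have := small_nadj (u := u) (v := v); rewrite uv.
    by case: (small u) => //; case: (small v) => // /(_ isT isT).
  by move: (eval _ _ _ s5) => s6 h3 h4; split=> // ok; case: ok.
- by split.
Qed.

Definition inO_seg s u := seg s u && ~~ lab s u.
Definition vis s u := 0 < ar s aVis u.

Lemma frame_n p s s' : frame p s s' -> ~~ writes p vS -> ~~ writes p vLen ->
  vr s vS + vr s vLen <= n -> vr s' vS + vr s' vLen <= n.
Proof. by case=> F1 _ _ h1 h2; rewrite !F1. Qed.

Lemma mark_near_spec s : vr s vS + vr s vLen <= n -> seg s (vr s vU) ->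
  let s' := eval n g mark_near s in
  frame mark_near s s' /\ forall w, inO_seg s w ->
    ar s' aNear w = if coadj (vr s vU) w then (vr s vU).+1 else ar s aNear w.
Proof.
move=> hn su s'; split; first exact: frame_eval.
have un := segn hn su.
have [|k s1 hk F hI|s1 [hI _]] := @scan_ind n g
  (fun k s1 => forall w, inO_seg s w ->
    ar s1 aNear w = if (w < vr s vS + k) && coadj (vr s vU) w
    then (vr s vU).+1 else ar s aNear w) vJ vW
  (If (And (inO vW) (coa (V vU) (V vW)))
              (Sto aNear (V vW) (Plus (V vU) (N 1))) Nop) s isT isT hn.
- by move=> w /andP [/andP [hw _] _]; rewrite addn0 ltnNge hw.
- have [F1 F2 _] := F.
  set w0 := vr s vS + k; set s2 := tick 6 _.
  have E : vr s2 vU = vr s vU := F1 vU isT.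
  have lab2 : lab s2 = lab s := lab_ext (F2 aLab isT).
  have Ev : evb n g s2 (And (inO vW) (coa (V vU) (V vW)))
          = ~~ lab s w0 && coadj (vr s vU) w0.
    by rewrite !evE -lab2 -E.
  rewrite eval_If Ev; case: ifP => h0 w Ow; have hw := hI w Ow; last first.
    rewrite eval_Nop; rewrite -[LHS]/(ar s1 aNear w) hw.
    have [E0|ne] := eqVneq w w0; last by congr (if _ && _ then _ else _); lia.
    move: h0; rewrite -E0; case/andP: Ow => _ -> /= ->.
    by rewrite !andbF.
  rewrite eval_Sto -[LHS]/(if w == w0 then minn (vr s2 vU + 1) (cap n) else ar s1 aNear w).
  rewrite E hw; have [E0|ne] := eqVneq w w0.
    case/andP: h0 => _; rewrite -E0 => ->.
    rewrite cap_gt; last by lia.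
    by rewrite addn1 E0 /w0 addnS ltnSn.
  by congr (if _ && _ then _ else _); rewrite /w0; lia.
rewrite {}/s' => -> w Ow; rewrite -[LHS]/(ar s1 aNear w) hI //.
by case/andP: Ow => /andP [_ ->].
Qed.

(** The last disjunction is shaped for [forest_step]: a new tree is begun only when no unvisited
    outside vertex has a visited co-neighbour. *)
Lemma select_spec s : vr s vS + vr s vLen <= n ->
  let s' := eval n g select s in
  (vr s' vSel = 0 /\ forall u, inO_seg s u -> vis s u) \/
   exists u, [/\ inO_seg s u, ~~ vis s u, vr s' vSel = u.+1 &
     0 < ar s aNear u \/ forall w, inO_seg s w -> ~~ vis s w -> ar s aNear w = 0].
Proof.
move=> hn; rewrite /select eval_Sq.
have [|F1 L1] := @locateP vSel vJ vW (And (inO vW) (And (Is0 (Arr aVis (V vW)))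
        (Pos (Arr aNear (V vW)))))
  (fun u => [&& ~~ lab s u, ~~ vis s u & 0 < ar s aNear u]) s isT isT isT hn.
  by move=> u; rewrite !evE.
move: (eval _ _ _ s) F1 L1 => s1 F1 L1; have [V1 A1 _] := F1.
rewrite eval_If evE [ev _ _ _ _]/=.
case: L1 => [[E no]|[u [su E /and3P [lu vu nu]]]]; last first.
  by rewrite E; right; exists u; split; rewrite ?/inO_seg ?su //; left.
rewrite E [_ < _]/=.
have {}no w : inO_seg s w -> ~~ vis s w -> ar s aNear w = 0.
  case/andP=> sw lw vw; have := no w sw; rewrite lw vw /=; lia.
have [|F2 L2] := @locateP vSel vJ vW (And (inO vW) (Is0 (Arr aVis (V vW))))
  (fun u => ~~ lab s u && ~~ vis s u) (tick (bcost (Pos (V vSel))) s1)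
  isT isT isT (frame_n F1 isT isT hn).
  by move=> u; rewrite !evE -[lab s]/(fun u => 0 < ar s aLab u) -[vis s]/(fun u => 0 < ar s aVis u) -!A1.
have seg1 : seg (tick (bcost (Pos (V vSel))) s1) = seg s := frame_seg F1 isT isT.
rewrite seg1 in L2.
case: L2 => [[-> no2]|[u [su -> /andP [lu vu]]]].
  by left; split=> // u /andP [su lu]; have := no2 u su; rewrite lu negbK.
by right; exists u; split; rewrite ?/inO_seg ?su //; right.
Qed.

Lemma test_edge_spec s p : vr s vS + vr s vLen <= n -> sound s ->
  inO_seg s (vr s vU) -> ar s aNear (vr s vU) = p.+1 -> inO_seg s p ->
  coadj (vr s vU) p ->
  let s' := eval n g test_edge s in
  sound s' /\ (vr s' vOk <> 0 -> vr s vOk <> 0 /\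
    isolated_edge (inO_seg s) (vr s vU) p).
Proof.
move=> hn snd0 Ou Ep Op up; rewrite /test_edge eval_If evE -[ev _ _ _ _]/(ar s aNear (vr s vU)) Ep.
rewrite /= eval_Sq eval_Sq eval_Asg.
set s1 := tick _ (setv _ _ _).
have Eu : vr s1 vU = vr s vU by [].
have E1 : vr s1 vP = p.
  by rewrite -[LHS]/(ar s aNear (vr s vU) - 1) Ep subn1.
have [|F2 L2] := @locateP vV0 vJ vW (And (inO vW)
           (And (coa (V vU) (V vW)) (coa (V vP) (V vW))))
  (fun w => [&& ~~ lab s w, coadj (vr s vU) w & coadj p w]) s1 isT isT isT hn.
  by move=> w; rewrite !evE -E1.
have seg1 : seg s1 = seg s by [].
rewrite seg1 in L2.
have snd2 := frame_sound F2 isT isT snd0.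
have seg2 : seg _ = seg s := frame_seg F2 isT isT.
have lab2 : lab _ = lab s := frame_lab F2 isT.
have Ok2 : vr _ vOk = vr s vOk := (let: And3 F _ _ := F2 in F vOk isT).
have U2 : vr _ vU = vr s vU := (let: And3 F _ _ := F2 in F vU isT).
have P2 : vr _ vP = p := etrans (let: And3 F _ _ := F2 in F vP isT) E1.
move: (eval _ _ _ s1) L2 snd2 seg2 lab2 Ok2 U2 P2 {F2} => s2 L2 snd2 seg2 lab2 Ok2 U2 P2.
rewrite eval_If evE [ev _ _ _ _]/=.
case: L2 => [[-> no]|[w [sw E /and3P [lw uw pw]]]].
  rewrite eval_Nop; split=> // ok; split; first by rewrite -Ok2.
  apply/and4P; split=> //; apply/allP => w _; apply/negP => /and3P [/andP [sw lw] uw pw].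
  by have := no w sw; rewrite lw uw pw.
rewrite E [_ < _]/=; set s3 := tick _ s2.
have /andP [su lu] := Ou; have /andP [sp lp] := Op.
have [|||] := @setcert_spec s3 (V vU) (V vP) (dec vV0) (V vU) (V vU).
- by [].
- by rewrite /= -![seg s3 _]/(seg s2 _) seg2 U2 P2 E subn1 su sp sw.
- rewrite /= -![lab s3 _]/(lab s2 _) lab2 U2 P2 E subn1.
  rewrite (negbTE lu) (negbTE lp) (negbTE lw).
  have := big_triple (segn hn su) (segn hn sp) (segn hn sw) up uw pw.
  by case: (small _) => //=; case: (small _) => //= ->.
by move: (eval _ _ _ s3) => s6 h3 h4; split=> // ok; case: ok.
Qed.

Lemma near_ok_ext (O v v' : pred nat) (f f' : nat -> nat) : v =1 v' ->
  (forall w, O w -> f w = f' w) -> near_ok O v f -> near_ok O v' f'.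
Proof.
move=> ev ef h w Ow; have := h w Ow; rewrite -ef //; case: (f w) => [|p].
  by move=> h' u Ou; rewrite -ev; apply: h'.
by rewrite ev.
Qed.

Lemma forest_ok_ext (O v v' : pred nat) : v =1 v' -> forest_ok O v -> forest_ok O v'.
Proof.
move=> E [[cur [c1 c2 c3]] ha]; split; last by move=> u w Ou Ow; rewrite -!E; apply: ha.
exists cur; split=> // [u|u w Ou Ow].
  by rewrite -E; apply: c1.
by rewrite -!E; apply: c3.
Qed.

(** The final alternative measures progress: each round visits exactly one new outside vertex until
    none is left. *)
Lemma prim_step_spec s : vr s vS + vr s vLen <= n -> sound s ->
  near_ok (inO_seg s) (vis s) (ar s aNear) ->
  let s' := eval n g prim_step s in
  [/\ sound s', near_ok (inO_seg s) (vis s') (ar s' aNear),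
    vr s' vOk <> 0 -> vr s vOk <> 0 /\
      (forest_ok (inO_seg s) (vis s) -> forest_ok (inO_seg s) (vis s'))
  & ((forall u, inO_seg s u -> vis s u) /\ vis s' =1 vis s) \/
    exists u, [/\ inO_seg s u, ~~ vis s u
      & forall v, vis s' v = (v == u) || vis s v]].
Proof.
move=> hn snd0 nok; rewrite /prim_step eval_Sq.
have := select_spec hn; have F1 := frame_eval n g select s.
move: (eval _ _ _ s) F1 => s1 F1 L1; have [V1 A1 _] := F1.
have snd1 := frame_sound F1 isT isT snd0.
have seg1 := frame_seg F1 isT isT; have lab1 := frame_lab F1 isT.
have Ok1 := V1 vOk isT; have vis1 : ar s1 aVis = ar s aVis := A1 aVis isT.
have near1 : ar s1 aNear = ar s aNear := A1 aNear isT.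
have hn1 := frame_n F1 isT isT hn.
rewrite eval_If evE [ev _ _ _ _]/=; case: L1 => [[E all]|[u [Ou vu E hu]]].
  rewrite E eval_Nop; split.
  - exact: snd1.
  - by rewrite /vis /= vis1 near1.
  - by rewrite /vis /= vis1 Ok1.
  - by left; split=> // v; rewrite /vis /= vis1.
rewrite E ltn0Sn eval_Sq eval_Asg; set s2 := tick _ (setv _ _ _).
have U2 : vr s2 vU = u by rewrite -[LHS]/(vr s1 vSel - 1) E subn1.
rewrite eval_Sq eval_Sto; set s3 := tick _ (seta _ _ _ _).
have U3 : vr s3 vU = u := U2.
have seg3 : seg s3 = seg s := seg1.
have lab3 : lab s3 = lab s := lab1.
have O3 : inO_seg s3 = inO_seg s by rewrite /inO_seg seg3 lab3.
have near3 : ar s3 aNear = ar s aNear := near1.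
have vis3 v : vis s3 v = (v == u) || vis s v.
  rewrite /vis -[ar s3 aVis v]/(if v == vr s2 vU then 1 else ar s1 aVis v) U2 vis1.
  by case: (v == u).
have snd3 : sound s3 := snd1.
have Ok3 : vr s3 vOk = vr s vOk := Ok1.
have hn3 : vr s3 vS + vr s3 vLen <= n := hn1.
clearbody s3; clear s2 U2 V1 A1 snd1 seg1 lab1 Ok1 vis1 near1 hn1 F1 E s1.
rewrite eval_Sq.
set s4 := eval _ _ test_edge s3.
have F4 : frame test_edge s3 s4 by exact: frame_eval.
have [snd4 Ok4] : sound s4 /\ (vr s4 vOk <> 0 -> vr s vOk <> 0 /\
    if ar s aNear u is p.+1 then isolated_edge (inO_seg s) u p else True).
  case Eu : (ar s aNear u) => [|p].
    have E4 : s4 = tick (bcost (Pos (Arr aNear (V vU)))) s3.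
      by rewrite /s4 /test_edge eval_If evE -[ev _ _ _ _]/(ar s3 aNear (vr s3 vU))
        U3 near3 Eu /=.
    by rewrite E4; split=> //; rewrite /= Ok3.
  have := nok u Ou; rewrite Eu => - [Op vp pu].
  have := @test_edge_spec s3 p hn3 snd3; rewrite O3 U3 near3 Ok3; apply=> //.
  by rewrite coadj_sym.
have [V4 A4 _] := F4.
have hn4 := frame_n F4 isT isT hn3.
have seg4 : seg s4 = seg s := etrans (frame_seg F4 isT isT) seg3.
have O4 : inO_seg s4 = inO_seg s.
  by rewrite -O3 /inO_seg (frame_lab F4 isT) (frame_seg F4 isT isT).
have U4 : vr s4 vU = u := etrans (V4 vU isT) U3.
have near4 : ar s4 aNear = ar s aNear := etrans (A4 aNear isT) near3.
have vis4 v : vis s4 v = (v == u) || vis s v by rewrite -vis3 /vis A4.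
clearbody s4.
have [|F5 N5] := mark_near_spec hn4; first by rewrite seg4 U4; case/andP: Ou.
have [V5 A5 _] := F5; have snd5 := frame_sound F5 isT isT snd4.
have Ok5 := V5 vOk isT; rewrite O4 U4 near4 in N5.
move: (eval _ _ _ s4) A5 N5 snd5 Ok5 {F5 V5} => s5 A5 N5 snd5 Ok5.
have vis5 v : vis s5 v = (v == u) || vis s v by rewrite -vis4 /vis A5.
split=> //.
- apply: near_ok_ext (near_step Ou nok) => [v|w Ow]; first by rewrite vis5.
  by rewrite N5 // Ow.
- rewrite Ok5 => /Ok4 [ok0 hE]; split=> // fok.
  apply: (@forest_ok_ext _ (fun v => (v == u) || vis s v)) => [v|].
    by rewrite vis5.
  apply: forest_step nok _ fok => //; case: (ar s aNear u) hu hE => [|p] //.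
  by case.
- by right; exists u.
Qed.

Lemma check_triples_spec s : vr s vS + vr s vLen <= n -> sound s ->
  let s' := eval n g check_triples s in
  sound s' /\ (vr s' vOk <> 0 -> vr s vOk <> 0 /\
    forall u v w, inO_seg s u -> inO_seg s v -> inO_seg s w ->
      coadj u v -> coadj v w -> coadj u w -> False).
Proof.
move=> hn snd0; rewrite /check_triples eval_Sq.
set p0 := scan _ _ _.
have F1 := frame_eval n g p0 s.
have {F1} : exists s1, [/\ eval n g p0 s = s1, frame p0 s s1 &
    forall u, seg s u -> ar s1 aVis u = 0 /\ ar s1 aNear u = 0].
  eexists; split; [reflexivity|exact: F1|].
  have [|k s1 hk F hI|s1 [hI _ E]] := @scan_ind n g
    (fun k s1 => forall u, vr s vS <= u < vr s vS + k ->
      ar s1 aVis u = 0 /\ ar s1 aNear u = 0) vJ vW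
    (Sq (Sto aVis (V vW) (N 0)) (Sto aNear (V vW) (N 0))) s isT isT hn.
  - by move=> u; lia.
  - move=> u hu; rewrite eval_Sq !eval_Sto.
    set w := vr s vS + k.
    rewrite -[ar _ aVis u]/(if u == w then 0 else ar s1 aVis u).
    rewrite -[ar _ aNear u]/(if u == w then 0 else ar s1 aNear u).
    by case: eqP => // ne; apply: hI; rewrite /w in ne; lia.
  - by rewrite E.
case=> s1 [-> F1 Z1].
have seg1 := frame_seg F1 isT isT; have lab1 := frame_lab F1 isT.
have snd1 := frame_sound F1 isT isT snd0.
have hn1 := frame_n F1 isT isT hn.
have Ok1 := (let: And3 F _ _ := F1 in F vOk isT).
pose O := inO_seg s.
(* Unless all outside vertices are visited, k rounds have visited at least k vertices of the
   segment; after [vLen] rounds the segment is exhausted. *)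
have [|k s2 hk F2|s2 [[snd2 nok2 Ok2 K2] F2 ->]] := @for_ind n g
  (fun k s2 => [/\ sound s2, near_ok O (vis s2) (ar s2 aNear),
     vr s2 vOk <> 0 -> vr s1 vOk <> 0 /\ forest_ok O (vis s2)
   & (forall u, O u -> vis s2 u) \/
      k <= count (vis s2) (iota (vr s vS) (vr s vLen))])
  vK vLen prim_step s1.
- have v0 u : O u -> vis s1 u = false.
    by case/andP=> su _; rewrite /vis (Z1 u su).1.
  split=> //; last by right.
    move=> w Ow; rewrite -[ar _ _ w]/(ar s1 aNear w).
    have -> : ar s1 aNear w = 0 by case/andP: Ow => sw _; have [] := Z1 w sw.
    by move=> u Ou; rewrite -[vis _ u]/(vis s1 u) v0.
  move=> ok; split=> //; split.
    exists (fun=> False); split=> // u w Ou.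
    by rewrite -[vis _ u]/(vis s1 u) v0.
  by move=> u w Ou _; rewrite -[vis _ u]/(vis s1 u) v0.
- move=> _ [snd2 nok2 Ok2 K2].
  have seg2 : seg s2 = seg s by rewrite -seg1; exact: frame_seg F2 isT isT.
  have O2 : inO_seg s2 = O.
    by rewrite /O /inO_seg seg2 -lab1 (frame_lab F2 isT).
  have hn2 := frame_n F2 isT isT hn1.
  have := @prim_step_spec s2 hn2 snd2; rewrite O2 => /(_ nok2).
  move: (eval _ _ _ s2) => s3 [snd3 nok3 Ok3 K3].
  split=> //.
    by move=> /Ok3 [/Ok2 [ok1 f2] f3]; split=> //; apply: f3.
  case: K2 => [all|K2].
    left=> u Ou; rewrite -[vis _ u]/(vis s3 u).
    by case: K3 => [[_ ->]|[v [_ _ ->]]]; rewrite all ?orbT.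
  case: K3 => [[all E]|[v [Ov nv E]]].
    by left=> u Ou; rewrite -[vis _ u]/(vis s3 u) E all.
  right; rewrite -[vis _]/(vis s3) (count_add1 (iota_uniq _ _) _ nv E) //.
  by rewrite mem_iota; case/andP: Ov.
have all u : O u -> vis s2 u.
  case: K2 => [all|K2]; first exact: all.
  move=> /andP [su _]; have : all (vis s2) (iota (vr s vS) (vr s vLen)).
    rewrite all_count eqn_leq count_size size_iota.
    by rewrite (let: And3 F _ _ := F1 in F vLen isT) in K2.
  by move/allP; apply; rewrite mem_iota.
split; first exact: snd2.
move=> /Ok2 [ok1 [_ hl]]; split; first by rewrite -Ok1.
apply: (no_cotriangle (O := O)); first by move=> u /andP [/(segn hn)].
by move=> u v Ou Ov; apply: hl => //; apply: all.
Qed.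

(** * Outside vertices that can occur alone *)

Definition degI s u := count (fun w => lab s w && g u w) (iota (vr s vS) (vr s vLen)).

Lemma degree_spec s : vr s vS + vr s vLen <= n ->
  let p := scan vJ vW (If (And (inI vW) (yadj (V vU) (V vW)))
       (Sto aDeg (V vU) (Plus (Arr aDeg (V vU)) (N 1))) Nop) in
  ar s aDeg (vr s vU) = 0 ->
  let s' := eval n g p s in
  ar s' aDeg (vr s vU) = degI s (vr s vU) /\
  forall v, v != vr s vU -> ar s' aDeg v = ar s aDeg v.
Proof.
move=> hn p z0.
have [|k s1 hk [F1 F2 _] [h1 h2]|s1 [[h1 h2] _ ->]] := @scan_ind n g
  (fun k s1 => ar s1 aDeg (vr s vU) =
       count (fun w => lab s w && g (vr s vU) w) (iota (vr s vS) k) /\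
     forall v, v != vr s vU -> ar s1 aDeg v = ar s aDeg v) vJ vW
  (If (And (inI vW) (yadj (V vU) (V vW)))
       (Sto aDeg (V vU) (Plus (Arr aDeg (V vU)) (N 1))) Nop) s isT isT hn.
- by split.
- set w := vr s vS + k; set s2 := tick 6 _.
  have U2 : vr s2 vU = vr s vU := F1 vU isT.
  have lab2 : lab s2 = lab s := lab_ext (F2 aLab isT).
  have Ev : evb n g s2 (And (inI vW) (yadj (V vU) (V vW))) = lab s w && g (vr s vU) w.
    by rewrite !evE -lab2 -U2.
  have cS : count (fun w => lab s w && g (vr s vU) w) (iota (vr s vS) k.+1) =
     count (fun w => lab s w && g (vr s vU) w) (iota (vr s vS) k)
       + (lab s w && g (vr s vU) w).
    by rewrite -[k.+1]addn1 iotaD count_cat /= addn0.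
  rewrite eval_If Ev cS; case: ifP => _; last by rewrite eval_Nop addn0.
  rewrite eval_Sto; set e0 := ev n g _ (Plus _ _).
  have E0 : e0 = (ar s1 aDeg (vr s vU)).+1.
    rewrite /e0 -[LHS]/(minn (ar s1 aDeg (vr s2 vU) + 1) (cap n)) U2 h1 cap_gt addn1 //.
    by rewrite ltnS; apply: leq_trans (count_size _ _) _; rewrite size_iota; lia.
  split.
    rewrite -[LHS]/(if vr s vU == vr s2 vU then e0 else ar s1 aDeg (vr s vU)).
    by rewrite U2 eqxx E0 h1 addn1.
  move=> v ne; rewrite -[LHS]/(if v == vr s2 vU then e0 else ar s1 aDeg v).
  by rewrite U2 (negbTE ne) h2.
- by split.
Qed.

Lemma degrees_spec s : vr s vS + vr s vLen <= n ->
  let s' := eval n g degrees s in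
  forall u, seg s u -> ar s' aDeg u = degI s u.
Proof.
move=> hn; rewrite /degrees; set body := Sq _ _.
have [|k s1 hk F hI|s1 [hI _ ->]] := @scan_ind n g
  (fun k s1 => forall u, vr s vS <= u < vr s vS + k -> ar s1 aDeg u = degI s u)
  vI vU body s isT isT hn.
- by move=> u; lia.
- have [F1 F2 _] := F; set u := vr s vS + k; set s2 := tick 6 _.
  rewrite /body eval_Sq eval_Sto; set s3 := tick _ (seta _ _ _ _).
  have hn3 : vr s3 vS + vr s3 vLen <= n := frame_n F isT isT hn.
  have Z3 : ar s3 aDeg (vr s3 vU) = 0.
    by rewrite -[LHS]/(if u == u then 0 else ar s1 aDeg u) eqxx.
  have D3 : degI s3 u = degI s u.
    by rewrite /degI -![vr s3 _]/(vr s1 _) !F1 // -[lab s3]/(lab s1) (frame_lab F isT).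
  have [h1 h2] := degree_spec hn3 Z3.
  move: (eval _ _ _ s3) h1 h2 => s4 h1 h2 v hv.
  have [E|ne] := eqVneq v u; first by rewrite E -D3; exact: h1.
  rewrite -[LHS]/(ar s4 aDeg v) h2 //.
  rewrite -[LHS]/(if v == u then 0 else ar s1 aDeg v) (negbTE ne) hI //.
  by rewrite /u in ne; lia.
- exact: hI.
Qed.

Lemma least_degree_spec s : vr s vS + vr s vLen <= n ->
  let s' := eval n g least_degree s in
  (vr s' vY0 = 0 /\ forall y, inO_seg s y -> ~~ coadj (vr s vU) y) \/
  exists y, [/\ inO_seg s y, coadj (vr s vU) y, vr s' vY0 = y.+1 &
    forall z, inO_seg s z -> coadj (vr s vU) z -> ar s aDeg y <= ar s aDeg z].
Proof.
move=> hn; rewrite /least_degree eval_Sq eval_Asg; set s0 := tick _ _.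
set body := If _ _ _.
have [|k s1 hk F hI|s1 [hI _ ->]] := @scan_ind n g
  (fun k s1 =>
    (vr s1 vY0 = 0 /\ forall y, inO_seg s y -> y < vr s vS + k ->
       ~~ coadj (vr s vU) y) \/
    exists y, [/\ inO_seg s y, coadj (vr s vU) y, vr s1 vY0 = y.+1 &
    forall z, inO_seg s z -> z < vr s vS + k -> coadj (vr s vU) z ->
       ar s aDeg y <= ar s aDeg z]) vJ vW body s0 isT isT hn.
- by left; split=> // y /andP [/andP [hy _] _]; lia.
- have [F1 F2 _] := F; set w := vr s0 vS + k; set s2 := tick 6 _.
  have U2 : vr s2 vU = vr s vU := F1 vU isT.
  have lab2 : lab s2 = lab s := lab_ext (F2 aLab isT).
  have D2 : ar s2 aDeg = ar s aDeg := F2 aDeg isT.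
  have sw : seg s w by rewrite /seg -[vr s vS]/(vr s0 vS); move: hk; rewrite -[vr s0 vLen]/(vr s vLen) /w; lia.
  have wn := segn hn sw.
  have Ev : evb n g s2 (And (inO vW) (coa (V vU) (V vW))) =
      inO_seg s w && coadj (vr s vU) w.
    by rewrite !evE /inO_seg sw -lab2 -U2.
  have split_w z : z < vr s vS + k.+1 -> z < vr s vS + k \/ z = w.
    by rewrite /w -[vr s0 vS]/(vr s vS); lia.
  have W2 : vr s2 vW = w by [].
  have Y2 : vr s2 vY0 = vr s1 vY0 by [].
  rewrite /body eval_If Ev; clearbody w; clearbody s2; case: ifP; last first.
    move=> nw; rewrite eval_Nop.
    case: hI => [[h1 h2]|[y [h1 h2 h3 h4]]].
      left; split; first by rewrite -[LHS]/(vr s2 vY0) Y2.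
      by move=> z Oz /split_w [/(h2 z Oz) //|E]; subst z; rewrite Oz /= in nw; rewrite nw.
    right; exists y; split=> //; first by rewrite -[LHS]/(vr s2 vY0) Y2.
    by move=> z Oz /split_w [zk|E] uz; [exact: h4|subst z; rewrite Oz uz in nw].
  case/andP=> Ow uw; rewrite eval_If evE -[ev _ _ _ _]/(vr s2 vY0) Y2.
  have plus1 c t : vr t vW = w -> ev n g (tick c t) (Plus (V vW) (N 1)) = w.+1.
    by move=> h; rewrite /= h cap_gt addn1 //; lia.
  case: hI => [[h1 h2]|[y [h1 h2 h3 h4]]].
    rewrite h1 eval_Asg plus1 //; right; exists w; split=> // z Oz /split_w [zk|-> //].
    by rewrite (negbTE (h2 z Oz zk)).
  rewrite h3 ltn0Sn eval_If.
  set c := evb _ _ _ _.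
  have -> : c = (ar s aDeg w < ar s aDeg y).
    rewrite /c -[LHS]/(ar s2 aDeg (vr s2 vW) < ar s2 aDeg (vr s2 vY0 - 1)).
    by rewrite W2 Y2 h3 subn1 D2.
  case: ltnP => hlt.
    rewrite eval_Asg plus1 //; right; exists w; split=> // z Oz /split_w [zk uz|-> //].
    by apply: leq_trans (ltnW hlt) _; apply: h4.
  rewrite eval_Nop; right; exists y; split=> //.
    by rewrite -[LHS]/(vr s2 vY0) Y2.
  by move=> z Oz /split_w [zk|->] uz //; apply: h4.
- case: hI => [[h1 h2]|[y [h1 h2 h3 h4]]].
    by left; split=> // y Oy; apply: h2 => //; case/andP: Oy => /andP [].
  right; exists y; split=> // z Oz uz; apply: h4 => //.
  by case/andP: Oz => /andP [].
Qed.

(** Maximality of [u] with its non-neighbours in [I]: removed members of [I] and outside neighbours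
    of [u] are blocked by [u], so only the outside non-neighbours [y] need a blocking [v]. *)
Definition single s u := forall y, inO_seg s y -> coadj u y ->
  exists v, [/\ seg s v, lab s v, g y v & ~~ g u v].

Lemma check_single_spec s : vr s vS + vr s vLen <= n -> sound s ->
  inO_seg s (vr s vU) -> (forall u, seg s u -> ar s aDeg u = degI s u) ->
  let s' := eval n g check_single s in
  [/\ sound s', forall v, v != vr s vU -> ar s' aOne v = ar s aOne v &
    vr s' vOk <> 0 -> vr s vOk <> 0 /\
      (0 < ar s' aOne (vr s vU) <-> single s (vr s vU))].
Proof.
move=> hn snd0 Ou hdeg; set u := vr s vU.
rewrite /check_single eval_Sq eval_Sto eval_Sq; set s1 := tick _ (seta _ _ _ _).
have F2 := frame_eval n g least_degree s1.
have L2 := @least_degree_spec s1 hn.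
move: (eval _ _ _ s1) F2 L2 => s2 F2 L2.
have snd2 : sound s2 := frame_sound F2 isT isT snd0.
have hn2 : vr s2 vS + vr s2 vLen <= n := frame_n F2 isT isT hn.
have seg2 : seg s2 = seg s := frame_seg F2 isT isT.
have lab2 : lab s2 = lab s := frame_lab F2 isT.
have [V2 A2 _] := F2.
have U2 : vr s2 vU = u := V2 vU isT.
have Ok2 : vr s2 vOk = vr s vOk := V2 vOk isT.
have one2 v : ar s2 aOne v = if v == u then 1 else ar s aOne v.
  by rewrite A2.
have {}L2 : (vr s2 vY0 = 0 /\ forall y, inO_seg s y -> ~~ coadj u y) \/
  exists y, [/\ inO_seg s y, coadj u y, vr s2 vY0 = y.+1 &
    forall z, inO_seg s z -> coadj u z -> degI s y <= degI s z].
  case: L2 => [L2|[y [Oy uy E h]]]; [by left|right; exists y; split=> // z Oz uz].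
  have := h z Oz uz; rewrite -[ar s1 aDeg y]/(ar s aDeg y) -[ar s1 aDeg z]/(ar s aDeg z).
  by rewrite !hdeg //; [case/andP: Oz|case/andP: Oy].
clear V2 A2 F2 s1.
(* Common ending of the two cases in which the flag keeps its initial value 1. *)
have fin t : ar t aOne =1 ar s2 aOne -> sound t ->
   vr t vOk = vr s2 vOk -> single s u ->
   [/\ sound t, forall v, v != u -> ar t aOne v = ar s aOne v &
    vr t vOk <> 0 -> vr s vOk <> 0 /\ (0 < ar t aOne u <-> single s u)].
  move=> Eo snd Eok sg; split=> // [v ne|ok].
    by rewrite Eo one2 (negbTE ne).
  by rewrite -Ok2 -Eok; split=> //; rewrite Eo one2 eqxx.
rewrite eval_If evE -[ev _ _ _ _]/(vr s2 vY0).
case: L2 => [[-> no]|[y [Oy uy Ey least]]].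
  rewrite eval_Nop; apply: fin => // y Oy.
  by rewrite (negbTE (no y Oy)).
rewrite Ey ltn0Sn eval_Sq; set s3 := tick _ s2.
have Y3 : ev n g s3 (dec vY0) = y by rewrite -[LHS]/(vr s2 vY0 - 1) Ey subn1.
have [|F4 L4] := @locateP vV0 vJ vW (And (inI vW) (And (yadj (dec vY0) (V vW))
          (nadj (V vU) (V vW)))) (fun w => [&& lab s w, g y w & ~~ g u w])
   s3 isT isT isT hn2.
  by move=> w; rewrite !evE -lab2 -U2 -Y3.
move: (eval _ _ _ s3) F4 L4 => s4 F4 L4.
have {}L4 : (vr s4 vV0 = 0 /\ forall w, seg s w -> ~~ [&& lab s w, g y w & ~~ g u w])
   \/ exists w, [/\ seg s w, vr s4 vV0 = w.+1 & [&& lab s w, g y w & ~~ g u w]].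
  by rewrite -seg2; exact: L4.
have snd4 : sound s4 := frame_sound F4 isT isT snd2.
have hn4 : vr s4 vS + vr s4 vLen <= n := frame_n F4 isT isT hn2.
have seg4 : seg s4 = seg s := etrans (frame_seg F4 isT isT) seg2.
have lab4 : lab s4 = lab s := etrans (frame_lab F4 isT) lab2.
have [V4 A4 _] := F4.
have U4 : vr s4 vU = u := etrans (V4 vU isT) U2.
have Y4 : vr s4 vY0 = y.+1 := etrans (V4 vY0 isT) Ey.
have Ok4 : vr s4 vOk = vr s2 vOk := V4 vOk isT.
have one4 : ar s4 aOne = ar s2 aOne := A4 aOne isT.
clear V4 A4 F4 Y3 s3.
rewrite eval_If evE -[ev _ _ _ _]/(vr s4 vV0).
(* Without such a [v], the neighbours of [y] in [I] are all neighbours of [u]; [y] itself is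
   unblocked and the flag must be 0. *)
case: L4 => [[-> no]|[v [sv Ev /and3P [lv yv uv]]]].
  rewrite eval_Sto; split=> //.
    move=> v ne.
    rewrite -[LHS]/(if v == vr s4 vU then 0 else ar s4 aOne v) U4 (negbTE ne).
    by rewrite one4 one2 (negbTE ne).
  move=> ok; split; first by rewrite -Ok2 -Ok4.
  rewrite -[ar _ aOne u]/(if u == vr s4 vU then 0 else ar s4 aOne u) U4 eqxx.
  split=> // sg; have [w [sw lw yw uw]] := sg y Oy uy.
  by have := no w sw; rewrite lw yw uw.
rewrite Ev ltn0Sn eval_Sq; set s5 := tick _ s4.
have V5 : ev n g s5 (dec vV0) = v by rewrite -[LHS]/(vr s4 vV0 - 1) Ev subn1.
have [|F6 L6] := @locateP vY1 vJ vW (And (inO vW) (And (coa (V vU) (V vW))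
             (nadj (V vW) (dec vV0)))) (fun w => [&& ~~ lab s w, coadj u w & ~~ g w v])
   s5 isT isT isT hn4.
  by move=> w; rewrite !evE -lab4 -U4 -V5.
move: (eval _ _ _ s5) F6 L6 => s6 F6 L6.
have {}L6 : (vr s6 vY1 = 0 /\ forall w, seg s w -> ~~ [&& ~~ lab s w, coadj u w & ~~ g w v])
   \/ exists w, [/\ seg s w, vr s6 vY1 = w.+1 & [&& ~~ lab s w, coadj u w & ~~ g w v]].
  by rewrite -seg4; exact: L6.
have snd6 : sound s6 := frame_sound F6 isT isT snd4.
have hn6 : vr s6 vS + vr s6 vLen <= n := frame_n F6 isT isT hn4.
have seg6 : seg s6 = seg s := etrans (frame_seg F6 isT isT) seg4.
have lab6 : lab s6 = lab s := etrans (frame_lab F6 isT) lab4.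
have [W6 A6 _] := F6.
have U6 : vr s6 vU = u := etrans (W6 vU isT) U4.
have Y6 : vr s6 vY0 = y.+1 := etrans (W6 vY0 isT) Y4.
have V6 : vr s6 vV0 = v.+1 := etrans (W6 vV0 isT) Ev.
have Ok6 : vr s6 vOk = vr s2 vOk := etrans (W6 vOk isT) Ok4.
have one6 : ar s6 aOne = ar s2 aOne := etrans (A6 aOne isT) one4.
clear W6 A6 F6 V5 s5.
rewrite eval_If evE -[ev _ _ _ _]/(vr s6 vY1).
(* Without such a [z], the single vertex [v] blocks every outside non-neighbour of [u]. *)
case: L6 => [[-> no]|[z [sz Ez /and3P [lz uz zv]]]].
  rewrite eval_Nop; apply: fin => //; first by move=> w; rewrite -[LHS]/(ar s6 aOne w) one6.
  move=> z /andP [sz lz] uz; exists v; split=> //.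
  by have := no z sz; rewrite lz uz negbK.
rewrite Ez ltn0Sn eval_Sq; set s7 := tick _ s6.
have Z7 : ev n g s7 (dec vY1) = z by rewrite -[LHS]/(vr s6 vY1 - 1) Ez subn1.
have Y7 : ev n g s7 (dec vY0) = y by rewrite -[LHS]/(vr s6 vY0 - 1) Y6 subn1.
have [|F8 L8] := @locateP vV1 vJ vW (And (inI vW) (And (yadj (dec vY1) (V vW))
                (nadj (dec vY0) (V vW)))) (fun w => [&& lab s w, g z w & ~~ g y w])
   s7 isT isT isT hn6.
  by move=> w; rewrite !evE -lab6 -Z7 -Y7.
move: (eval _ _ _ s7) F8 L8 => s8 F8 L8.
have {}L8 : (vr s8 vV1 = 0 /\ forall w, seg s w -> ~~ [&& lab s w, g z w & ~~ g y w])
   \/ exists w, [/\ seg s w, vr s8 vV1 = w.+1 & [&& lab s w, g z w & ~~ g y w]].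
  by rewrite -seg6; exact: L8.
have hn8 : vr s8 vS + vr s8 vLen <= n := frame_n F8 isT isT hn6.
have seg8 : seg s8 = seg s := etrans (frame_seg F8 isT isT) seg6.
have lab8 : lab s8 = lab s := etrans (frame_lab F8 isT) lab6.
have [W8 A8 _] := F8.
have U8 : vr s8 vU = u := etrans (W8 vU isT) U6.
have Y8 : vr s8 vY0 = y.+1 := etrans (W8 vY0 isT) Y6.
have V8 : vr s8 vV0 = v.+1 := etrans (W8 vV0 isT) V6.
have Z8 : vr s8 vY1 = z.+1 := etrans (W8 vY1 isT) Ez.
have one8 : ar s8 aOne = ar s2 aOne := etrans (A8 aOne isT) one6.
clear W8 A8 F8 Z7 Y7 s7.
have /andP [su lu] := Ou; have /andP [sy ly] := Oy.
case: L8 => [[_ no]|[w [sw Ew /and3P [lw zw yw]]]].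
  have Oz : inO_seg s z by rewrite /inO_seg sz.
  (* The last search cannot fail: [y] has no more neighbours in [I] than [z], and [v] is adjacent to
     [y] only, so some [w] is adjacent to [z] only. *)
  have [|||w [ws /andP [lw zw] nw]] := count_exchange (least z Oz uz) (x := v).
  - by rewrite mem_iota.
  - by rewrite lv.
  - by rewrite (negbTE zv) andbF.
  by have := no w; rewrite /seg -mem_iota ws lw zw; move: nw; rewrite lw => -> /(_ isT).
have [|||] := @setcert_spec s8 (V vU) (dec vY0) (dec vY1) (dec vV0) (dec vV1).
- by [].
- by rewrite /= seg8 U8 Y8 Z8 V8 Ew !subn1 su sy sz sv sw.
- rewrite /= lab8 U8 Y8 Z8 V8 Ew !subn1.
  rewrite (negbTE lu) (negbTE ly) (negbTE lz) lv lw.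
  have := crossing_cert (segn hn su) (segn hn sy) (segn hn sz) (segn hn sv)
    (segn hn sw) uy uz yv zv zw yw.
  by case: (small u); case: (small y); case: (small z); case: (small v); case: (small w).
have [_ A9 _] := frame_eval n g
  (setcert (V vU) (dec vY0) (dec vY1) (dec vV0) (dec vV1)) s8.
have one9 := A9 aOne isT.
move: (eval _ _ _ s8) one9 => s9 one9 h3 h4; split=> // v' ne.
by rewrite one9 one8 one2 (negbTE ne).
Qed.

Lemma check_singles_spec s : vr s vS + vr s vLen <= n -> sound s ->
  let s' := eval n g check_singles s in
  sound s' /\ (vr s' vOk <> 0 -> vr s vOk <> 0 /\
    forall u, inO_seg s u -> 0 < ar s' aOne u <-> single s u).
Proof.
move=> hn snd0; rewrite /check_singles eval_Sq.
have D1 := degrees_spec hn; have F1 := frame_eval n g degrees s.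
move: (eval _ _ _ s) D1 F1 => s1 D1 F1.
have snd1 : sound s1 := frame_sound F1 isT isT snd0.
have hn1 : vr s1 vS + vr s1 vLen <= n := frame_n F1 isT isT hn.
have seg1 : seg s1 = seg s := frame_seg F1 isT isT.
have lab1 : lab s1 = lab s := frame_lab F1 isT.
have [V1 _ _] := F1.
have Ok1 : vr s1 vOk = vr s vOk := V1 vOk isT.
have S1 : vr s1 vS = vr s vS := V1 vS isT.
have N1 : vr s1 vLen = vr s vLen := V1 vLen isT.
set body := If _ _ _.
have [|k s2 hk F2 [snd2 Ok2]|s2 [[snd2 Ok2] _ ->]] := @scan_ind n g
  (fun k s2 => sound s2 /\ (vr s2 vOk <> 0 -> vr s1 vOk <> 0 /\
    forall u, inO_seg s u -> u < vr s vS + k ->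
      0 < ar s2 aOne u <-> single s u)) vI vU body s1 isT isT hn1.
- by split=> // ok; split=> // u /andP [/andP [hu _] _]; lia.
- have [W2 A2 _] := F2; rewrite S1; set u := vr s vS + k; set s3 := tick 6 _.
  have su : seg s u by rewrite /seg /u -N1; lia.
  have seg3 : seg s3 = seg s := etrans (frame_seg F2 isT isT) seg1.
  have lab3 : lab s3 = lab s := etrans (frame_lab F2 isT) lab1.
  have S3 : vr s3 vS = vr s vS := etrans (W2 vS isT) S1.
  have N3 : vr s3 vLen = vr s vLen := etrans (W2 vLen isT) N1.
  have O3 : inO_seg s3 = inO_seg s by rewrite /inO_seg seg3 lab3.
  have D3 v : seg s3 v -> ar s3 aDeg v = degI s3 v.
    rewrite seg3 => sv; rewrite -[LHS]/(ar s2 aDeg v) A2 // D1 //.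
    by rewrite /degI S3 N3 lab3.
  have hn3 : vr s3 vS + vr s3 vLen <= n := frame_n F2 isT isT hn1.
  have U3 : vr s3 vU = u by [].
  have Ok3 : vr s3 vOk = vr s2 vOk by [].
  have one3 : ar s3 aOne = ar s2 aOne by [].
  have snd3 : sound s3 := snd2.
  have sg3 : single s3 = single s by rewrite /single O3 seg3 lab3.
  clearbody s3.
  have split_u z : z < vr s vS + k.+1 -> z < vr s vS + k \/ z = u by rewrite /u; lia.
  have hu : evb n g s3 (inO vU) = inO_seg s u.
    by rewrite !evE -O3 /inO_seg seg3 su -U3.
  rewrite /body eval_If hu; case: ifP => Ou; last first.
    rewrite eval_Nop; split; first exact: snd3.
    rewrite -[vr _ _]/(vr s3 vOk) Ok3 => /Ok2 [ok1 h]; split=> // z Oz.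
    rewrite -[ar _ _ _]/(ar s3 aOne z) one3 => /split_u [|E]; first exact: h.
    by rewrite E Ou in Oz.
  have [||snd4 h1 h2] := @check_single_spec (tick (bcost (inO vU)) s3) hn3 snd3.
  - by rewrite -[inO_seg _]/(inO_seg s3) O3 -[vr _ _]/(vr s3 vU) U3.
  - exact: D3.
  move: (eval _ _ _ (tick _ _)) snd4 h1 h2 => s4 snd4 h1 h2.
  split; first exact: snd4.
  rewrite -[vr _ _]/(vr s4 vOk) => /h2 [].
  rewrite -[vr (tick _ _) vOk]/(vr s3 vOk) -[vr (tick _ _) vU]/(vr s3 vU) U3 Ok3.
  move=> /Ok2 [ok1 h] hs; split=> // z Oz.
  rewrite -[ar _ _ _]/(ar s4 aOne z) => /split_u [zk|->].
    rewrite h1; last by rewrite -[vr _ vU]/(vr s3 vU) U3 /u; lia.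
    by rewrite -[ar _ _ _]/(ar s3 aOne z) one3; apply: h.
  by rewrite -sg3.
split; first exact: snd2.
move=> /Ok2 [ok1 h]; split; first by rewrite -Ok1.
by move=> u Ou; apply: h => //; case/andP: Ou => /andP [_]; rewrite N1.
Qed.

Definition edge_free s :=
  forall u v, seg s u -> seg s v -> lab s u -> lab s v -> ~~ g u v.
Definition triple_free s :=
  forall u v w, inO_seg s u -> inO_seg s v -> inO_seg s w ->
    coadj u v -> coadj v w -> coadj u w -> False.
Definition singles_ok s :=
  forall u, inO_seg s u -> 0 < ar s aOne u <-> single s u.

Lemma check_spec s : vr s vS + vr s vLen <= n ->
  let s' := eval n g check s in
  frame check s s' /\
  (vr s' vOk = 0 -> cert s') /\
  (vr s' vOk <> 0 -> [/\ edge_free s', triple_free s' & singles_ok s']).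
Proof.
move=> hn s'; split; first exact: frame_eval.
rewrite {}/s' /check eval_Sq eval_Asg; set s0 := tick _ _.
rewrite eval_Sq; have F1 := frame_eval n g check_edges s0.
have [|snd1 h1] := @check_edges_spec s0 hn; first by [].
move: (eval _ _ _ s0) F1 snd1 h1 => s1 F1 snd1 h1.
have hn1 : vr s1 vS + vr s1 vLen <= n := frame_n F1 isT isT hn.
have seg1 : seg s1 = seg s := frame_seg F1 isT isT.
have lab1 : lab s1 = lab s := frame_lab F1 isT.
rewrite eval_Sq; have F2 := frame_eval n g check_triples s1.
have [snd2 h2] := check_triples_spec hn1 snd1.
move: (eval _ _ _ s1) F2 snd2 h2 => s2 F2 snd2 h2.
have hn2 : vr s2 vS + vr s2 vLen <= n := frame_n F2 isT isT hn1.
have seg2 : seg s2 = seg s := etrans (frame_seg F2 isT isT) seg1.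
have lab2 : lab s2 = lab s := etrans (frame_lab F2 isT) lab1.
have F3 := frame_eval n g check_singles s2.
have [snd3 h3] := check_singles_spec hn2 snd2.
move: (eval _ _ _ s2) F3 snd3 h3 => s3 F3 snd3 h3.
have seg3 : seg s3 = seg s := etrans (frame_seg F3 isT isT) seg2.
have lab3 : lab s3 = lab s := etrans (frame_lab F3 isT) lab2.
split=> // /h3 [/h2 [/h1 [_ h1'] h2'] h3']; split.
- by rewrite /edge_free seg3 lab3; exact: h1'.
- by rewrite /triple_free /inO_seg seg3 lab3 -seg1 -lab1.
- by rewrite /singles_ok /single /inO_seg seg3 lab3 -seg2 -lab2.
Qed.

(** * The search tree that repairs a labelling *)

Lemma flip_spec x t v :
  lab (eval n g (flip x) t) v = (v == vr t x) (+) lab t v.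
Proof.
rewrite /flip eval_If evE -[_ < _]/(lab t (vr t x)); case: ifP => h; rewrite eval_Sto.
  rewrite /lab -[ar _ aLab v]/(if v == vr t x then 0 else ar t aLab v).
  by case: eqP => // ->; rewrite -[_ < ar _ _ _]/(lab t (vr t x)) h.
rewrite /lab -[ar _ aLab v]/(if v == vr t x then 1 else ar t aLab v).
by case: eqP => // ->; rewrite -[_ < ar _ _ _]/(lab t (vr t x)) h.
Qed.

Definition wrong s u := lab s u != small u.
Definition errs s := count (wrong s) (iota (vr s vS) (vr s vLen)).
Definition good s := [/\ edge_free s, triple_free s & singles_ok s].

Lemma errs_flip s t u : seg s u -> wrong s u ->
  vr t vS = vr s vS -> vr t vLen = vr s vLen ->
  (forall v, lab t v = (v == u) (+) lab s v) -> errs s = (errs t).+1.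
Proof.
move=> su wu E1 E2 E; rewrite /errs E1 E2; apply: count_add1 (iota_uniq _ _) _ _ _.
- by rewrite mem_iota; exact: su.
- by move: wu; rewrite /wrong E eqxx; case: (lab s u); case: (small u).
- move=> v; rewrite /wrong E; have [->|ne] //= := eqVneq v u.
Qed.

Lemma save_spec d s :
  let s' := eval n g (save d) s in
  [/\ forall r, r < 100 -> vr s' r = vr s r, ar s' = ar s &
      forall j, j < 5 -> vr s' (saved d j) = vr s (4 + j)].
Proof.
have ne r x v : r < 100 -> x >= 100 -> forall f, upd f x v r = f r.
  by move=> h1 h2 f; rewrite upd_neq //; lia.
have sd j : 100 <= saved d j by rewrite /saved; lia.
have nes i j v f : i != j -> upd f (saved d i) v (saved d j) = f (saved d j).
  by move=> h; rewrite upd_neq // /saved; lia.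
rewrite /save !eval_Sq !eval_Asg; split=> //.
  by move=> r hr; rewrite /= !ne.
case=> [|[|[|[|[|//]]]]] _; rewrite /= ?(upd_eq, nes) //= !ne //.
Qed.

(** Success means that the conditions hold, whichever flips led there; failure restores the labels.
    With at most [d] errors success is forced: without errors no certificate can exist, and
    otherwise some certificate vertex is wrong and flipping it leaves one error less. *)
Lemma repair_spec d s : vr s vS + vr s vLen <= n ->
  let s' := eval n g (repair d) s in
  [/\ forall u, ~~ seg s u -> lab s' u = lab s u,
      0 < vr s' vDone -> good s',
      vr s' vDone = 0 -> lab s' =1 lab s
    & errs s <= d -> 0 < vr s' vDone].
Proof.
elim: d s => [|d IHd] s hn.
  rewrite [repair 0]/= eval_Sq eval_Asg.
  have [F1 [C1 G1]] := check_spec hn.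
  move: (eval _ _ _ s) F1 C1 G1 => s1 F1 C1 G1.
  have lab1 : lab s1 = lab s := frame_lab F1 isT.
  have seg1 : seg s1 = seg s := frame_seg F1 isT isT.
  split.
  - by move=> u _; rewrite -[lab _]/(lab s1) lab1.
  - rewrite -[vr _ vDone]/(vr s1 vOk) => ok.
    have [h1 h2 h3] := G1 (elimN eqP (lt0n_neq0 ok)).
    by split; [exact: h1|exact: h2|exact: h3].
  - by move=> _ u; rewrite -[lab _]/(lab s1) lab1.
  - rewrite -[vr _ vDone]/(vr s1 vOk) leqn0 => /eqP e0; rewrite lt0n; apply/negP => /eqP /C1.
    case/andP=> /allP hs /hasP [u hu wu]; move/eqP: e0; rewrite -leqn0 leqNgt -has_count.
    case/hasP; exists u; last by rewrite /wrong -lab1.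
    by rewrite mem_iota; have := hs u hu; rewrite seg1.
rewrite repairS eval_Sq.
have [F1 [C1 G1]] := check_spec hn.
move: (eval _ _ _ s) F1 C1 G1 => s1 F1 C1 G1.
have lab1 : lab s1 = lab s := frame_lab F1 isT.
have seg1 : seg s1 = seg s := frame_seg F1 isT isT.
rewrite eval_If evE -[ev _ _ _ _]/(vr s1 vOk); case: (posnP (vr s1 vOk)) => ok; last first.
  have [h1 h2 h3] := G1 (elimN eqP (lt0n_neq0 ok)).
  rewrite eval_Asg; split.
  - by move=> u _; rewrite -[lab _]/(lab s1) lab1.
  - by split; [exact: h1|exact: h2|exact: h3].
  - by [].
  - by [].
have {C1 G1} /andP [/allP cseg cwr] := C1 ok.
rewrite eval_Sq; have [V2 A2 S2] := save_spec d (tick (bcost (Pos (V vOk))) s1).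
move: (eval _ _ _ (tick _ _)) V2 A2 S2 => s2 V2 A2 S2.
rewrite eval_Sq eval_Asg; set s3 := tick _ _.
pose c j := vr s1 (4 + j).
have [W1 _ _] := F1.
(* As long as nothing has succeeded, each attempt so far proves its certificate vertex correctly
   labelled, provided there were at most [d.+1] errors. After five attempts this contradicts the
   certificate. *)
pose Inv j t := [/\ [/\ forall i, i < 5 -> vr t (saved d i) = c i,
    vr t vS = vr s vS, vr t vLen = vr s vLen
    & forall u, ~~ seg s u -> lab t u = lab s u],
   0 < vr t vDone -> good t,
   vr t vDone = 0 -> lab t =1 lab s &
   vr t vDone = 0 -> errs s <= d.+1 -> forall i, i < j -> ~~ wrong s (c i)].
have cs j : j < 5 -> seg s (c j).
  move=> hj; rewrite -seg1; apply: cseg; apply/mapP; exists (4 + j) => //.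
  by rewrite mem_iota; lia.
have I0 : Inv 0 s3.
  have lab3 : lab s3 = lab s.
    by rewrite -lab1; apply: lab_ext; rewrite -[LHS]/(ar s2 aLab) A2.
  split=> //; last by rewrite lab3.
  split.
  - move=> i hi; rewrite -[LHS]/(if saved d i == vDone then 0 else vr s2 (saved d i)).
    have -> : (saved d i == vDone) = false by rewrite /saved; lia.
    by rewrite S2.
  - by rewrite -[LHS]/(vr s2 vS) V2 //; exact: W1.
  - by rewrite -[LHS]/(vr s2 vLen) V2 //; exact: W1.
  - by rewrite lab3.
have IS j t : j < 5 -> Inv j t -> Inv j.+1 (eval n g (attempt d (repair d) j) t).
  move=> hj [[T1 T2 T3 T4] T5 T6 T7].
  rewrite /attempt eval_If evE -[ev _ _ _ _]/(vr t vDone).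
  case: (posnP (vr t vDone)) => dn; last first.
    rewrite eval_Nop; split.
    - by split.
    - exact: T5.
    - by rewrite -[vr _ vDone]/(vr t vDone) => h; rewrite h in dn.
    - by rewrite -[vr _ vDone]/(vr t vDone) => h; rewrite h in dn.
  rewrite eval_Sq; set t0 := tick _ t.
  have X0 : vr t0 (saved d j) = c j := T1 j hj.
  have [Vf _ _] := frame_eval n g (flip (saved d j)) t0.
  have L1 v : lab (eval n g (flip (saved d j)) t0) v = (v == c j) (+) lab s v.
    by rewrite flip_spec X0 -[lab t0 v]/(lab t v) T6.
  move: (eval _ _ _ t0) Vf L1 => t1 Vf L1.
  have {}Vf r : vr t1 r = vr t r by rewrite Vf.
  have hn1 : vr t1 vS + vr t1 vLen <= n by rewrite !Vf T2 T3.
  have segt1 : seg t1 = seg s by apply: seg_ext; rewrite Vf.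
  rewrite eval_Sq; have [R1 R2 R3 R4] := IHd t1 hn1.
  have [Fr _ _] := frame_eval n g (repair d) t1.
  move: (eval _ _ _ t1) R1 R2 R3 R4 Fr => t2 R1 R2 R3 R4 Fr.
  have fr r : r < 3 \/ 100 + 5 * d <= r -> vr t2 r = vr t r.
    by move=> hr; rewrite Fr ?Vf //; apply/negP => /repair_writes; lia.
  have X2 i : i < 5 -> vr t2 (saved d i) = c i.
    by move=> hi; rewrite fr ?T1 //; right; rewrite /saved; lia.
  have S2' : vr t2 vS = vr s vS by rewrite fr ?T2 //; left.
  have N2' : vr t2 vLen = vr s vLen by rewrite fr ?T3 //; left.
  have out2 u : ~~ seg s u -> lab t2 u = lab s u.
    move=> nu; rewrite R1 ?segt1 // L1; have [E|//] := eqVneq u (c j).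
    by rewrite E cs in nu.
  rewrite eval_If evE -[ev _ _ _ _]/(vr t2 vDone).
  case: (posnP (vr t2 vDone)) => dn2; last first.
    rewrite eval_Nop; split.
    - by split.
    - by move=> _; exact: R2.
    - by rewrite -[vr _ vDone]/(vr t2 vDone) => h; rewrite h in dn2.
    - by rewrite -[vr _ vDone]/(vr t2 vDone) => h; rewrite h in dn2.
  set t3 := tick _ t2.
  have X3 : vr t3 (saved d j) = c j := X2 j hj.
  have [Vg _ _] := frame_eval n g (flip (saved d j)) t3.
  have L3 v : lab (eval n g (flip (saved d j)) t3) v = lab s v.
    rewrite flip_spec X3 -[lab t3 v]/(lab t2 v) R3 // L1.
    by case: (v == c j); case: (lab s v).
  move: (eval _ _ _ t3) Vg L3 => t4 Vg L3.
  have {}Vg r : vr t4 r = vr t2 r by rewrite Vg.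
  split.
  - by split=> [i hi|||u _]; rewrite ?Vg ?X2.
  - by rewrite Vg dn2.
  - by move=> _; exact: L3.
  - move=> _ he i; rewrite ltnS leq_eqVlt => /orP [/eqP ->|]; last exact: T7.
    (* Had this vertex been wrong, its flip would have left at most [d] errors and the inner repair
       would have succeeded. *)
    apply/negP => wj.
    have := errs_flip (cs j hj) wj (etrans (Vf vS) T2) (etrans (Vf vLen) T3) L1.
    by move=> E; have := R4; rewrite dn2 => h; have := h _; rewrite E in he; move=> /(_ he).
have {IS} [[T1 T2 T3 T4] T5 T6 T7] := IS 4 _ isT (IS 3 _ isT (IS 2 _ isT (IS 1 _ isT (IS 0 _ isT I0)))).
rewrite !eval_Sq; split=> // he; rewrite lt0n; apply/negP => /eqP dn.
case/hasP: cwr => u /mapP [i]; rewrite mem_iota => hi -> wi.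
have := T7 dn he (i - 4); rewrite /c /wrong -lab1 subnKC; last by lia.
by rewrite wi => h; have /h : i - 4 < 5 by lia.
Qed.

(** Three non-small vertices labelled as members of [I] would be pairwise non-adjacent, against
    [big_triple]; three small ones left outside would violate [triple_free]. So there are at most
    two errors of each kind. *)
Lemma good_errs s : vr s vS + vr s vLen <= n -> edge_free s -> triple_free s ->
  errs s <= 4.
Proof.
move=> hn ef tf; set r := iota (vr s vS) (vr s vLen).
have mr u : (u \in r) = seg s u by rewrite mem_iota.
have h1 : count (fun u => lab s u && ~~ small u) r <= 2.
  rewrite leqNgt; apply/negP => /(three_of_count (iota_uniq _ _)).
  case=> x [y [z [[]]]]; rewrite !mr => sx sy sz [/andP [lx bx] /andP [ly bY] /andP [lz bz]] [xy xz yz].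
  have := big_triple (segn hn sx) (segn hn sy) (segn hn sz).
  rewrite /coadj xy xz yz !ef // (negbTE bx) (negbTE bY) (negbTE bz).
  by move=> /(_ isT isT isT).
have h2 : count (fun u => ~~ lab s u && small u) r <= 2.
  rewrite leqNgt; apply/negP => /(three_of_count (iota_uniq _ _)).
  case=> x [y [z [[]]]]; rewrite !mr => sx sy sz [/andP [lx bx] /andP [ly bY] /andP [lz bz]] [xy xz yz].
  apply: (tf x y z); rewrite /inO_seg ?sx ?sy ?sz //;
    by rewrite /coadj ?xy ?xz ?yz small_nadj.
have -> : errs s = count (predU (fun u => lab s u && ~~ small u)
    (fun u => ~~ lab s u && small u)) r.
  by apply: eq_count => u /=; rewrite /wrong; case: (lab s u); case: (small u).
have := count_predUI (fun u => lab s u && ~~ small u)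
    (fun u => ~~ lab s u && small u) r; lia.
Qed.

(** * Divide and conquer in quadratic time *)

Definition err_in s x m := count (fun u => (u < n) && wrong s u) (iota x m).

Lemma err_in_ext s t x m :
  (forall u, x <= u < x + m -> u < n -> lab t u = lab s u) ->
  err_in t x m = err_in s x m.
Proof.
move=> E; apply: eq_in_count => u; rewrite mem_iota /wrong => hu.
by case: ltnP => //= un; rewrite E.
Qed.

Lemma err_inD s x m m' : err_in s x (m + m') = err_in s x m + err_in s (x + m) m'.
Proof. by rewrite /err_in iotaD count_cat. Qed.

(** Positions from [n] on carry no errors, so a truncated last block may be treated as having full
    length. *)
Lemma err_in_errs s m : vr s vS + vr s vLen <= n -> vr s vLen <= m ->
  vr s vLen = m \/ vr s vS + vr s vLen = n -> err_in s (vr s vS) m = errs s.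
Proof.
move=> hn hm hl; rewrite -(subnKC hm) err_inD.
have -> : err_in s (vr s vS + vr s vLen) (m - vr s vLen) = 0.
  case: hl => [->|->]; first by rewrite subnn.
  apply/eqP; rewrite -leqn0 leqNgt -has_count; apply/negP => /hasP [u].
  by rewrite mem_iota => hu /andP []; lia.
rewrite addn0; apply: eq_in_count => u; rewrite mem_iota => hu.
by have -> : u < n by lia.
Qed.

(** Two halves with four errors each give at most 8, within reach of a search of depth [d]. The
    repaired block satisfies the conditions, and [good_errs] brings its errors back to four. *)
Lemma block_spec d s x L : 7 < d -> vr s vN = n -> vr s vNext = x -> x < n ->
  vr s vL = L -> 0 < L < n -> err_in s x (L + L) <= 8 ->
  let s' := eval n g (block d) s in
  [/\ vr s' vNext = x + (L + L), err_in s' x (L + L) <= 4,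
      forall u, u < n -> ~~ (x <= u < x + (L + L)) -> lab s' u = lab s u &
      ck s' <= ck s + 50 + fcost (repair d) * (L + L).+1 ^ 2].
Proof.
move=> hd EN Ex hx EL hL he.
(* Since [x] and [L] are below [n], all sums formed here stay below 3n and no addition saturates. *)
have n_cap : 3 * n <= cap n by rewrite /cap !expnS; nia.
have [wfr bdr dpr arr emr] := repair_static d.
rewrite /block eval_Sq eval_Asg eval_Sq eval_Asg eval_Sq.
set s1 := tick _ (setv vLen _ _).
have S1 : vr s1 vS = x := Ex.
have N1 : vr s1 vLen = L + L.
  by rewrite -[LHS]/(minn (vr s vL + vr s vL) (cap n)) EL; lia.
have C1 : ck s1 = ck s + 8 by rewrite /=; lia.
have X1 : vr s1 vNext = x := Ex.
have L1 : vr s1 vL = L := EL.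
have M1 : vr s1 vN = n := EN.
have lab1 : lab s1 = lab s by [].
clearbody s1.
rewrite eval_If; set b1 := evb _ _ _ _.
have Eb : b1 = (n < x + (L + L)).
  rewrite /b1 -[LHS]/(vr s1 vN < minn (vr s1 vS + vr s1 vLen) (cap n)).
  by rewrite M1 S1 N1; lia.
rewrite Eb {b1 Eb}; set s2 := (X in eval _ _ (Sq _ _) X).
have : [/\ vr s2 vS = x, vr s2 vLen = minn (L + L) (n - x) , vr s2 vNext = x,
    vr s2 vL = L & lab s2 = lab s] /\ ck s2 <= ck s + 30.
  rewrite /s2; case: ltnP => h.
    rewrite eval_Asg; split; last by rewrite /= C1; lia.
    split=> //; rewrite -[LHS]/(vr s1 vN - vr s1 vS) M1 S1; lia.
  rewrite eval_Nop; split; last by rewrite /= C1; lia.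
  by split=> //; rewrite -[LHS]/(vr s1 vLen) N1; lia.
clearbody s2; clear s1 S1 N1 C1 X1 L1 M1 lab1.
case=> - [S2 N2 X2 L2 lab2] C2.
have hn2 : vr s2 vS + vr s2 vLen <= n by rewrite S2 N2; lia.
have E2 : err_in s2 x (L + L) = errs s2.
  by rewrite -S2; apply: err_in_errs => //; rewrite ?S2 N2; lia.
have ee : errs s2 <= d.
  by rewrite -E2; apply: leq_trans hd; rewrite (err_in_ext (s := s)) // lab2.
rewrite eval_Sq; have [R1 R2 _ R4] := repair_spec d hn2.
have nw r : r < 3 \/ 20 < r < 100 -> ~~ writes (repair d) r.
  by move=> hr; apply/negP => /repair_writes; lia.
have [V3 _ _] := frame_eval n g (repair d) s2.
have C3 := @eval_cost n g vLen (repair d) s2 bdr (nw vLen (or_introl isT)).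
move: (eval _ _ _ s2) R1 R2 R4 V3 C3 => s3 R1 R2 R4 V3 C3.
have S3 : vr s3 vS = x by rewrite V3 ?S2 // nw //; left.
have N3 : vr s3 vLen = vr s2 vLen by rewrite V3 // nw //; left.
have X3 : vr s3 vNext = x by rewrite V3 ?X2 // nw //; right.
have L3 : vr s3 vL = L by rewrite V3 ?L2 // nw //; right.
have hn3 : vr s3 vS + vr s3 vLen <= n by rewrite S3 N3 -S2.
have [g1 g2 g3] := R2 (R4 ee).
have e3 := good_errs hn3 g1 g2.
rewrite eval_Asg; split.
- rewrite -[LHS]/(minn (vr s3 vNext + minn (vr s3 vL + vr s3 vL) (cap n)) (cap n)).
  by rewrite X3 L3; lia.
- rewrite -[err_in _ _ _]/(err_in s3 x (L + L)) -S3 err_in_errs //.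
    by rewrite N3 N2; lia.
  by rewrite S3 N3 N2; lia.
- move=> u un hu; rewrite -[lab _ u]/(lab s3 u) R1 ?lab2 //.
  by rewrite /seg S2 N2; lia.
- rewrite -[ck _]/(10 + ck s3).
  have hp : (vr s2 vLen).+1 ^ depth (repair d) <= (L + L).+1 ^ 2.
    apply: (@leq_trans ((vr s2 vLen).+1 ^ 2)); first by rewrite leq_pexp2l.
    by rewrite leq_exp2r // N2; lia.
  have := leq_mul (leqnn (fcost (repair d))) hp; lia.
Qed.

Lemma block_writes d r : writes (block d) r ->
  [|| r == vS, r == vLen, r == vNext | writes (repair d) r].
Proof.
rewrite /block; move: (repair d) => p /=.
by case: (r == vS); case: (r == vLen); case: (r == vNext); rewrite ?orbT //= orbF.
Qed.

Lemma level_spec d s L : 7 < d -> vr s vN = n -> vr s vL = L -> 0 < L < n ->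
  (forall k, err_in s (k * L) L <= 4) ->
  let s' := eval n g (level d) s in
  (forall k, err_in s' (k * (L + L)) (L + L) <= 4) /\
  ck s' <= ck s + (300 + 50 * fcost (repair d)) * (n * L).
Proof.
move=> hd EN EL hL he.
set K := fcost (repair d); pose D := 50 + K * (L + L).+1 ^ 2.
rewrite /level eval_Sq eval_Asg; set s1 := tick _ _.
have N1 : vr s1 vN = n := EN.
have C1 : ck s1 = ck s + 2 by rewrite /=; lia.
(* [k] counts rounds and [k'] finished blocks; they part once the blocks cover all of 0..n-1 and the
   loop idles. *)
have [|k t hk [F _ _] _ [k' [I1 I2 I3 I4 [I5 I6]]]|t [[k' [I1 I2 I3 I4 [I5 I6]]] _ ->]] :=
  @for_ind n g (fun k t => exists k', [/\ vr t vNext = k' * (L + L),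
     k <= k' \/ n <= k' * (L + L),
     forall j, j < k' -> err_in t (j * (L + L)) (L + L) <= 4,
     forall j, k' * 2 <= j -> err_in t (j * L) L <= 4 &
     k' * (L + L) <= n + (L + L) /\ ck t <= ck s1 + 5 * k + k' * D])
  vK2 vN (If (Lt (V vNext) (V vN)) (block d) Nop) s1.
- exists 0; split=> //.
  + by left.
  + by move=> j _; apply: he.
  + by rewrite mul0n -[ck (setv _ _ _)]/(ck s1); lia.
- have nw r : r < 1 \/ r = vL -> ~~ writes (repair d) r.
    by move=> hr; apply/negP => /repair_writes; lia.
  have nwb r : r < 1 \/ r = vL -> ~~ writes (For vK2 vN (If (Lt (V vNext) (V vN)) (block d) Nop)) r.
    move=> hr; apply/negP => /orP [|/orP [/block_writes|//]]; first by lia.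
    by rewrite (negbTE (nw r hr)); lia.
  have Nt : vr t vN = n by rewrite F ?nwb //; left.
  have Lt' : vr t vL = L by rewrite F ?nwb //; right.
  rewrite eval_If -[evb _ _ _ _]/(vr t vNext < vr t vN) I1 Nt.
  case: ltnP => hx; last first.
    rewrite eval_Nop; exists k'; split=> //; first by right.
    by split=> //; rewrite -[ck _]/(2 + (3 + ck t)); lia.
  have [|B1 B2 B3 B4] := @block_spec d (tick 3 t) (k' * (L + L)) L hd Nt I1 hx Lt' hL.
    rewrite -[err_in _ _ _]/(err_in t (k' * (L + L)) (L + L)) err_inD.
    have h1 := I4 (k' * 2); have h2 := I4 (k' * 2).+1.
    have E1 : k' * 2 * L = k' * (L + L) by lia.
    have E2 : (k' * 2).+1 * L = k' * (L + L) + L by lia.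
    by rewrite E1 in h1; rewrite E2 in h2; lia.
  move: (eval _ _ _ (tick _ t)) B1 B2 B3 B4 => t' B1 B2 B3 B4.
  have ex x m : (forall u, x <= u < x + m ->
       ~~ (k' * (L + L) <= u < k' * (L + L) + (L + L))) ->
      err_in t' x m = err_in t x m.
    by move=> h; apply: err_in_ext => u hu un; rewrite B3 //; apply: h.
  exists k'.+1; split.
  + by rewrite -[LHS]/(vr t' vNext) B1; lia.
  + by left; case: I2; lia.
  + move=> j hj; rewrite -[err_in _ _ _]/(err_in t' (j * (L + L)) (L + L)).
    have [->|ne] := eqVneq j k'; first exact: B2.
    rewrite ex; first by apply: I3; lia.
    have : j.+1 * (L + L) <= k' * (L + L) by rewrite leq_mul2r; lia.
    by move=> h u hu; lia.
  + move=> j hj; rewrite -[err_in _ _ _]/(err_in t' (j * L) L).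
    rewrite ex; first by apply: I4; lia.
    have : k'.+1 * 2 * L <= j * L by rewrite leq_mul2r hj orbT.
    by move=> h u hu; lia.
  + split; first by lia.
    by rewrite -[ck _]/(2 + ck t'); rewrite -[ck (tick _ _)]/(3 + ck t) -/K in B4; rewrite /D; lia.
split.
  move=> k; rewrite -[err_in _ _ _]/(err_in t (k * (L + L)) (L + L)).
  case: (ltnP k k') => hk; first exact: I3.
  have hn : n <= k * (L + L).
    by case: I2 => [|h]; [rewrite N1 => h|]; nia.
  rewrite (_ : err_in _ _ _ = 0) //; apply/eqP; rewrite -leqn0 leqNgt -has_count.
  by apply/negP => /hasP [u]; rewrite mem_iota => hu /andP []; lia.
rewrite -[ck _]/(2 + ck t); rewrite N1 C1 in I6.
(* The finished blocks cover at most n + 2L < 3n positions, and each costs at most a multiple of 5L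
   per position: in total 15nL. *)
have hq : (L + L).+1 ^ 2 <= (L + L) * (5 * L) by rewrite expnS expn1; nia.
have h1 : k' * (L + L).+1 ^ 2 <= 15 * (n * L).
  apply: (@leq_trans (k' * (L + L) * (5 * L))).
    by rewrite -mulnA leq_mul2l hq orbT.
  apply: (@leq_trans ((n + (L + L)) * (5 * L))); first by rewrite leq_mul2r I5 orbT.
  by nia.
have h2 : k' <= 3 * (n * L) by nia.
have h3 : n <= n * L by rewrite leq_pmulr //; case/andP: hL.
have h4 : k' * D <= (150 + 15 * K) * (n * L).
  by rewrite /D; have := leq_mul (leqnn K) h1; lia.
by move: h4 h3 I6 hL; lia.
Qed.

Lemma level_free d r : r = vN \/ r = vL -> ~~ writes (level d) r.
Proof.
move=> hr; apply/negP => /orP [|/orP [|/orP [/block_writes|//]]].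
- by case: hr => ->.
- by case: hr => ->.
- by case/or4P => [|||/repair_writes]; case: hr => ->.
Qed.

Lemma doubling_spec d s : 7 < d -> vr s vN = n ->
  let s' := eval n g (doubling d) s in
  err_in s' 0 n <= 4 /\
  ck s' <= ck s + (1000 + 200 * fcost (repair d)) * n.+1 ^ 2.
Proof.
move=> hd EN; set K := fcost (repair d).
have n_cap : 3 * n <= cap n by rewrite /cap !expnS; nia.
rewrite /doubling eval_Sq eval_Asg; set s1 := tick _ _.
have N1 : vr s1 vN = n := EN.
have C1 : ck s1 = ck s + 2 by rewrite /=; lia.
(* The geometric sum is kept in closed form: a level at length L costs a multiple of nL, exactly the
   growth of that term when L doubles. Since L exceeds the number of rounds until it reaches [n],
   [vN] rounds suffice. The successor in [n.*2.+1] is for [n = 0], where L is still 1. *)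
have [|k t hk [F _ _] _ [I1 I2 I3 I4]|t [[I1 I2 I3 I4] _ ->]] :=
  @for_ind n g (fun k t => [/\ 0 < vr t vL <= n.*2.+1,
     k < vr t vL \/ n <= vr t vL,
     forall j, err_in t (j * vr t vL) (vr t vL) <= 4 &
     ck t <= ck s1 + 20 * k + (300 + 50 * K) * (n * vr t vL)])
  vK1 vN (If (Lt (V vL) (V vN)) (Sq (level d) (Asg vL (Plus (V vL) (V vL)))) Nop) s1.
- split=> //; [by left| |by rewrite /=; lia].
  by move=> j; apply: leq_trans (count_size _ _) _; rewrite size_iota.
- have nw r : r < 1 \/ r = vL -> ~~ writes (repair d) r.
    by move=> hr; apply/negP => /repair_writes; lia.
  have Nt : vr t vN = n.
    rewrite F //; apply/negP => /orP [//|/orP [/orP [h|//]|//]].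
    exact: (negP (@level_free d vN (or_introl erefl)) h).
  rewrite eval_If -[evb _ _ _ _]/(vr t vL < vr t vN) Nt.
  case: (ltnP (vr t vL) n) => hL; last first.
    rewrite eval_Nop; split; [exact: I1|by right|exact: I3|].
    by rewrite -[ck _]/(2 + (3 + ck t)) -[vr _ vL]/(vr t vL); lia.
  rewrite eval_Sq.
  have [||V1 V2] := @level_spec d (tick 3 t) (vr t vL) hd Nt erefl.
  + by lia.
  + exact: I3.
  have [W _ _] := frame_eval n g (level d) (tick 3 t).
  have EL : vr (eval n g (level d) (tick 3 t)) vL = vr t vL.
    by apply: W; apply: level_free; right.
  move: (eval _ _ _ (tick _ t)) V1 V2 EL {W} => t' V1 V2 EL.
  rewrite eval_Asg; set t2 := tick 2 _.
  have L2 : vr t2 vL = vr t vL + vr t vL.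
    by rewrite -[LHS]/(minn (vr t' vL + vr t' vL) (cap n)) EL; lia.
  rewrite L2; split.
  + by lia.
  + by left; case: I2; lia.
  + exact: V1.
  + rewrite -[ck t2]/(2 + (6 + ck t')).
    rewrite -[ck (tick _ _)]/(3 + ck t) -/K in V2; rewrite mulnDr mulnDr.
    by lia.
rewrite N1 in I2 I4; split.
  have := I3 0; rewrite mul0n -[err_in (tick _ _) _ _]/(err_in t 0 n).
  have hL : n <= vr t vL by case: I2; lia.
  by rewrite -{1}(subnKC hL) err_inD; lia.
rewrite -[ck _]/(2 + ck t).
have h1 : n * vr t vL <= 2 * n.+1 ^ 2 by rewrite expnS expn1; nia.
have h2 : n.+1 <= n.+1 ^ 2 by rewrite expnS expn1; nia.
have := leq_mul (leqnn (300 + 50 * K)) h1; rewrite C1 in I4.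
by nia.
Qed.

Lemma classify_spec d s : 7 < d -> vr s vN = n ->
  let s' := eval n g (classify d) s in
  [/\ vr s' vS = 0, vr s' vLen = n, vr s' vN = n, good s' &
      ck s' <= ck s + (1010 + 201 * fcost (repair d)) * n.+1 ^ 2].
Proof.
move=> hd EN; have [e1 c1] := doubling_spec hd EN; rewrite /classify eval_Sq.
have nw r : r < 3 -> ~~ writes (repair d) r.
  by move=> hr; apply/negP => /repair_writes; lia.
have [V1 _ _] := frame_eval n g (doubling d) s.
have N1 : vr (eval n g (doubling d) s) vN = n.
  rewrite V1 //; apply/negP => /orP [//|/orP [//|/orP [/orP [h|//]|//]]].
  exact: (negP (@level_free d vN (or_introl erefl)) h).
move: (eval _ _ _ s) e1 c1 N1 {V1} => s1 e1 c1 N1.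
rewrite eval_Sq eval_Asg eval_Sq eval_Asg; set s2 := tick _ (setv vLen _ _).
have S2 : vr s2 vS = 0 by [].
have L2 : vr s2 vLen = n := N1.
have M2 : vr s2 vN = n := N1.
have C2 : ck s2 = 4 + ck s1 by rewrite /=; lia.
have e2 : errs s2 <= d.
  rewrite -(@err_in_errs s2 n) ?S2 ?L2 //; last by left.
  by rewrite -[err_in s2 _ _]/(err_in s1 0 n); apply: leq_trans e1 _; lia.
clearbody s2.
have hn2 : vr s2 vS + vr s2 vLen <= n by rewrite S2 L2.
have [R1 R2 _ R4] := repair_spec d hn2.
have [W2 _ _] := frame_eval n g (repair d) s2.
have [wfr bdr dpr _ _] := repair_static d.
have C3 := @eval_cost n g vLen (repair d) s2 bdr (nw vLen isT).
move: (eval _ _ _ s2) R1 R2 R4 W2 C3 => s3 R1 R2 R4 W2 C3.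
split.
- by rewrite W2 ?nw.
- by rewrite W2 ?nw.
- by rewrite W2 ?nw.
- exact: R2 (R4 e2).
have hp : (vr s2 vLen).+1 ^ depth (repair d) <= n.+1 ^ 2.
  by rewrite L2 leq_pexp2l.
have h2 : 0 < n.+1 ^ 2 by rewrite expn_gt0.
have := leq_mul (leqnn (fcost (repair d))) hp; nia.
Qed.

(** * Listing the maximal independent sets *)

Section Listing.

(** [Acc L c o] relates the pairs treated so far to the counter and the output; counting and
    printing instantiate it differently. *)
Variables (act : prog) (Acc : seq (nat * nat) -> nat -> seq nat -> Prop).
Variables (l one : pred nat).

Definition base t := [/\ vr t vS = 0, vr t vLen = n, vr t vN = n, lab t =1 l
  & forall x, (0 < ar t aOne x) = one x].

Hypothesis act_writes : forall r, writes act r -> (r == vCnt) || (37 < r < 100).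
Hypothesis act_arrays : forall k, ~~ writes_array act k.
Hypothesis act_acc : forall L t, base t -> Acc L (vr t vCnt) (ot t) ->
  Acc (rcons L (vr t vA, vr t vB)) (vr (eval n g act t) vCnt) (ot (eval n g act t)).

Definition partners x k := [seq y <- iota 0 k | [&& y < x, ~~ l y & ~~ g x y]].

Definition row_list x :=
  if l x then [::] else
  [seq (x, y) | y <- partners x n] ++ (if one x then [:: (x, n)] else [::]).

Definition dominating := all (fun x => l x || has (fun v => l v && g x v) (iota 0 n))
  (iota 0 n).

Definition candidates :=
  flatten [seq row_list x | x <- iota 0 n] ++
  (if dominating then [:: (n, n)] else [::]).

Lemma act_free r : r < 34 \/ 34 < r < 38 -> ~~ writes act r.
Proof. by move=> hr; apply/negP => /act_writes; lia. Qed.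

Lemma base_ext t t' : (forall r, r < 3 -> vr t' r = vr t r) ->
  ar t' aLab = ar t aLab -> ar t' aOne = ar t aOne -> base t -> base t'.
Proof. by move=> E1 E2 E3 [b1 b2 b3 b4 b5]; rewrite /base /lab !E1 // E2 E3. Qed.

Lemma base_frame p t t' : frame p t t' -> (forall r, r < 3 -> ~~ writes p r) ->
  (forall k, ~~ writes_array p k) -> base t -> base t'.
Proof.
by case=> F1 F2 _ h1 h2; apply: base_ext => [r /h1||]; [apply: F1|rewrite F2..].
Qed.

Lemma act_on_spec L t x y : y != vA -> base t -> Acc L (vr t vCnt) (ot t) ->
  let t' := eval n g (act_on act x y) t in
  Acc (rcons L (vr t x, vr t y)) (vr t' vCnt) (ot t').
Proof.
move=> ya bt acc; rewrite /act_on eval_Sq eval_Asg eval_Sq eval_Asg.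
set t2 := tick _ (setv vB _ _).
have bt2 : base t2 by exact: bt.
have := act_acc bt2 acc.
have -> : vr t2 vB = vr t y by rewrite -[LHS]/(upd (vr t) vA (vr t x) y) upd_neq.
by rewrite -[vr t2 vA]/(vr t x).
Qed.

Lemma act_on_free x y r : r < 34 \/ r = vFl -> ~~ writes (act_on act x y) r.
Proof.
move=> hr; have := @act_free r; rewrite /=; case: (writes act r) => [h|_].
  by have : false by apply: h; lia.
by lia.
Qed.

Lemma row_free r : r < 11 \/ r = vU \/ r = vFl -> ~~ writes (row act) r.
Proof.
move=> hr; have h := @act_free r; have {}h : writes act r = false.
  by apply/negbTE/h; lia.
by rewrite /= h; lia.
Qed.

Lemma row_arrays k : ~~ writes_array (row act) k.
Proof. by rewrite /= (negbTE (act_arrays k)). Qed.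

Lemma row_spec L t : base t -> Acc L (vr t vCnt) (ot t) ->
  let t' := eval n g (row act) t in
  vr t vU < n -> Acc (L ++ row_list (vr t vU)) (vr t' vCnt) (ot t').
Proof.
move=> bt acc t' un; rewrite {}/t' /row eval_If; set x := vr t vU.
have [b1 b2 b3 b4 b5] := bt.
have -> : evb n g t (inO vU) = ~~ l x by rewrite !evE -b4.
rewrite /row_list; case lx: (l x); first by rewrite eval_Nop cats0.
rewrite eval_Sq; set t0 := tick _ t.
set body := If (And _ _) _ _.
have bw r : r < 34 \/ r = vFl -> ~~ writes body r.
  by move=> hr; rewrite /= orbF; exact: (@act_on_free vU vW r hr).
have ba k : ~~ writes_array body k by rewrite /= orbF; exact: act_arrays.
have [|||k t1 hk F I1|t1 [I1 F ->]] := @scan_ind n g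
  (fun k t1 => Acc (L ++ [seq (x, y) | y <- partners x k]) (vr t1 vCnt) (ot t1))
  vJ vW body t0 isT.
- by rewrite !bw //; left.
- by rewrite -[vr t0 vS]/(vr t vS) -[vr t0 vLen]/(vr t vLen) b1 b2.
- by rewrite cats0; exact: acc.
- have -> : vr t0 vS = 0 := b1; rewrite add0n; set t2 := tick 6 _.
  rewrite -[vr t0 vLen]/(vr t vLen) b2 in hk.
  have sw r : r < 34 -> r != vJ -> r != vW -> ~~ writes (scan vJ vW body) r.
    move=> h1 /negbTE h2 /negbTE h3; apply/negP => /orP [|/orP []].
    + by rewrite h2.
    + by rewrite /= h3.
    + by apply/negP/bw; left.
  have bt1 : base t1.
    apply: base_frame F _ _ bt => [r hr|k']; first by apply: sw; lia.
    by rewrite /= orbF; exact: act_arrays.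
  have U2 : vr t2 vU = x by case: F => F _ _; exact: (F vU (sw vU isT isT isT)).
  have bt2 : base t2 := bt1.
  have [_ _ _ l2 _] := bt2.
  have Ev : evb n g t2 (And (Lt (V vW) (V vU)) (And (inO vW) (nadj (V vU) (V vW)))) =
      [&& k < x, ~~ l k & ~~ g x k].
    by rewrite !evE -l2 -U2.
  have pS : partners x k.+1 = partners x k ++
      (if [&& k < x, ~~ l k & ~~ g x k] then [:: k] else [::]).
    have -> : partners x k.+1 = [seq y <- iota 0 k ++ [:: k] |
       [&& y < x, ~~ l y & ~~ g x y]] by rewrite -[[:: k]]/(iota (0 + k) 1) -iotaD addn1.
    by rewrite filter_cat.
  rewrite /body eval_If Ev pS map_cat catA; case: ifP => hc.
    have := @act_on_spec (L ++ [seq (x, y) | y <- partners x k])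
      (tick (bcost (And (Lt (V vW) (V vU)) (And (inO vW) (nadj (V vU) (V vW))))) t2)
      vU vW isT bt2 I1.
    rewrite -[vr (tick _ _) vU]/(vr t2 vU) U2 -[vr (tick _ _) vW]/k.
    by move: (eval _ _ _ _) => t3; rewrite -cats1.
  by rewrite eval_Nop cats0.
rewrite -[vr t0 vLen]/(vr t vLen) b2 in I1.
have sw r : r < 34 -> r != vJ -> r != vW -> ~~ writes (scan vJ vW body) r.
  move=> h1 /negbTE h2 /negbTE h3; apply/negP => /orP [|/orP []].
  + by rewrite h2.
  + by rewrite /= h3.
  + by apply/negP/bw; left.
have bt1 : base t1.
  apply: base_frame F _ _ bt => [r hr|k']; first by apply: sw; lia.
  by rewrite /= orbF; exact: act_arrays.
have U1 : vr t1 vU = x by case: F => F _ _; exact: (F vU (sw vU isT isT isT)).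
have [c1 c2 c3 c4 c5] := bt1.
rewrite eval_If evE -[ev _ _ _ _]/(ar t1 aOne (vr t1 vU)) U1 c5 catA.
case: ifP => _; last by rewrite eval_Nop cats0.
have := @act_on_spec (L ++ [seq (x, y) | y <- partners x n])
   (tick (bcost (Pos (Arr aOne (V vU)))) (tick 2 t1)) vU vN isT bt1 I1.
rewrite -[vr (tick _ _) vU]/(vr t1 vU) U1 -[vr (tick _ _) vN]/(vr t1 vN) c3.
by move: (eval _ _ _ _) => t3; rewrite cats1.
Qed.

Lemma lonely_spec t : base t ->
  let t' := eval n g lonely t in (0 < vr t' vFl) = dominating.
Proof.
move=> bt; rewrite /lonely eval_Sq eval_Asg; set t0 := tick _ _.
have [b1 b2 b3 b4 b5] := bt; set body := If _ _ _.
have [||k t1 hk F I1|t1 [I1 F ->]] := @scan_ind n g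
  (fun k t1 => (0 < vr t1 vFl) =
     all (fun x => l x || has (fun v => l v && g x v) (iota 0 n)) (iota 0 k))
  vI vU body t0 isT isT.
- by rewrite -[vr t0 vS]/(vr t vS) -[vr t0 vLen]/(vr t vLen) b1 b2.
- by [].
- have -> : vr t0 vS = 0 := b1; rewrite add0n; set t2 := tick 6 _.
  have [F1 F2 _] := F.
  have l2 : lab t2 =1 l by move=> v; rewrite /lab -[ar t2 _]/(ar t1 aLab) F2 //; exact: b4.
  have S2 : vr t2 vS = 0 := etrans (F1 vS isT) b1.
  have N2 : vr t2 vLen = n := etrans (F1 vLen isT) b2.
  have hn2 : vr t2 vS + vr t2 vLen <= n by rewrite S2 N2.
  have sg2 v : seg t2 v = (v \in iota 0 n) by rewrite /seg S2 N2 mem_iota.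
  rewrite -[k.+1]addn1 iotaD all_cat /= andbT -I1 /body eval_If.
  have -> : evb n g t2 (inO vU) = ~~ l k by rewrite !evE -l2.
  case lk: (l k); first by rewrite eval_Nop andbT.
  rewrite eval_Sq; set t3 := tick _ t2.
  have [|F4 L4] := @locateP vV0 vJ vW (And (inI vW) (yadj (V vU) (V vW)))
    (fun v => l v && g k v) t3 isT isT isT hn2.
    by move=> v; rewrite !evE -l2.
  have fl4 := (let: And3 G _ _ := F4 in G vFl isT).
  move: (eval _ _ _ t3) L4 fl4 {F4} => t4 L4 fl4.
  have {}L4 : (vr t4 vV0 = 0 /\ forall u, u \in iota 0 n -> ~~ (l u && g k u)) \/
      exists u, [/\ u \in iota 0 n, vr t4 vV0 = u.+1 & l u && g k u].
    case: L4 => [[E h]|[u [su E h]]]; [left|right].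
      by split=> // u; rewrite -sg2; apply: h.
    by exists u; split=> //; rewrite -sg2.
  rewrite eval_If evE -[ev _ _ _ _]/(vr t4 vV0).
  case: L4 => [[-> h]|[u [su -> h]]].
    rewrite eval_Asg /= (negbTE (introN hasP _)) ?andbF //.
    by case=> u /h /negbTE ->.
  rewrite eval_Nop -[X in (0 < X) = _]/(vr t4 vFl) fl4 -[vr t3 vFl]/(vr t1 vFl) /=.
  by rewrite (introT hasP _) ?andbT //; exists u.
by rewrite -[vr _ vFl]/(vr t1 vFl) I1 -[vr t0 vLen]/(vr t vLen) b2.
Qed.

Lemma listing_spec t : base t -> Acc [::] (vr t vCnt) (ot t) ->
  let t' := eval n g (listing act) t in
  Acc candidates (vr t' vCnt) (ot t').
Proof.
move=> bt acc; rewrite /listing eval_Sq.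
have [b1 b2 b3 b4 b5] := bt.
have sw r : r < 10 -> ~~ writes (scan vI vU (row act)) r.
  move=> hr; apply/negP => /orP [|/orP []]; first by lia.
    by rewrite /=; lia.
  by apply/negP/row_free; lia.
have sa k : ~~ writes_array (scan vI vU (row act)) k := row_arrays k.
have [|||k t1 hk F I1|t1 [I1 F ->]] := @scan_ind n g
  (fun k t1 => Acc (flatten [seq row_list x | x <- iota 0 k]) (vr t1 vCnt) (ot t1))
  vI vU (row act) t isT.
- by rewrite !row_free //; left.
- by rewrite b1 b2.
- exact: acc.
- have bt1 : base t1 by apply: base_frame F _ sa bt => r hr; apply: sw; lia.
  rewrite b1 add0n; set t2 := tick 6 _; rewrite b2 in hk.
  have bt2 : base t2 := bt1.
  have := row_spec bt2 I1 hk; rewrite -[vr t2 vU]/k.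
  move: (eval _ _ _ t2) => t3.
  by rewrite -[k.+1]addn1 iotaD map_cat flatten_cat /= cats0.
rewrite b2 in I1.
have bt1 : base t1 by apply: base_frame F _ sa bt => r hr; apply: sw; lia.
rewrite eval_Sq; set t2 := tick 2 t1; have bt2 : base t2 := bt1.
have E2 := lonely_spec bt2; have F2 := frame_eval n g lonely t2.
move: (eval _ _ _ t2) E2 F2 => t3 E3 F3.
have bt3 : base t3.
  apply: base_frame F3 _ _ bt2 => [r|k]; last by [].
  by rewrite writes_written => hr; apply/negP; rewrite !inE; lia.
have [G1 _ G3] := F3.
have acc3 : Acc (flatten [seq row_list x | x <- iota 0 n]) (vr t3 vCnt) (ot t3).
  by rewrite G1 // G3.
rewrite eval_If evE -[ev _ _ _ _]/(vr t3 vFl) E3 /candidates.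
case: ifP => _; last by rewrite eval_Nop cats0.
have := @act_on_spec _ (tick (bcost (Pos (V vFl))) t3) vN vN isT bt3 acc3.
have [_ _ -> _ _] : base (tick (bcost (Pos (V vFl))) t3) := bt3.
by move: (eval _ _ _ _) => t4; rewrite cats1.
Qed.

End Listing.

(** * Candidate pairs and maximal independent sets *)

Section MaximalSets.

Variables (e : rel 'I_n) (l one : pred nat).
Hypothesis e_g : forall i j : 'I_n, e i j = g i j.
Hypothesis EF : forall u v, u < n -> v < n -> l u -> l v -> ~~ g u v.
Hypothesis TF : forall u v w, u < n -> v < n -> w < n ->
  ~~ l u -> ~~ l v -> ~~ l w -> coadj u v -> coadj v w -> coadj u w -> False.
Hypothesis SG : forall u, u < n -> ~~ l u -> one u <->
  (forall y, y < n -> ~~ l y -> coadj u y ->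
     exists v, [/\ v < n, l v, g y v & ~~ g u v]).

Let g_out u : g u n = false.
Proof. by apply/negP => /g_lt; rewrite ltnn andbF. Qed.

(** When [x] or [y] is the placeholder [n], its equation fails for all vertices and its
    non-adjacency is automatic, so one formula covers two, one or no outside vertices. *)
Definition member x y v := [|| v == x, v == y | [&& l v, ~~ g v x & ~~ g v y]].

Definition set_of (p : nat * nat) : {set 'I_n} := [set v : 'I_n | member p.1 p.2 v].

Definition pair_ok x y := [&& y < x, x < n, ~~ l x, ~~ l y & ~~ g x y].
Definition single_ok x y := [&& x < n, ~~ l x, one x & y == n].
Definition none_ok x y := [&& x == n, y == n & dominating l].

Lemma mem_candidates x y :
  ((x, y) \in candidates l one) = [|| pair_ok x y, single_ok x y | none_ok x y].
Proof.
rewrite mem_cat orbA; congr (_ || _); last first.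
  by rewrite /none_ok; case: dominating; rewrite ?inE ?andbT ?andbF // xpair_eqE.
apply/flatten_mapP/idP => [[z]|h].
  rewrite mem_iota0 /row_list => hz; case lz: (l z) => //.
  rewrite mem_cat => /orP [/mapP [w]|].
    rewrite mem_filter mem_iota0 => /andP [/and3P [h1 h2 h3] h4] [-> ->].
    by rewrite /pair_ok h1 h2 h3 lz hz.
  case oz: (one z) => //; rewrite inE => /eqP [-> ->].
  by rewrite /single_ok lz oz eqxx hz orbT.
case/orP: h => [/and5P [h1 h2 h3 h4 h5]|/and4P [h1 h2 h3 /eqP ->]];
  exists x; rewrite ?mem_iota0 // /row_list; [rewrite (negbTE h3)|rewrite (negbTE h2)];
  rewrite mem_cat.
  by rewrite map_f // mem_filter h1 h4 h5 mem_iota0; lia.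
by rewrite h3 inE eqxx orbT.
Qed.

Lemma uniq_candidates : uniq (candidates l one).
Proof.
rewrite cat_uniq; apply/and3P; split; last by case: dominating.
  have : uniq (iota 0 n) := iota_uniq 0 n.
  elim: (iota 0 n) => //= x r IH /andP [xr ur]; rewrite cat_uniq IH // andbT.
  have fst_row z p : p \in row_list l one z -> p.1 = z.
    rewrite /row_list; case: (l z) => //; rewrite mem_cat => /orP [/mapP [w _ -> //]|].
    by case: (one z) => //; rewrite inE => /eqP ->.
  apply/andP; split.
    rewrite /row_list; case: (l x) => //; rewrite cat_uniq map_inj_uniq; last by move=> ? ? [].
    rewrite filter_uniq ?iota_uniq //=; apply/andP; split; last by case: (one x).
    apply/hasPn => p; case: (one x) => //; rewrite inE => /eqP ->.
    by apply/negP => /mapP [w]; rewrite mem_filter mem_iota0 => /andP [_ hw] []; lia.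
  apply/hasPn => p /flatten_mapP [z zr /fst_row pz]; apply/negP => /fst_row px.
  by rewrite -px pz zr in xr.
apply/hasPn => p; case: dominating => //; rewrite inE => /eqP ->.
apply/negP => /flatten_mapP [z]; rewrite mem_iota0 /row_list => hz.
case: (l z) => //; rewrite mem_cat => /orP [/mapP [w _ []]|]; first by lia.
by case: (one z) => //; rewrite inE => /eqP []; lia.
Qed.

(** The pair can be read off from the vertices outside [I] in its set: the larger one first, with
    [n] for a missing one. *)
Lemma set_of_inj : {in candidates l one &, injective set_of}.
Proof.
move=> [x y] [x' y'] hp hq /setP E.
have {}E v : v < n -> ~~ l v -> (v == x) || (v == y) = (v == x') || (v == y').
  move=> vn lv; have := E (Ordinal vn).
  by rewrite !inE /member /= (negbTE lv) !orbF.
have ex : x < n -> ~~ l x -> (x == x') || (x == y').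
  by move=> h1 h2; rewrite -E ?eqxx.
have ey : y < n -> ~~ l y -> (y == x') || (y == y').
  by move=> h1 h2; rewrite -E ?eqxx ?orbT.
have ex' : x' < n -> ~~ l x' -> (x' == x) || (x' == y).
  by move=> h1 h2; rewrite E ?eqxx.
have ey' : y' < n -> ~~ l y' -> (y' == x) || (y' == y).
  by move=> h1 h2; rewrite E ?eqxx ?orbT.
have typ u v : (u, v) \in candidates l one ->
  [\/ [/\ v < u, u < n, ~~ l u & ~~ l v], [/\ u < n, v = n & ~~ l u] | u = n /\ v = n].
  rewrite mem_candidates => /or3P [/and5P [h1 h2 h3 h4 h5]|/and4P [h1 h2 h3 /eqP h4]|].
  - by apply: Or31.
  - by apply: Or32.
  - by case/and3P=> /eqP -> /eqP -> _; apply: Or33.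
suff [-> ->] : x = x' /\ y = y' by [].
by case: (typ _ _ hp) => [[p1 p2 p3 p4]|[p1 p2 p3]|[p1 p2]];
   case: (typ _ _ hq) => [[q1 q2 q3 q4]|[q1 q2 q3]|[q1 q2]];
   rewrite ?p3 ?p4 ?q3 ?q4 in ex ey ex' ey'; lia.
Qed.

Lemma maximal_independentP (U : {set 'I_n}) : maximal_independent e U <->
  (forall u v : 'I_n, u \in U -> v \in U -> ~~ g u v) /\
  (forall v : 'I_n, v \notin U -> exists2 u : 'I_n, u \in U & g v u).
Proof.
have indP (W : {set 'I_n}) : independent e W <->
    (forall u v : 'I_n, u \in W -> v \in W -> ~~ g u v).
  split=> [/forall_inP h u v uW vW|h].
    by have /forall_inP /(_ v vW) := h u uW; rewrite e_g.
  by apply/forall_inP => u uW; apply/forall_inP => v vW; rewrite e_g h.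
split=> [/maxsetP [/indP ind mx]|[ind dom]].
  split=> // v vU; have [/exists_inP //|/exists_inPn no] :=
    boolP [exists u in U, g v u].
  have : v |: U = U.
    apply: mx (subsetUr _ _); apply/indP => u w; rewrite !in_setU1.
    case/orP=> [/eqP ->|uU] /orP [/eqP ->|wU].
    - by rewrite g_irr.
    - exact: no.
    - by rewrite g_sym; apply: no.
    - exact: ind.
  by move=> E; rewrite -E setU11 in vU.
apply/maxsetP; split; first exact/indP.
move=> W /indP indW sUW; apply/eqP; rewrite eqEsubset sUW andbT.
apply/subsetP => v vW; apply/negPn/negP => /dom [u uU].
by apply/negP; apply: indW => //; apply: (subsetP sUW).
Qed.

Lemma coadjE u v : u != v -> coadj u v = ~~ g u v.
Proof. by rewrite /coadj => ->. Qed.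

(** An outside vertex adjacent to neither [x] nor [y] would complete an independent triple when both
    are present; it is blocked by the flag's meaning when only [x] is, and by domination when
    neither is. *)
Lemma set_of_maximal p : p \in candidates l one -> maximal_independent e (set_of p).
Proof.
case: p => x y; rewrite mem_candidates => hp; apply/maximal_independentP.
have xy : ~~ g x y.
  case/or3P: hp => [/and5P [_ _ _ _ ->] //|/and4P [_ _ _ /eqP ->]|/and3P [_ /eqP -> _]];
  by rewrite g_out.
split=> [u v|v].
  rewrite !inE /= => /or3P [/eqP ->|/eqP ->|/and3P [lu ux uy]] /or3P
     [/eqP ->|/eqP ->|/and3P [lv vx vy]]; rewrite ?g_irr //.
  - by rewrite g_sym.
  - by rewrite g_sym.
  - by rewrite g_sym.
  - exact: EF.
rewrite !inE /= !negb_or => /and3P [nx ny].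
have inx : x < n -> g v x -> exists2 u : 'I_n, u \in set_of (x, y) & g v u.
  by move=> h vx; exists (Ordinal h); rewrite // inE /member eqxx.
have iny : y < n -> g v y -> exists2 u : 'I_n, u \in set_of (x, y) & g v u.
  by move=> h vy; exists (Ordinal h); rewrite // inE /member eqxx orbT.
have inxy : g v x || g v y -> exists2 u : 'I_n, u \in set_of (x, y) & g v u.
  by case/orP=> h; have /andP [_ h'] := g_lt h; auto.
case lv: (l v); first by rewrite /= negb_and !negbK => /inxy.
move=> _.
case: (boolP (g v x || g v y)) => [/inxy //|]; rewrite negb_or => /andP [vx vy].
have vn := ltn_ord v; have nlv : ~~ l v by rewrite lv.
case/or3P: hp => [/and5P [h1 h2 h3 h4 h5]|/and4P [h1 h2 h3 /eqP h4]|/and3P [/eqP h1 /eqP h2 h3]].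
- exfalso; apply: (TF (u := v) (v := x) (w := y)) => //; try lia.
  + by rewrite coadjE.
  + by rewrite coadjE //; lia.
  + by rewrite coadjE.
- have cx : coadj x v by rewrite coadj_sym coadjE.
  have [w [wn lw vw xw]] := (SG h1 h2).1 h3 v vn nlv cx.
  exists (Ordinal wn) => //; rewrite inE /member /= lw h4 g_out (g_sym w) xw.
  by rewrite !orbT.
- move/allP: h3 => /(_ v); rewrite mem_iota0 vn lv => /(_ isT) /hasP [w].
  rewrite mem_iota0 => wn /andP [lw vw]; exists (Ordinal wn) => //.
  by rewrite inE /member /= lw h1 h2 !g_out !orbT.
Qed.

(** A maximal set is determined by its outside vertices, of which [TF] allows at most two; each
    possible number of them corresponds to one kind of candidate. *)
Lemma maximal_set_of U : maximal_independent e U ->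
  exists2 p, p \in candidates l one & U = set_of p.
Proof.
move/maximal_independentP => [ind dom].
pose q v := ~~ l v && [exists u : 'I_n, (u \in U) && (val u == v)].
have qP (u : 'I_n) : q u = ~~ l u && (u \in U).
  rewrite /q; congr (_ && _); apply/existsP/idP => [[w /andP [wU /eqP/val_inj <-]] //|uU].
  by exists u; rewrite uU eqxx.
have qn v : q v -> exists2 u : 'I_n, u \in U & v = u.
  by case/andP=> _ /existsP [u /andP [uU /eqP <-]]; exists u.
have mem_r v : (v \in [seq v <- iota 0 n | q v]) = q v.
  rewrite mem_filter mem_iota0 andbC; case qv: (q v); rewrite ?andbF // andbT.
  by have [u _ ->] := qn v qv; rewrite ltn_ord.
(* If [v] were missing, maximality would give it a neighbour in [U], which by [EF] lies outside [I]
   and is thus excluded. *)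
have closed (v : 'I_n) : l v -> (forall x, q x -> ~~ g v x) -> v \in U.
  move=> lv h; apply/negPn/negP => /dom [u uU vu].
  have [lu|lu] := boolP (l u); first by move: vu; rewrite (negbTE (EF _ _ lv lu)) ?ltn_ord.
  by have := h u; rewrite qP lu uU vu => /(_ isT).
(* The increasing order gives [y < x], as [pair_ok] demands. *)
have srt : sorted ltn [seq v <- iota 0 n | q v].
  by apply: sorted_filter; [exact: ltn_trans|exact: iota_ltn_sorted].
case Er: [seq v <- iota 0 n | q v] mem_r srt => [|y [|x [|z r]]] mem_r srt.
- have nq v : q v = false by rewrite -mem_r.
  have UL (u : 'I_n) : (u \in U) = l u.
    apply/idP/idP => [uU|lu]; last by apply: closed => // x; rewrite nq.
    by have := nq u; rewrite qP uU andbT => /negbFE.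
  exists (n, n).
    rewrite mem_candidates /none_ok eqxx /=; apply/orP; right; apply/orP; right.
    apply/allP => x; rewrite mem_iota0 => xn; case lx: (l x) => //=.
    have [u uU xu] : exists2 u : 'I_n, u \in U & g (Ordinal xn) u.
      by apply: dom; rewrite UL /= lx.
    by apply/hasP; exists (val u); rewrite ?mem_iota0 ?ltn_ord // -UL uU.
  apply/setP => u; rewrite inE /member /= UL !g_out !andbT.
  by have -> : (u == n :> nat) = false by have := ltn_ord u; lia.
- have qE v : q v = (v == y) by rewrite -mem_r inE.
  have [u0 u0U Ey] := qn y (etrans (qE y) (eqxx y)); have yn : y < n by rewrite Ey.
  have ly : ~~ l y by have := qP u0; rewrite -Ey qE eqxx => /esym/andP [].
  have UE (u : 'I_n) : (u \in U) = (u == y :> nat) || (l u && ~~ g u y).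
    apply/idP/orP => [uU|[/eqP uy|/andP [lu uy]]].
    - have [lu|lu] := boolP (l u); last by left; rewrite -qE qP lu uU.
      by right; rewrite Ey ind.
    - by have := qE u; rewrite qP uy eqxx => /andP [].
    - by apply: closed => // x; rewrite qE => /eqP ->.
  exists (y, n).
    rewrite mem_candidates /single_ok yn ly eqxx andbT /=; apply/orP; right; apply/orP; left.
    apply/(SG yn ly) => z zn lz yz.
    have [u uU zu] : exists2 u : 'I_n, u \in U & g (Ordinal zn) u.
      apply: dom; apply/negP => zU; have := qE z; rewrite (qP (Ordinal zn)) /= lz zU.
      by case/andP: yz => ne _; rewrite eq_sym (negbTE ne).
    exists (val u); split; [exact: ltn_ord| |exact: zu|by rewrite Ey ind].
    apply/negPn/negP => lu; have := qE u; rewrite qP lu uU => /esym/eqP E.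
    by case/andP: yz => _; rewrite g_sym -E zu.
  apply/setP => u; rewrite UE inE /member /= g_out andbT.
  by have -> : (u == n :> nat) = false by have := ltn_ord u; lia.
- have qE v : q v = (v == y) || (v == x) by rewrite -mem_r !inE.
  have yx : y < x by case/andP: srt.
  have [u0 u0U Ey] := qn y (etrans (qE y) (introT orP (or_introl (eqxx y)))).
  have [u1 u1U Ex] := qn x (etrans (qE x) (introT orP (or_intror (eqxx x)))).
  have yn : y < n by rewrite Ey.
  have xn : x < n by rewrite Ex.
  have ly : ~~ l y by have := qP u0; rewrite -Ey qE eqxx => /esym/andP [].
  have lx : ~~ l x by have := qP u1; rewrite -Ex qE eqxx orbT => /esym/andP [].
  exists (x, y).
    by rewrite mem_candidates /pair_ok yx xn lx ly Ex Ey ind.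
  apply/setP => u; rewrite inE /member /=; apply/idP/or3P => [uU|].
    have [lu|lu] := boolP (l u); last first.
      by have := qE u; rewrite qP lu uU => /esym/orP [h|h]; [apply: Or32|apply: Or31].
    by apply: Or33; rewrite Ex Ey !ind.
  case=> [/eqP ux|/eqP uy|/and3P [lu ux uy]].
  + by have := qE u; rewrite qP ux eqxx orbT => /andP [].
  + by have := qE u; rewrite qP uy eqxx => /andP [].
  + by apply: closed => // w; rewrite qE => /orP [/eqP ->|/eqP ->].
- exfalso; move: srt => /and3P [/= h1 h2 _].
  have hq v : v \in [:: y, x, z & r] -> exists2 u : 'I_n, u \in U & v = u /\ ~~ l v.
    rewrite mem_r => qv; have [u uU E] := qn v qv; exists u => //; split=> //.
    by case/andP: qv.
  have [|u0 u0U [E0 l0]] := hq y; first by rewrite inE eqxx.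
  have [|u1 u1U [E1 l1]] := hq x; first by rewrite !inE eqxx orbT.
  have [|u2 u2U [E2 l2]] := hq z; first by rewrite !inE eqxx !orbT.
  apply: (TF (u := y) (v := x) (w := z)) => //; rewrite ?E0 ?E1 ?E2 ?ltn_ord //;
    by rewrite coadjE ?ind // -?E0 -?E1 -?E2; lia.
Qed.

Lemma maximal_sets : let L := [seq set_of p | p <- candidates l one] in
  uniq L /\ forall U, (U \in L) = maximal_independent e U.
Proof.
split; first by rewrite map_inj_in_uniq; [exact: uniq_candidates|exact: set_of_inj].
move=> U; apply/mapP/idP => [[p pc ->]|]; first exact: set_of_maximal.
exact: maximal_set_of.
Qed.

Lemma size_candidates : size (candidates l one) <= cap n.
Proof.
pose box := [seq (x, y) | x <- iota 0 n.+1, y <- iota 0 n.+1].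
have sub : {subset candidates l one <= box}.
  move=> [x y]; rewrite mem_candidates => h; apply/allpairsP; exists (x, y).
  rewrite !mem_iota0 /=; case/or3P: h => [/and5P [h1 h2 _ _ _]|/and4P [h1 _ _ /eqP ->]|
    /and3P [/eqP -> /eqP -> _]]; split=> //; lia.
apply: leq_trans (uniq_leq_size uniq_candidates sub) _.
by rewrite size_allpairs !size_iota /cap !expnS; nia.
Qed.

End MaximalSets.

(** The truncation is carried along, because the length is bounded only for the complete list, by
    [size_candidates]. *)
Definition counted (L : seq (nat * nat)) c (o : seq nat) :=
  c = minn (size L) (cap n) /\ o = [::].

Lemma act_count_spec l one L t : base l one t -> counted L (vr t vCnt) (ot t) ->
  counted (rcons L (vr t vA, vr t vB))
    (vr (eval n g act_count t) vCnt) (ot (eval n g act_count t)).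
Proof.
move=> _ [E1 E2]; rewrite /act_count eval_Asg; split=> //.
rewrite -[LHS]/(minn (vr t vCnt + 1) (cap n)) E1 size_rcons; lia.
Qed.

Definition code (l : pred nat) (p : nat * nat) :=
  let m := [seq v <- iota 0 n | member l p.1 p.2 v] in size m :: m.

Definition emitted l (L : seq (nat * nat)) (c : nat) o :=
  o = flatten [seq code l p | p <- L].

Lemma is_memberE l t : lab t =1 l ->
  evb n g t is_member = member l (vr t vA) (vr t vB) (vr t vX).
Proof.
move=> lt; rewrite !evE /member -lt.
by rewrite -!negb_or orbA -orbA negbK.
Qed.

Lemma act_emit_spec l one L t : base l one t ->
  emitted l L (vr t vCnt) (ot t) ->
  emitted l (rcons L (vr t vA, vr t vB))
    (vr (eval n g act_emit t) vCnt) (ot (eval n g act_emit t)).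
Proof.
move=> [b1 b2 b3 b4 b5] acc; set x := vr t vA; set y := vr t vB.
pose m k := [seq v <- iota 0 k | member l x y v].
have mS k : m k.+1 = m k ++ (if member l x y k then [:: k] else [::]).
  have -> : m k.+1 = [seq v <- iota 0 k ++ [:: k] | member l x y v].
    by rewrite -[[:: k]]/(iota (0 + k) 1) -iotaD addn1.
  by rewrite filter_cat.
rewrite /act_emit eval_Sq eval_Asg; set t0 := tick _ _; rewrite eval_Sq.
have hn0 : vr t0 vS + vr t0 vLen <= n.
  by rewrite -[vr t0 vS]/(vr t vS) -[vr t0 vLen]/(vr t vLen) b1 b2.
have [|k t1 hk [F1 F2 _] I1|t1 [I1 [F1 F2 F3] ->]] := @scan_ind n g
  (fun k t1 => vr t1 vCnt = size (m k)) vE vX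
  (If is_member (Asg vCnt (Plus (V vCnt) (N 1))) Nop) t0 isT isT hn0.
- by [].
- have -> : vr t0 vS = 0 := b1; rewrite add0n; set t2 := tick 6 _.
  have l2 : lab t2 =1 l by move=> v; rewrite /lab -[ar t2 _]/(ar t1 aLab) F2 //; exact: b4.
  have A2 : vr t2 vA = x := F1 vA isT.
  have B2 : vr t2 vB = y := F1 vB isT.
  rewrite eval_If (is_memberE l2) A2 B2 -[vr t2 vX]/k mS; case: ifP => _; last first.
    by rewrite eval_Nop cats0.
  rewrite eval_Asg size_cat -I1 -[LHS]/(minn (vr t1 vCnt + 1) (cap n)).
  have : size (m k) <= k by rewrite -[X in _ <= X](size_iota 0) size_filter count_size.
  rewrite -I1 -[vr t0 vLen]/(vr t vLen) b2 in hk * => h.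
  by rewrite cap_gt //; lia.
rewrite -[vr t0 vLen]/(vr t vLen) b2 in I1.
rewrite eval_Sq -[eval n g (Out _) _]/(tick 2 (emit (vr t1 vCnt) (tick 2 t1))) I1.
set t3 := tick 2 (emit _ _).
have ot3 : ot t3 = flatten [seq code l p | p <- L] ++ [:: size (m n)].
  by rewrite -[LHS]/(rcons (ot t1) _) F3 // -cats1; congr (_ ++ _).
have S3 : vr t3 vS = 0 := etrans (F1 vS isT) b1.
have N3 : vr t3 vLen = n := etrans (F1 vLen isT) b2.
have A3 : vr t3 vA = x := F1 vA isT.
have B3 : vr t3 vB = y := F1 vB isT.
have l3 : lab t3 =1 l by move=> v; rewrite /lab -[ar t3 _]/(ar t1 aLab) F2 //; exact: b4.
have hn3 : vr t3 vS + vr t3 vLen <= n by rewrite S3 N3.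
have [|k t4 hk [G1 G2 _] I4|t4 [I4 _ ->]] := @scan_ind n g
  (fun k t4 => ot t4 = ot t3 ++ m k) vE vX (If is_member (Out (V vX)) Nop)
  t3 isT isT hn3.
- by rewrite cats0.
- rewrite S3 add0n; set t5 := tick 6 _.
  have l5 : lab t5 =1 l by move=> v; rewrite /lab -[ar t5 _]/(ar t4 aLab) G2 //; exact: l3.
  have A5 : vr t5 vA = x := etrans (G1 vA isT) A3.
  have B5 : vr t5 vB = y := etrans (G1 vB isT) B3.
  rewrite eval_If (is_memberE l5) A5 B5 -[vr t5 vX]/k mS catA -I4.
  case: ifP => _; last by rewrite eval_Nop cats0.
  by rewrite -[LHS]/(rcons (ot t4) k) cats1.
rewrite N3 in I4; rewrite /emitted -[ot (tick 2 t4)]/(ot t4) I4 ot3.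
by rewrite -cats1 map_cat flatten_cat -catA /= cats0.
Qed.

Lemma classify_frame d r : r = vCnt -> ~~ writes (classify d) r.
Proof.
move=> ->; apply/negP => /orP [/orP [//|/orP [//|/orP [/orP [h|//]|//]]]|/orP [//|/orP [//|]]].
  case/orP: h => [//|/orP [//|/orP [/block_writes|//]]].
  by case/or4P => // /repair_writes.
by move/repair_writes.
Qed.

Lemma classify_silent d : ~~ emits (classify d).
Proof.
have [_ _ _ _ h] := repair_static d.
rewrite /classify /doubling /level /block; move: (repair d) h => p h /=.
by rewrite (negbTE h).
Qed.

Definition init := St (upd (fun=> 0) vN n) (fun _ _ => 0) [::] 0.

Lemma programs_spec d (e : rel 'I_n) : 7 < d ->
  (forall i j : 'I_n, e i j = g i j) ->
  (enumerates_maximal_independent e (ot (eval n g (enum_prog d) init)) /\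
   ck (eval n g (enum_prog d) init) <=
     (1010 + 201 * fcost (repair d)) * n.+1 ^ 2
       + fcost (listing act_emit) * n.+1 ^ 3) /\
  (counts_maximal_independent e (ot (eval n g (count_prog d) init)) /\
   ck (eval n g (count_prog d) init) <=
     (1010 + 201 * fcost (repair d)) * n.+1 ^ 2
       + fcost (listing act_count) * n.+1 ^ 2 + 2).
Proof.
move=> hd eg; rewrite /enum_prog /count_prog.
rewrite (@eval_Sq n g (classify d) (listing act_emit)).
rewrite (@eval_Sq n g (classify d) (Sq (listing act_count) (Out (V vCnt)))).
rewrite (@eval_Sq n g (listing act_count) (Out (V vCnt))).
have [S1 N1 M1 [G1 G2 G3] C1] := @classify_spec d init hd erefl.
have [F1 _ F3] := frame_eval n g (classify d) init.
have Z1 := F1 vCnt (@classify_frame d vCnt erefl).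
have O1 := F3 (classify_silent d).
move: (eval n g (classify d) init) S1 N1 M1 G1 G2 G3 C1 Z1 O1 {F1 F3} =>
  s S1 N1 M1 G1 G2 G3 C1 Z1 O1.
pose l := lab s; pose one x := 0 < ar s aOne x.
have bs : base l one s by [].
have sg u : seg s u = (u < n) by rewrite /seg S1 N1.
have EF u v : u < n -> v < n -> l u -> l v -> ~~ g u v.
  by rewrite -!sg; apply: G1.
have TF u v w : u < n -> v < n -> w < n -> ~~ l u -> ~~ l v -> ~~ l w ->
    coadj u v -> coadj v w -> coadj u w -> False.
  rewrite -!sg => su sv sw lu lv lw.
  by apply: G2; rewrite /inO_seg ?su ?sv ?sw.
have SG u : u < n -> ~~ l u -> one u <-> (forall y, y < n -> ~~ l y -> coadj u y ->
     exists v, [/\ v < n, l v, g y v & ~~ g u v]).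
  rewrite -sg => su lu; rewrite /one; have /G3 -> : inO_seg s u by rewrite /inO_seg su.
  split=> h y.
    rewrite -sg => sy ly uy; have [|v [sv lv yv uv]] := h y _ uy.
      by rewrite /inO_seg sy.
    by exists v; rewrite -sg.
  case/andP=> sy ly uy; rewrite sg in sy; have [v [sv lv yv uv]] := h y sy ly uy.
  by exists v; rewrite sg.
have [U1 U2] := maximal_sets eg EF TF SG.
split; split.
- exists [seq set_of l p | p <- candidates l one]; split=> //.
  have We r : writes act_emit r -> (r == vCnt) || (37 < r < 100).
    by rewrite writes_written !inE; lia.
  have acc0 : emitted l [::] (vr s vCnt) (ot s) by rewrite /emitted O1.
  have := @listing_spec act_emit (emitted l) l one We (fun=> isT)
    (@act_emit_spec l one) s bs acc0.
  rewrite /emitted => ->; congr flatten; rewrite -map_comp; apply: eq_map => p /=.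
  have E : [seq val v | v <- enum (set_of l p)] = [seq v <- iota 0 n | member l p.1 p.2 v].
    by apply: enum_filter => v; rewrite inE.
  by rewrite /code /encode_set -E size_map -cardE.
- have := @eval_cost n g vLen (listing act_emit) s isT isT; rewrite N1.
  by rewrite -[depth _]/3; move: C1; rewrite -[ck init]/0; lia.
- rewrite /counts_maximal_independent -[eval n g (Out _) _]/(tick 2 (emit
    (vr (eval n g (listing act_count) s) vCnt) (eval n g (listing act_count) s))).
  have Wc r : writes act_count r -> (r == vCnt) || (37 < r < 100).
    by move=> /eqP ->.
  have acc0 : counted [::] (vr s vCnt) (ot s).
    by split; [rewrite Z1 min0n|rewrite O1].
  have := @listing_spec act_count counted l one Wc (fun=> isT)
    (@act_count_spec l one) s bs acc0.
  move: (eval n g (listing act_count) s) => s2 [E1 E2].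
  rewrite -[ot _]/(rcons (ot s2) (vr s2 vCnt)) E1 E2 /=.
  congr [:: _]; rewrite (minn_idPl (size_candidates l one)).
  rewrite -(size_map (set_of l)) -(card_uniqP U1); apply: eq_card => U.
  by rewrite !inE U2.
- have := @eval_cost n g vLen (listing act_count) s isT isT; rewrite N1.
  rewrite -[ck (eval n g (Out _) _)]/(2 + ck (eval n g (listing act_count) s)).
  by rewrite -[depth _]/2; move: C1; rewrite -[ck init]/0; lia.
Qed.

End TwoThreshold.

(** * Input encoding, word size and final bounds *)

Lemma classify_wf d : wf (classify d).
Proof.
have [h _ _ _ _] := repair_static d.
have f r : r \in [:: 0; 30; 31] -> writes (repair d) r = false.
  by move=> hr; apply/negP => /repair_writes; rewrite !inE in hr; lia.
move: (f 0 isT) (f 30 isT) (f 31 isT).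
rewrite /classify /doubling /level /block; move: (repair d) h => p h /= f0 f1 f2.
by rewrite f0 f1 f2 h.
Qed.

(** Programs handle numbers, so adjacency is extended by false to all of nat. *)
Definition graph_fun n (e : rel 'I_n) u v :=
  [exists i : 'I_n, exists j : 'I_n, [&& val i == u, val j == v & e i j]].

Lemma graph_funE n (e : rel 'I_n) (i j : 'I_n) : graph_fun e i j = e i j.
Proof.
apply/existsP/idP => [[i' /existsP [j' /and3P [/eqP/val_inj -> /eqP/val_inj ->]]] //|h].
by exists i; apply/existsP; exists j; rewrite !eqxx.
Qed.

Lemma graph_fun_lt n (e : rel 'I_n) u v : graph_fun e u v -> (u < n) && (v < n).
Proof.
by case/existsP=> i /existsP [j /and3P [/eqP <- /eqP <- _]]; rewrite !ltn_ord.
Qed.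

(** The powers of n + 2 leave garbage in two temporaries, about which [sim] says nothing. Arrays
    need no initialisation, as input memory is 0 from [n * n] on. *)
Definition prelude :=
  Seq (Const (tm 0) 2) (Seq (Add (tm 0) rN (tm 0)) (Seq (Mul (tm 1) (tm 0) (tm 0))
    (Seq (Mul rM (tm 1) (tm 0)) (Seq (Const r1 1) (Seq (Const r8 8)
      (Seq (Mul rNN rN rN) (Add (va 0) rN r0))))))).

Lemma prelude_ok n (e : rel 'I_n) B : 10 * cap n + n * n + 8 < B ->
  exists t m, [/\ exec B prelude (input_state e) t m, t <= 8 &
    sim n (graph_fun e) (init n) m].
Proof.
move=> hB.
have h1 : n + 2 <= cap n by rewrite /cap !expnS; nia.
have h2 : (n + 2) * (n + 2) <= cap n by rewrite /cap !expnS expn0; nia.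
exists (1 + (1 + (1 + (1 + (1 + (1 + (1 + 1))))))); eexists; split.
- apply: exec_seq; first by apply: exec_const; lia.
  apply: exec_seq; first by apply: exec_add; rewrite /set_reg /= /upd /tm /=; lia.
  apply: exec_seq; first by apply: exec_mul; rewrite /set_reg /= /upd /tm /=; lia.
  apply: exec_seq.
    by apply: exec_mul; rewrite /set_reg /= /upd /tm /=; move: hB; rewrite /cap !expnS expn0; lia.
  apply: exec_seq; first by apply: exec_const; lia.
  apply: exec_seq; first by apply: exec_const; lia.
  apply: exec_seq; first by apply: exec_mul; rewrite /set_reg /= /upd /tm /=; lia.
  by apply: exec_add; rewrite /set_reg /= /upd /tm /va /=; lia.
- by [].
- split=> //.
  + case=> [|x] /=; first by rewrite /upd /= addn0.
    have ne r : r < 8 \/ r = 9 -> (va x.+1 == r) = false by rewrite /va; lia.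
    by rewrite /upd !ne //; by [left|right].
  + by rewrite /= /upd /= /cap !expnS expn0 muln1 mulnA.
  + move=> i j hi hj; rewrite /= /graph_fun; congr nat_of_bool.
    apply: eq_existsb => i'; apply: eq_existsb => j'; rewrite andbA; congr (_ && _).
    have h' := ltn_ord j'; apply/eqP/andP => [E|[/eqP -> /eqP ->] //].
    (* Quotient and remainder by [n] recover row and column from the address. *)
    have /(congr1 (divn^~ n)) := E; have /(congr1 (modn^~ n)) := E.
    rewrite !divnMDl ?modnMDl ?modn_small ?divn_small ?addn0 //; try lia.
    by move=> -> ->.
  + move=> k i _; apply/eqP; rewrite /= eqb0; apply/negP => /existsP [i' /existsP [j' /andP [/eqP E _]]].
    have := ltn_ord i'; have := ltn_ord j'; nia.
  + by move=> [|x]; rewrite /= /upd /=; lia.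
Qed.

Lemma run_program n (e : rel 'I_n) p : wf p ->
  let s := eval n (graph_fun e) p (init n) in
  exists t m, [/\ exec (n.+2 ^ 8) (Seq prelude (comp p)) (input_state e) t m,
    t <= 8 + ck s & out m = ot s].
Proof.
move=> wp s.
(* The left side is below 20 (n+2)^3, and 2^5 (n+2)^3 is at most (n+2)^8, since the base is at least
   2. *)
have hB : 10 * cap n + n * n + 8 < n.+2 ^ 8.
  rewrite /cap addn2 (expnD n.+2 3 5); have : 2 ^ 5 <= n.+2 ^ 5 by rewrite leq_exp2r.
  have : n * n + 8 < 10 * n.+2 ^ 3 by rewrite !expnS expn0; nia.
  have -> : 2 ^ 5 = 32 by [].
  move: (n.+2 ^ 3) (n.+2 ^ 5) => q r; nia.
have [t1 [m1 [e1 c1 s1]]] := prelude_ok e hB.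
have [t2 [m2 [e2 c2 s2]]] := comp_ok hB wp s1.
exists (t1 + t2), m2; split; first exact: exec_seq e1 e2.
  by move: c2; rewrite -/s -[ck (init n)]/0; lia.
exact: sim_out s2.
Qed.

(** An edge is a two-element set that is not independent, so the threshold condition is applied to
    [[set x; y]]. *)
Lemma threshold_edge (R : realType) (V : finType) (e : rel V) :
  threshold_graph R e -> exists (w : V -> R) (T : R),
  forall x y, e x y = (x != y) && (T < w x + w y)%R.
Proof.
case=> - [sym irr] [w [T [_ _ h]]]; exists w, T => x y.
have [->|ne] := eqVneq x y; first by rewrite irr.
have I : independent e [set x; y] = ~~ e x y.
  apply/forall_inP/idP => [hx|nxy u].
    by have /forall_inP := hx x (set21 x y); apply; rewrite set22.
  rewrite !inE => /orP [] /eqP ->; apply/forall_inP => v; rewrite !inE => /orP [] /eqP ->;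
  by rewrite ?irr // sym.
have := h [set x; y]; rewrite I big_setU1 ?inE //= big_set1 ltNge.
by case: (e x y) => - [h1 h2]; apply/esym; [apply/negP => /h2|rewrite h1].
Qed.

Lemma two_threshold_weights (R : realType) n (e : rel 'I_n) :
  two_threshold_graph R e -> exists (a b : nat -> R) (A B : R),
  forall u v, u < n -> v < n -> graph_fun e u v =
    (u != v) && ((A < a u + a v)%R || (B < b u + b v)%R).
Proof.
case=> e1 [e2 [/threshold_edge [w1 [T1 h1]] /threshold_edge [w2 [T2 h2]] h]].
(* The default 0 is never consulted, as both indices are below [n]. *)
pose ext (w : 'I_n -> R) u := if insub u is Some i then w i else 0%R.
have extE w u (hu : u < n) : ext w u = w (Ordinal hu).
  by rewrite /ext insubT.
exists (ext w1), (ext w2), T1, T2 => u v hu hv.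
rewrite !extE -[graph_fun e u v]/(graph_fun e (Ordinal hu) (Ordinal hv)).
by rewrite graph_funE h h1 h2 -andb_orr.
Qed.

Lemma cubic_bound c1 c2 c3 :
  bigO (fun n => c1 * n.+1 ^ 2 + c2 * n.+1 ^ 3 + c3) (fun n => n ^ 3).
Proof.
exists (4 * c1 + 8 * c2 + c3), 1 => n n1.
have h2 : n.+1 ^ 2 <= 4 * n ^ 3 by rewrite !expnS expn0; nia.
have h3 : n.+1 ^ 3 <= 8 * n ^ 3.
  by rewrite -[8]/(2 ^ 3) -expnMn leq_exp2r //; lia.
have h0 : 0 < n ^ 3 by rewrite expn_gt0 n1.
have := leq_mul (leqnn c1) h2; have := leq_mul (leqnn c2) h3.
have := leq_mul (leqnn c3) h0; lia.
Qed.

Lemma quadratic_bound c1 c2 :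
  bigO (fun n => c1 * n.+1 ^ 2 + c2) (fun n => n ^ 2).
Proof.
exists (4 * c1 + c2), 1 => n n1.
have h2 : n.+1 ^ 2 <= 4 * n ^ 2 by rewrite !expnS expn0; nia.
have h0 : 0 < n ^ 2 by rewrite expn_gt0 n1.
have := leq_mul (leqnn c1) h2; have := leq_mul (leqnn c2) h0; lia.
Qed.

Theorem theorem4p26 (R : realType) :
  computable_in_time (fun n (e : rel 'I_n) => two_threshold_graph R e)
    enumerates_maximal_independent (fun n => n ^ 3) /\
  computable_in_time (fun n (e : rel 'I_n) => two_threshold_graph R e)
    counts_maximal_independent (fun n => n ^ 2).
Proof.
(* Forgetting the value 8 keeps [repair d] from unfolding, which would produce more than 5^8 copies
   of [check]. *)
have [d hd] : exists d, 7 < d by exists 8.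
have spec n (e : rel 'I_n) (te : two_threshold_graph R e) :=
  let: ex_intro a (ex_intro b (ex_intro A (ex_intro B def))) := two_threshold_weights te in
  programs_spec (@graph_fun_lt n e) def hd (fun i j => esym (graph_funE e i j)).
pose c1 := 1010 + 201 * fcost (repair d).
split.
  exists (Seq prelude (comp (enum_prog d))), 8.
  exists (fun n => c1 * n.+1 ^ 2 + fcost (listing act_emit) * n.+1 ^ 3 + 8).
  split=> [|n e te]; first exact: cubic_bound.
  have [[h1 h2] _] := spec n e te.
  have wp : wf (enum_prog d) by apply/andP; split; first exact: classify_wf.
  have [t [m [ex ht ho]]] := run_program e wp.
  exists t, m; split=> //; last by rewrite ho.
  by apply: leq_trans ht _; rewrite addnC leq_add2r.
exists (Seq prelude (comp (count_prog d))), 8.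
exists (fun n => (c1 + fcost (listing act_count)) * n.+1 ^ 2 + 10).
split=> [|n e te]; first exact: quadratic_bound.
have [_ [h1 h2]] := spec n e te.
have wp : wf (count_prog d) by apply/andP; split; first exact: classify_wf.
have [t [m [ex ht ho]]] := run_program e wp.
exists t, m; split=> //; last by rewrite ho.
by apply: leq_trans ht _; rewrite mulnDl; move: h2; rewrite -/c1; lia.
Qed.
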